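(* Let $n\ge2$ be finite, let $P_V\subseteq G_n$ be the open set defined in the context, let $\mathcal V$ be the Volterra nest on $L^2[0,1]$, and let $O_n$ be represented on $L^2[0,1]$ as described in the context. Then $$A(P_V)=O_n\cap\operatorname{Alg}\mathcal V.$$
   Context: Fix a finite $n\ge 2$. $X=\prod_{1}^{\infty}\{1,\dots,n\}$ with the product topology. For a (possibly empty) finite string $\alpha$ in $\{1,\dots,n\}$, $\ell(\alpha)$ is its length, and $\alpha\gamma$ ($\gamma\in X$) is the concatenation. The Cuntz groupoid is $G_n=\{(\alpha\gamma,\ell(\alpha)-\ell(\beta),\beta\gamma)\mid \alpha,\beta \text{ finite strings},\ \gamma\in X\}$ with $(x,k,y)(y,j,z)=(x,k+j,z)$, $(x,k,y)^{-1}=(y,-k,x)$, and topology with basis the (compact open) sets $U_{\alpha,\beta}=\{(\alpha\gamma,\ell(\alpha)-\ell(\beta),\beta\gamma)\mid\gamma\in X\}$. The groupoid C*-algebra $C^*(G_n)$ is the completion of $C_c(G_n)$ (with convolution $f*g(x,k,y)=\sum f(x,k_1,z)g(z,k_2,y)$, the sum over $k_1+k_2=k$ and $z$ with both factors in $G_n$, and $f^*(x,k,y)=\overline{f(y,-k,x)}$) in the groupoid C*-norm. The Cuntz algebra $O_n$, generated by isometries $S_1,\dots,S_n$ with $\sum S_iS_i^*=I$, is identified with $C^*(G_n)$ so that $S_\alpha S_\beta^*$ (where $S_\alpha=S_{\alpha_1}\cdots S_{\alpha_k}$, $S_\emptyset=I$) corresponds to the characteristic function $\chi_{\alpha,\beta}$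 of $U_{\alpha,\beta}$. Since the sup norm is dominated by the C*-norm, elements of $C^*(G_n)$ are viewed as continuous functions on $G_n$ vanishing at infinity. For an open $P\subseteq G_n$, $A(P)=\{f\in C^*(G_n)\mid f \text{ vanishes on } G_n\setminus P\}$. Representation: $O_n$ acts on $L^2[0,1]$ with $S_i$ the isometry induced by the order preserving affine map of $[0,1]$ onto $[\frac{i-1}{n},\frac in]$, i.e. $(S_ih)(t)=\sqrt n\,h(nt-(i-1))$ for $t\in[\frac{i-1}n,\frac in]$ and $0$ otherwise. The Volterra nest $\mathcal V$ is the set of projections $p_x$ of $L^2[0,1]$ onto $L^2[0,x]$, $x\in[0,1]$, and $\operatorname{Alg}\mathcal V$ (the Volterra nest algebra) is the set of bounded operators on $L^2[0,1]$ leaving invariant the range of every $p_x$. Definition of $P_V$ (orders $\prec,\preceq$ are lexicographic): an element of $G_n$ is in $P_V$ if it can be written $(\alpha\gamma,\ell(\alpha)-\ell(\beta),\beta\gamma)$ with $\alpha,\beta$ satisfying one of: (i) $\ell(\alpha)=\ell(\beta)$ and $\alpha\preceq\beta$; (ii) $\ell(\alpha)<\ell(\beta)$ and $\alpha\prec(\beta_1,\dots,\beta_{\ell(\alpha)})$; (iii) $\ell(\alpha)<\ell(\beta)$, $\alpha=(\beta_1,\dots,\beta_{\ell(\alpha)})$ and $\beta_{\ell(\alpha)+1}=\dots=\beta_{\ell(\beta)}=n$; (iv) $\ell(\alpha)>\ell(\beta)$ and $(\alpha_1,\dots,\alpha_{\ell(\beta)})\prec\beta$; (v) $\ell(\alpha)>\ell(\beta)$,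 $(\alpha_1,\dots,\alpha_{\ell(\beta)})=\beta$ and $\alpha_{\ell(\beta)+1}=\dots=\alpha_{\ell(\alpha)}=1$. Equivalently, $P_V$ is the union of $\{(x,k,y)\in G_n\mid x\prec y\}$ (lexicographic order on $X$), $\{(x,0,x)\mid x\in X\}$, $\{(x,k,x)\in G_n\mid k<0,\ x_j=n\text{ for all large }j\}$ and $\{(x,k,x)\in G_n\mid k>0,\ x_j=1\text{ for all large }j\}$. $P_V$ is open in $G_n$. *)

(* Defs.v *)
From HB Require Import structures.
From mathcomp Require Import all_boot all_order all_algebra.
From mathcomp Require Import sesquilinear complex.
From mathcomp Require Import all_classical all_reals all_analysis.
From mathcomp Require Import ring lra zify.
Set Implicit Arguments.
Unset Strict Implicit.
Unset Printing Implicit Defensive.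
Import Order.TTheory GRing.Theory Num.Theory.
Import numFieldNormedType.Exports.
Local Open Scope classical_set_scope.
Local Open Scope quotient_scope.
Local Open Scope ring_scope.

Section ComplexL2.
Context d (T : measurableType d) (R : realType) (mu : {measure set T -> \bar R}).

(* Square-integrable complex functions, through their real and imaginary parts. *)
Definition CLfun2 : {pred T -> R[i]} := [pred f : T -> R[i] |
  ((fun t => complex.Re (f t)) \in Lfun mu 2%:E) &&
  ((fun t => complex.Im (f t)) \in Lfun mu 2%:E)].

Lemma CLfun2_submod_closed : submod_closed CLfun2.
Proof.
have p1 : (1 <= 2%:E :> \bar R)%E by rewrite lee_fin ler1n.
have [L0 LD] := @Lfun_submod_closed _ T R mu _ p1.
have LC a b (f g h : T -> R) : f \in Lfun mu 2%:E -> g \in Lfun mu 2%:E ->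
    h \in Lfun mu 2%:E ->
    (fun t => a * f t + (b * g t + h t)) \in Lfun mu 2%:E.
  by move=> fL gL hL; apply: (LD a f _ fL (LD b g h gL hL)).
split; first by apply/andP; split; exact: L0.
move=> a f g /andP[f1 f2] /andP[g1 g2]; apply/andP; split.
- rewrite (_ : (fun _ => _) = (fun t => complex.Re a * complex.Re (f t) +
    (- complex.Im a * complex.Im (f t) + complex.Re (g t)))); first exact: LC.
  apply/funext => t; rewrite /= !fctE.
  by case: (f t) (g t) a => [x y] [z w] [u v] /=; rewrite addrA mulNr.
- rewrite (_ : (fun _ => _) = (fun t => complex.Re a * complex.Im (f t) +
    (complex.Im a * complex.Re (f t) + complex.Im (g t)))); first exact: LC.
  apply/funext => t; rewrite /= !fctE.
  by case: (f t) (g t) a => [x y] [z w] [u v] /=; rewrite addrA.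
Qed.
HB.instance Definition _ :=
  GRing.isSubmodClosed.Build _ _ CLfun2 CLfun2_submod_closed.

Definition CLfun2Type := {f : T -> R[i] | f \in CLfun2}.
HB.instance Definition _ := SubChoice.on CLfun2Type.
HB.instance Definition _ := [SubChoice_isSubLmodule of CLfun2Type by <:].

Definition CLfun2_ae_eq (f g : CLfun2Type) : bool :=
  `[< {ae mu, forall t, val f t = val g t} >].

Let aeP (f g : CLfun2Type) :
  reflect {ae mu, forall t, val f t = val g t} (CLfun2_ae_eq f g).
Proof. exact: asboolP. Qed.

Lemma CLfun2_ae_eq_refl : reflexive CLfun2_ae_eq.
Proof. by move=> f; apply/aeP; exact: aeW. Qed.

Lemma CLfun2_ae_eq_sym : symmetric CLfun2_ae_eq.
Proof. by move=> f g; apply/aeP/aeP; apply: filterS => t ->. Qed.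

Lemma CLfun2_ae_eq_trans : transitive CLfun2_ae_eq.
Proof.
move=> g f h /aeP fg /aeP gh; apply/aeP.
by apply: filterS2 fg gh => t -> ->.
Qed.

Canonical CLfun2_ae_eq_equiv := EquivRel CLfun2_ae_eq
  CLfun2_ae_eq_refl CLfun2_ae_eq_sym CLfun2_ae_eq_trans.

Definition CL2 : Type := {eq_quot CLfun2_ae_eq}.
HB.instance Definition _ := Choice.on CL2.
HB.instance Definition _ := EqQuotient.on CL2.

Definition CL2_fun (x : CL2) : T -> R[i] := val (repr x).
Coercion CL2_fun : CL2 >-> Funclass.

Lemma CL2_eqP (f g : CLfun2Type) :
  {ae mu, forall t, val f t = val g t} <-> \pi_CL2 f = \pi_CL2 g.
Proof. by split => [/aeP/eqmodP|/eqmodP/aeP]. Qed.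

Lemma CL2_piE (f : CLfun2Type) : {ae mu, forall t, (\pi_CL2 f : CL2) t = val f t}.
Proof. by apply/CL2_eqP; rewrite reprK. Qed.

Lemma CL2_ext (x y : CL2) : {ae mu, forall t, x t = y t} -> x = y.
Proof. by move/CL2_eqP; rewrite !reprK. Qed.

Definition CL2_zero : CL2 := \pi_CL2 0.
Definition CL2_opp (x : CL2) : CL2 := \pi_CL2 (- repr x).
Definition CL2_add (x y : CL2) : CL2 := \pi_CL2 (repr x + repr y).
Definition CL2_scale (a : R[i]) (x : CL2) : CL2 := \pi_CL2 (a *: repr x).

Let zeroE : {ae mu, forall t, CL2_zero t = 0}.
Proof. exact: CL2_piE. Qed.
Let oppE x : {ae mu, forall t, CL2_opp x t = - x t}.
Proof. exact: CL2_piE. Qed.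
Let addE x y : {ae mu, forall t, CL2_add x y t = x t + y t}.
Proof. exact: CL2_piE. Qed.
Let scaleE a x : {ae mu, forall t, CL2_scale a x t = a * x t}.
Proof. exact: CL2_piE. Qed.

Let addA : associative CL2_add.
Proof.
move=> x y z; apply: CL2_ext.
near=> t; rewrite (near (addE _ _) t) // (near (addE _ _) t) //.
by rewrite (near (addE _ _) t) // (near (addE _ _) t) // addrA.
Unshelve. all: by end_near. Qed.

Let addC : commutative CL2_add.
Proof.
move=> x y; apply: CL2_ext; near=> t.
by rewrite (near (addE _ _) t) // (near (addE _ _) t) // addrC.
Unshelve. all: by end_near. Qed.

Let add0 : left_id CL2_zero CL2_add.
Proof.
move=> x; apply: CL2_ext; near=> t.
by rewrite (near (addE _ _) t) // (near zeroE t) // add0r.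
Unshelve. all: by end_near. Qed.

Let addN : left_inverse CL2_zero CL2_opp CL2_add.
Proof.
move=> x; apply: CL2_ext; near=> t.
rewrite (near (addE _ _) t) // (near (oppE _) t) //.
by rewrite (near zeroE t) // addNr.
Unshelve. all: by end_near. Qed.

HB.instance Definition _ := GRing.isZmodule.Build CL2 addA addC add0 addN.

Let scaleA a b x : CL2_scale a (CL2_scale b x) = CL2_scale (a * b) x.
Proof.
apply: CL2_ext; near=> t; rewrite (near (scaleE _ _) t) //.
by rewrite (near (scaleE _ _) t) // (near (scaleE _ _) t) // mulrA.
Unshelve. all: by end_near. Qed.

Let scale1 : left_id 1 CL2_scale.
Proof.
move=> x; apply: CL2_ext; near=> t.
by rewrite (near (scaleE _ _) t) // mul1r.
Unshelve. all: by end_near. Qed.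

Let scaleDr : right_distributive CL2_scale +%R.
Proof.
move=> a x y; apply: CL2_ext; near=> t.
rewrite (near (scaleE _ _) t) // (near (addE _ _) t) // (near (addE _ _) t) //.
by rewrite (near (scaleE _ _) t) // (near (scaleE _ _) t) // mulrDr.
Unshelve. all: by end_near. Qed.

Let scaleDl x : {morph CL2_scale^~ x : a b / a + b >-> a + b}.
Proof.
move=> a b; apply: CL2_ext; near=> t.
rewrite (near (scaleE _ _) t) // (near (addE _ _) t) //.
by rewrite (near (scaleE _ _) t) // (near (scaleE _ _) t) // mulrDl.
Unshelve. all: by end_near. Qed.

HB.instance Definition _ :=
  GRing.Zmodule_isLmodule.Build R[i] CL2 scaleA scale1 scaleDr scaleDl.

Lemma CL2_addE (x y : CL2) : {ae mu, forall t, (x + y : CL2) t = x t + y t}.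
Proof. exact: addE. Qed.

Lemma CL2_scaleE a (x : CL2) : {ae mu, forall t, (a *: x : CL2) t = a * x t}.
Proof. exact: scaleE. Qed.


Definition CL2_dot (x y : CL2) : R[i] :=
  Complex (\int[mu]_t complex.Re (x t * (y t)^*))
          (\int[mu]_t complex.Im (x t * (y t)^*)).

Lemma CL2_fun_Lfun (x : CL2) :
  (fun t => complex.Re (x t)) \in Lfun mu 2%:E /\
  (fun t => complex.Im (x t)) \in Lfun mu 2%:E.
Proof. by apply/andP; exact: (valP (repr x)). Qed.

Let prod_int (f g : T -> R) : f \in Lfun mu 2%:E -> g \in Lfun mu 2%:E ->
  mu.-integrable setT (EFin \o (f \* g)).
Proof. by move=> fL gL; apply/Lfun1_integrable; exact: Lfun2_mul_Lfun1. Qed.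

Lemma CL2_dot_integrable (x y : CL2) :
  mu.-integrable setT (fun t => (complex.Re (x t * (y t)^* ))%:E) /\
  mu.-integrable setT (fun t => (complex.Im (x t * (y t)^* ))%:E).
Proof.
have [x1 x2] := CL2_fun_Lfun x; have [y1 y2] := CL2_fun_Lfun y; split.
- rewrite (_ : (fun _ => _) =
    (fun t => (complex.Re (x t) * complex.Re (y t))%R%:E) \+
    (fun t => (complex.Im (x t) * complex.Im (y t))%R%:E))%E.
    by apply: integrableD => //; exact: prod_int.
  apply/funext => t /=; case: (x t) (y t) => [a b] [c e] /=.
  by rewrite -EFinD mulrN opprK.
- rewrite (_ : (fun _ => _) =
    (fun t => (complex.Im (x t) * complex.Re (y t))%R%:E) \-
    (fun t => (complex.Re (x t) * complex.Im (y t))%R%:E))%E.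
    by apply: integrableB => //; exact: prod_int.
  apply/funext => t /=; case: (x t) (y t) => [a b] [c e] /=.
  by rewrite -EFinB mulrN addrC.
Qed.

Let Rint_ae (f g : T -> R) : mu.-integrable setT (EFin \o f) ->
  mu.-integrable setT (EFin \o g) -> {ae mu, forall t, f t = g t} ->
  \int[mu]_t f t = \int[mu]_t g t.
Proof.
move=> /integrableP[mf _] /integrableP[mg _] fg; congr fine.
by apply: ae_eq_integral => //; apply: filterS fg => t /= -> _.
Qed.

Let iZ (b : R) (f : T -> R) : mu.-integrable setT (EFin \o f) ->
  mu.-integrable setT (EFin \o (fun t => b * f t)).
Proof. by move=> fi; apply: (integrableZl measurableT b fi). Qed.

Let iD (f g : T -> R) : mu.-integrable setT (EFin \o f) ->
  mu.-integrable setT (EFin \o g) ->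
  mu.-integrable setT (EFin \o (fun t => f t + g t)).
Proof. by move=> fi gi; exact: (integrableD measurableT fi gi). Qed.

Let iB (f g : T -> R) : mu.-integrable setT (EFin \o f) ->
  mu.-integrable setT (EFin \o g) ->
  mu.-integrable setT (EFin \o (fun t => f t - g t)).
Proof. by move=> fi gi; exact: (integrableB measurableT fi gi). Qed.

Let dotDZl a (x y z : CL2) :
  CL2_dot (a *: x + y) z = a * CL2_dot x z + CL2_dot y z.
Proof.
have [i1 i2] := CL2_dot_integrable (a *: x + y) z.
have [j1 j2] := CL2_dot_integrable x z.
have [k1 k2] := CL2_dot_integrable y z.
have E : {ae mu, forall t, (a *: x + y : CL2) t * (z t)^* =
    a * (x t * (z t)^* ) + y t * (z t)^* }.
  near=> t; rewrite (near (CL2_addE _ _) t) // (near (CL2_scaleE _ _) t) //.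
  by rewrite mulrDl mulrA.
rewrite /CL2_dot; case: a i1 i2 E => a b i1 i2 E /=; congr Complex.
- transitivity (\int[mu]_t ((a * complex.Re (x t * (z t)^* ) -
      b * complex.Im (x t * (z t)^* )) + complex.Re (y t * (z t)^* ))).
    apply: Rint_ae => //.
      by apply: iD => //; apply: iB; exact: iZ.
    apply: filterS E => t ->.
    by case: (x t * _) (y t * _) => [? ?] [? ?].
  rewrite RintegralD //; last by apply: iB; exact: iZ.
  rewrite RintegralB //; [|exact: iZ|exact: iZ].
  by rewrite !RintegralZl.
- transitivity (\int[mu]_t ((a * complex.Im (x t * (z t)^* ) +
      b * complex.Re (x t * (z t)^* )) + complex.Im (y t * (z t)^* ))).
    apply: Rint_ae => //.
      by apply: iD => //; apply: iD; exact: iZ.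
    apply: filterS E => t ->.
    by case: (x t * _) (y t * _) => [? ?] [? ?].
  rewrite RintegralD //; last by apply: iD; exact: iZ.
  rewrite RintegralD //; [|exact: iZ|exact: iZ].
  by rewrite !RintegralZl.
Unshelve. all: by end_near. Qed.

Let dotC (x y : CL2) : CL2_dot x y = (-1) ^+ false * (CL2_dot y x)^*.
Proof.
have [i1 i2] := CL2_dot_integrable y x.
rewrite expr0 mul1r /CL2_dot /=; congr Complex.
  congr fine; apply: eq_integral => t _; congr EFin.
  by case: (x t) (y t) => [a b] [c e] /=; rewrite !mulrN !opprK mulrC (mulrC b).
rewrite -mulN1r -RintegralZl //; congr fine; apply: eq_integral => t _.
congr EFin; case: (x t) (y t) => [a b] [c e] /=.
by rewrite mulN1r opprD !mulrN opprK addrC (mulrC b) (mulrC a).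
Qed.

Let dot_bilinear : bilinear_for (GRing.Scale.Law.clone _ _ *%R _)
  (GRing.Scale.Law.clone _ _ (Num.conj_op \; *%R) _) CL2_dot.
Proof.
split => [z|x] a u v /=; first exact: dotDZl.
rewrite dotC dotDZl expr0 mul1r rmorphD rmorphM /=.
by rewrite [in RHS](dotC x u) [in RHS](dotC x v) !expr0 !mul1r.
Qed.

HB.instance Definition _ := bilinear_isBilinear.Build R[i] CL2 CL2 R[i] _ _
  CL2_dot dot_bilinear.
HB.instance Definition _ :=
  isHermitianSesquilinear.Build R[i] CL2 false Num.conj_op CL2_dot dotC.

Let dot_gt0 (u : CL2) : u != 0 -> 0 < CL2_dot u u.
Proof.
have [i1 _] := CL2_dot_integrable u u.
have Im0 t : complex.Im (u t * (u t)^* ) = 0.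
  by case: (u t) => a b /=; rewrite mulrN mulrC addNr.
have Re0 t : 0 <= complex.Re (u t * (u t)^* ).
  by case: (u t) => a b /=; rewrite mulrN opprK addr_ge0 // -expr2 sqr_ge0.
move=> u0; rewrite ltcE /=.
have -> : \int[mu]_t complex.Im (u t * (u t)^* ) = 0.
  rewrite /Rintegral (eq_integral (cst 0%E)) ?integral0 //.
  by move=> t _; rewrite Im0.
rewrite eqxx /= lt_def Rintegral_ge0 // andbT; apply: contra u0 => /eqP I0.
apply/eqP/CL2_ext.
have /ae_eq_integral_abs : (\int[mu]_t `|(complex.Re (u t * (u t)^* ))%:E| = 0)%E.
  rewrite (eq_integral (fun t => (complex.Re (u t * (u t)^* ))%:E)).
    rewrite -[LHS]fineK; last exact: integrable_fin_num.
    by rewrite -[fine _]/(Rintegral _ _ _) I0.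
  by move=> t _; rewrite gee0_abs // lee_fin.
move=> /(_ measurableT (measurable_int _ i1)) H.
have Z := CL2_piE (0 : CLfun2Type).
near=> t; have -> : (0 : CL2) t = 0 by near: t; exact: Z.
have : complex.Re (u t * (u t)^* ) = 0.
  apply: EFin_inj.
  by near: t; apply: filterS H => t /(_ I).
case: (u t) => a b /=; rewrite mulrN opprK -!expr2 => /eqP.
by rewrite paddr_eq0 ?sqr_ge0 // !sqrf_eq0 => /andP[/eqP -> /eqP ->].
Unshelve. all: by end_near. Qed.
HB.instance Definition _ := isDotProduct.Build R[i] CL2 CL2_dot dot_gt0.

End ComplexL2.

Record prehilbert (R : realType) := PreHilbert {
  hcarrier :> lmodType R[i];
  hform : {dot hcarrier for @Num.conj_op R[i]} }.

Section HilbertOperators.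
Context (R : realType) (H : prehilbert R).
Implicit Types (u v : H) (T U : H -> H) (B : set (H -> H)).
Local Notation "''[' u , v ]" := (hform H u v).

Definition hnorm u : R := Num.sqrt (complex.Re '[u, u]).

Lemma hform_norm u : '[u, u] = (hnorm u ^+ 2)%:C%C.
Proof.
have /andP[/eqP I0 R0] : (complex.Im '[u, u] == 0) && (0 <= complex.Re '[u, u]).
  by have := dnorm_ge0 (hform H) u; rewrite lecE.
by rewrite sqr_sqrtr //; case: '[u, u] I0 => a b /= ->.
Qed.

Lemma hnorm0 : hnorm 0 = 0.
Proof. by rewrite /hnorm linear0r sqrtr0. Qed.

Lemma hnormN u : hnorm (- u) = hnorm u.
Proof. by rewrite /hnorm linearNl linearNr opprK. Qed.

Lemma hnorm_eq0 u : hnorm u = 0 -> u = 0.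
Proof.
move=> u0; apply/eqP; rewrite -(dnorm_eq0 (hform H)) hform_norm u0.
by rewrite expr0n.
Qed.

Lemma ler_hnormD u v : hnorm (u + v) <= hnorm u + hnorm v.
Proof.
have [/hnorm_eq0 ->|u0] := eqVneq (hnorm u) 0; first by rewrite hnorm0 !add0r.
have [/hnorm_eq0 ->|v0] := eqVneq (hnorm v) 0; first by rewrite hnorm0 !addr0.
have pu : 0 < hnorm u by rewrite lt_def u0 sqrtr_ge0.
have pv : 0 < hnorm v by rewrite lt_def v0 sqrtr_ge0.
have Q (a b : R) : complex.Re '[a%:C%C *: u + b%:C%C *: v,
    a%:C%C *: u + b%:C%C *: v] = a ^+ 2 * hnorm u ^+ 2 +
    b ^+ 2 * hnorm v ^+ 2 + a * b * (complex.Re '[u, v] *+ 2).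
  rewrite dnormD !dnormZ linearZl_LR linearZr_LR /= !hform_norm.
  by rewrite !normCK; case: '[u, v] => x y /=; ring.
have Q0 : 0 <= complex.Re '[(hnorm v)%:C%C *: u + (- hnorm u)%:C%C *: v,
    (hnorm v)%:C%C *: u + (- hnorm u)%:C%C *: v].
  by rewrite hform_norm /= sqr_ge0.
have {Q0} CS : complex.Re '[u, v] <= hnorm u * hnorm v.
  rewrite Q in Q0; rewrite -(ler_pM2l (mulr_gt0 pu pv)).
  by move: Q0; nra.
rewrite -(ler_pXn2r (ltn0Sn 1)) ?nnegrE ?addr_ge0 ?sqrtr_ge0 //.
have := Q 1 1; rewrite !scale1r hform_norm /= => ->.
by move: CS; nra.
Qed.

End HilbertOperators.

Section OperatorAlgebras.
Context (R : realType) (H : prehilbert R).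
Implicit Types (u v : H) (T U : H -> H) (B : set (H -> H)).

Definition hcomplete := forall u : nat -> H,
  (forall e : R, 0 < e -> exists N, forall i j, (N <= i)%N -> (N <= j)%N ->
    hnorm (u i - u j) < e) ->
  exists l, (fun k => hnorm (u k - l)) @ \oo --> (0 : R).

Definition bounded_op T :=
  linear T /\ exists M : R, forall u, hnorm (T u) <= M * hnorm u.

(* Unique when it exists, since the form is nondegenerate. *)
Definition adjoint T : H -> H :=
  xget (fun=> 0) [set T' | forall u v, hform H (T u) v = hform H u (T' v)].

(* Convergence in operator norm. *)
Definition op_cvg (T_ : nat -> H -> H) T := forall e : R, 0 < e ->
  exists N, forall k, (N <= k)%N -> forall u,
    hnorm (T_ k u - T u) <= e * hnorm u.

Definition cstar_subalgebra B :=
  [/\ B `<=` bounded_op,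
      forall (a : R[i]) T U, B T -> B U -> B (fun u => a *: T u + U u),
      forall T U, B T -> B U -> B (T \o U),
      forall T, B T -> B (adjoint T) &
      forall (T_ : nat -> H -> H) T, (forall k, B (T_ k)) -> bounded_op T -> op_cvg T_ T -> B T].

Definition cstar_generated (S : set (H -> H)) : set (H -> H) :=
  [set T | forall B, cstar_subalgebra B -> S `<=` B -> B T].

Definition nest_algebra (N : set (H -> H)) : set (H -> H) :=
  [set T | bounded_op T /\
           forall p, N p -> forall u, range p u -> range p (T u)].

End OperatorAlgebras.

Section CuntzGroupoid.
Context (n : nat).
Local Notation word := (seq 'I_n).

(* The letters from 1 to n are encoded by the ordinals from 0 to n - 1. *)
Definition path_space := nat -> 'I_n.
HB.instance Definition _ := Choice.on path_space.

Definition wcat (w : word) (x : path_space) : path_space :=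
  fun k => if (k < size w)%N then nth (x 0) w k else x (k - size w)%N.

Definition cuntz_triple (w v : word) (x : path_space) :
    path_space * int * path_space :=
  (wcat w x, (size w)%:Z - (size v)%:Z, wcat v x).

Record cuntz_groupoid := CuntzGroupoid {
  gtriple : path_space * int * path_space;
  gtripleP : `[< exists w v x, gtriple = cuntz_triple w v x >] }.
HB.instance Definition _ := [isSub for gtriple].
HB.instance Definition _ := [Choice of cuntz_groupoid by <:].
Local Notation G := cuntz_groupoid.

Definition grng (g : G) : path_space := (gtriple g).1.1.
Definition gdeg (g : G) : int := (gtriple g).1.2.
Definition gsrc (g : G) : path_space := (gtriple g).2.

Definition gcylinder (w v : word) : set G :=
  [set g | exists x, gtriple g = cuntz_triple w v x].

(* The open sets are the unions of the sets gcylinder w v, which form a base by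
   gopenI below. *)
Definition gopen : set (set G) := [set A | forall g, A g ->
  exists w v, gcylinder w v g /\ gcylinder w v `<=` A].

Lemma gopenT : gopen setT.
Proof.
move=> g _; have /asboolP[w [v [x E]]] := gtripleP g.
by exists w, v; split => //; exists x.
Qed.

Lemma gcylinder_sub (w v w' v' : word) (g : G) : (size w <= size w')%N ->
  gcylinder w v g -> gcylinder w' v' g -> gcylinder w' v' `<=` gcylinder w v.
Proof.
move=> le_ww' [x gx] [x' gx'] h [y hy].
have [Ew Ed Ev] : cuntz_triple w v x = cuntz_triple w' v' x' by rewrite -gx -gx'.
rewrite /gcylinder /= hy; clear g gx gx' h hy.
have Es : (size w + size v' = size w' + size v)%N by lia.
have le_vv' : (size v <= size v')%N by lia.
have eqw k : wcat w x k = wcat w' x' k by rewrite Ew.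
have eqv k : wcat v x k = wcat v' x' k by rewrite Ev.
have head (u : word) (a b : path_space) k : (k < size u)%N ->
    wcat u a k = wcat u b k.
  by move=> ku; rewrite /wcat ku; exact: set_nth_default.
have tail (u : word) (a : path_space) k : wcat u a (size u + k)%N = a k.
  by rewrite /wcat ltnNge leq_addr addKn.
exists (fun k => wcat w' y (size w + k)%N); congr (_, _, _); last 1 first.
- apply/funext => k; have [kv|vk] := ltnP k (size v).
    rewrite (head v _ x) // eqv; apply: head; exact: leq_trans kv le_vv'.
  rewrite -(subnKC vk) tail; set j := (k - size v)%N.
  have [jw|wj] := ltnP (size w + j)%N (size w').
    rewrite (head v' _ x') -?eqv ?tail; last by lia.
    by rewrite (head w' _ x') // -eqw tail.
  have -> : (size w + j = size w' + (size w + j - size w'))%N by lia.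
  rewrite tail -[RHS](tail v' y); congr (wcat v' y); lia.
- apply/funext => k; have [kw|wk] := ltnP k (size w).
    rewrite (head w _ x) // eqw; apply: head; exact: leq_trans kw le_ww'.
  by rewrite -(subnKC wk) tail.
- by move: Ed; lia.
Qed.

Lemma gopenI A B : gopen A -> gopen B -> gopen (A `&` B).
Proof.
move=> oA oB g [/oA[w [v [wv sA]]] /oB[w' [v' [wv' sB]]]].
have [le_ww'|/ltnW le_w'w] := leqP (size w) (size w').
- exists w', v'; split=> // h hh; split; last exact: sB.
  by apply/sA/(gcylinder_sub le_ww' wv wv').
- exists w, v; split=> // h hh; split; first exact: sA.
  by apply/sB/(gcylinder_sub le_w'w wv' wv).
Qed.

Lemma gopen_bigU (I : Type) (f : I -> set G) :
  (forall i, gopen (f i)) -> gopen (\bigcup_i f i).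
Proof.
move=> fo g [i _ /(fo i)[w [v [gwv wvf]]]]; exists w, v; split => //.
by move=> h /wvf fh; exists i.
Qed.

HB.instance Definition _ :=
  isOpenTopological.Build cuntz_groupoid gopenT gopenI gopen_bigU.

Lemma ginv_subproof (g : G) :
  `[< exists w v x, (gsrc g, - gdeg g, grng g) = cuntz_triple w v x >].
Proof.
case: g => g /= gP; have /asboolP[w [v [x E]]] := gP; apply/asboolP.
by exists v, w, x; rewrite /gsrc /gdeg /grng /= E /cuntz_triple /= opprB.
Qed.
Definition ginv (g : G) : G := CuntzGroupoid (ginv_subproof g).

(* The pairs of composable elements with product g. *)
Definition gfactor (g : G) : set (G * G) :=
  [set p | [/\ grng p.1 = grng g, gsrc p.1 = grng p.2, gsrc p.2 = gsrc g &
               gdeg p.1 + gdeg p.2 = gdeg g]].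

(* The admissible pairs, in the order: equal lengths; w shorter with w before
   the prefix of v; w a prefix of v, continued in v by the last letter only; v
   shorter with the prefix of w before v; v a prefix of w, continued in w by the
   first letter only. The lexicographic order of seqlexi is only used between
   words of equal length. *)
Definition volterra_pair (w v : word) : Prop :=
  [\/ size w = size v /\ ((w : seqlexi 'I_n) <= v)%O,
      (size w < size v)%N /\ ((w : seqlexi 'I_n) < take (size w) v)%O |
  [\/ [/\ (size w < size v)%N, w = take (size w) v &
        all (fun i : 'I_n => i == n.-1 :> nat) (drop (size w) v)],
      (size v < size w)%N /\ ((take (size v) w : seqlexi 'I_n) < v)%O |
      [/\ (size v < size w)%N, take (size v) w = v &
        all (fun i : 'I_n => i == 0 :> nat) (drop (size v) w)]]].

Definition PV : set G :=
  [set g | exists w v x, gtriple g = cuntz_triple w v x /\ volterra_pair w v].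

End CuntzGroupoid.

Section GroupoidCstar.
Context (R : realType) (n : nat).
Local Notation G := (cuntz_groupoid n).
Implicit Types f g : G -> R[i].

Definition Cc : set (G -> R[i]) :=
  [set f : G -> R[i] | [/\ continuous (fun x => complex.Re (f x)),
               continuous (fun x => complex.Im (f x)) &
               compact (closure [set x | f x != 0])]].

(* The sum has only finitely many nonzero terms when f and g are in Cc. *)
Definition conv f g : G -> R[i] :=
  fun x => \sum_(p \in gfactor x) f p.1 * g p.2.

Definition gstar f : G -> R[i] := fun x => (f (ginv x))^*.

Definition star_rep (H : prehilbert R) (rho : (G -> R[i]) -> H -> H) :=
  [/\ forall f, Cc f -> bounded_op (rho f),
      forall a f g, Cc f -> Cc g ->
        rho (a *: f + g) = (fun u => a *: rho f u + rho g u),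
      forall f g, Cc f -> Cc g -> rho (conv f g) = rho f \o rho g &
      forall f, Cc f -> forall u v,
        hform H (rho f u) v = hform H u (rho (gstar f) v)].

(* The full groupoid norm: the supremum of the operator norms over all
   *-representations on Hilbert spaces. *)
Definition cstar_norm f : \bar R :=
  ereal_sup [set r | exists (H : prehilbert R) (rho : (G -> R[i]) -> H -> H) u,
    [/\ hcomplete H, star_rep rho, hnorm u <= 1 & r = (hnorm (rho f u))%:E]].

Lemma star_repB (H : prehilbert R) (rho : (G -> R[i]) -> H -> H) f g u :
  star_rep rho -> Cc f -> Cc g -> rho (f - g) u = rho f u - rho g u.
Proof.
move=> [_ L _ _] fc gc; have := L (-1) g f gc fc.
by rewrite scaleN1r addrC => ->; rewrite scaleN1r addrC.
Qed.

Lemma cstar_normBB f : Cc f -> (cstar_norm (f - f)%R <= 0)%E.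
Proof.
move=> fc; apply: ge_ereal_sup => _ [H [rho [u [_ rh _ ->]]]].
by rewrite star_repB // subrr hnorm0.
Qed.

Lemma cstar_normBC f g : Cc f -> Cc g -> cstar_norm (f - g) = cstar_norm (g - f).
Proof.
move=> fc gc; congr ereal_sup; apply/seteqP; split => _ [H [rho [u [hH rh u1 ->]]]];
  exists H, rho, u; split => //; rewrite !star_repB //;
  by rewrite -hnormN opprB.
Qed.

Lemma cstar_normB_triangle f g h : Cc f -> Cc g -> Cc h ->
  (cstar_norm (f - h)%R <= cstar_norm (f - g)%R + cstar_norm (g - h)%R)%E.
Proof.
move=> fc gc hc; apply: ge_ereal_sup => _ [H [rho [u [hH rh u1 ->]]]].
rewrite star_repB // -(subrKA (rho g u)).
apply: (@le_trans _ _ ((hnorm (rho f u - rho g u))%:E +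
  (hnorm (rho g u - rho h u))%:E)%E); first by rewrite -EFinD lee_fin ler_hnormD.
by apply: leeD; apply: ereal_sup_ubound; exists H, rho, u; rewrite star_repB.
Qed.

(* The C*-algebra of the groupoid, CstarG below, is the completion of Cc for
   cstar_norm: Cauchy sequences modulo null sequences. *)
Record cauchy_seq := CauchySeq {
  cseq :> nat -> G -> R[i];
  cseq_Cc : forall k, Cc (cseq k);
  cseq_cauchy : forall e : R, 0 < e -> exists N, forall i j,
    (N <= i)%N -> (N <= j)%N -> (cstar_norm (cseq i - cseq j)%R < e%:E)%E }.
HB.instance Definition _ := gen_eqMixin cauchy_seq.
HB.instance Definition _ := gen_choiceMixin cauchy_seq.

Definition cauchy_equiv (s t : cauchy_seq) : bool :=
  `[< forall e : R, 0 < e -> exists N, forall k, (N <= k)%N ->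
      (cstar_norm (s k - t k)%R < e%:E)%E >].

Lemma cauchy_equiv_refl : reflexive cauchy_equiv.
Proof.
move=> s; apply/asboolP => e e0; exists 0%N => k _.
by apply: (le_lt_trans (cstar_normBB (cseq_Cc s k))); rewrite lte_fin.
Qed.

Lemma cauchy_equiv_sym : symmetric cauchy_equiv.
Proof.
move=> s t; apply/asboolP/asboolP => st e /st[N HN]; exists N => k /HN.
  by rewrite cstar_normBC //; exact: cseq_Cc.
by rewrite cstar_normBC //; exact: cseq_Cc.
Qed.

Lemma cauchy_equiv_trans : transitive cauchy_equiv.
Proof.
move=> t s r /asboolP st /asboolP tr; apply/asboolP => e e0.
have e2 : 0 < e / 2 by rewrite divr_gt0.
have [N HN] := st _ e2; have [M HM] := tr _ e2.
exists (maxn N M) => k; rewrite geq_max => /andP[/HN sk /HM tk].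
apply: (le_lt_trans (cstar_normB_triangle (cseq_Cc s k) (cseq_Cc t k) (cseq_Cc r k))).
by rewrite [e]splitr EFinD lteD.
Qed.

Canonical cauchy_equiv_rel := EquivRel cauchy_equiv
  cauchy_equiv_refl cauchy_equiv_sym cauchy_equiv_trans.

Definition CstarG : Type := {eq_quot cauchy_equiv}.
HB.instance Definition _ := Choice.on CstarG.
HB.instance Definition _ := EqQuotient.on CstarG.

(* The sup norm is dominated by the C*-norm, so that the limit exists and does
   not depend on the representative. *)
Definition cstar_fun (a : CstarG) (x : G) : R[i] :=
  Complex (limn (fun k => complex.Re ((repr a : cauchy_seq) k x)))
          (limn (fun k => complex.Im ((repr a : cauchy_seq) k x))).

Definition vanishing_off (P : set G) : set CstarG :=
  [set a | forall x, ~ P x -> cstar_fun a x = 0].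

Definition chi (w v : seq 'I_n) : G -> R[i] :=
  fun x => (`[< gcylinder w v x >])%:R.

End GroupoidCstar.

Section VolterraRepresentation.
Context (R : realType).

Definition I01 : {measure set (measurableTypeR R) -> \bar R} :=
  mrestr (@lebesgue_measure R) (measurable_itv `[0%R, 1%R]).

Definition L2I : prehilbert R :=
  PreHilbert (@CL2_dot _ (measurableTypeR R) R I01 : {dot CL2 I01 for _}).

(* Class of f, or 0 when f is not square integrable; this default is never used
   below, as the functions to which L2I_of is applied are square integrable. *)
Definition L2I_of (f : R -> R[i]) : L2I :=
  \pi_(CL2 I01) (insubd (0 : CLfun2Type I01) f).

Definition volterra_proj (x : R) (h : L2I) : L2I :=
  L2I_of (fun t => if (0 <= t <= x)%R then (h : CL2 I01) t else 0).

Definition volterra_nest : set (L2I -> L2I) :=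
  [set p | exists2 x : R, 0 <= x <= 1 & p = volterra_proj x].

Context (n : nat).

(* With the letters encoded from 0, the interval of the letter i is
   [i / n, (i + 1) / n]. *)
Definition cuntz_isometry (i : 'I_n) (h : L2I) : L2I :=
  L2I_of (fun t => if (i%:R / n%:R <= t <= i.+1%:R / n%:R)%R
    then (Num.sqrt n%:R)%:C%C * (h : CL2 I01) (n%:R * t - i%:R) else 0).

Definition cuntz_word (w : seq 'I_n) : L2I -> L2I :=
  foldr (fun i T => cuntz_isometry i \o T) id w.

Definition cuntz_algebra : set (L2I -> L2I) :=
  cstar_generated (range cuntz_isometry).

(* A formal combination of pairs (w, v), read as chi w v by poly_fun and as
   S_w S_v^* by poly_op. *)
Definition cuntz_poly := seq (R[i] * (seq 'I_n * seq 'I_n)).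

Definition poly_fun (c : cuntz_poly) : cuntz_groupoid n -> R[i] :=
  \sum_(m <- c) m.1 *: chi R m.2.1 m.2.2.

Definition poly_op (c : cuntz_poly) : L2I -> L2I :=
  fun h => \sum_(m <- c) m.1 *: cuntz_word m.2.1 (adjoint (cuntz_word m.2.2) h).

(* The graph of the isomorphism from CstarG onto cuntz_algebra that maps each
   chi w v to S_w S_v^*: isomorphisms of C*-algebras are isometric and the span
   of the functions chi w v is dense, so that its graph is the closure of its
   restriction to that span. *)
Definition cuntz_identified (a : CstarG R n) (T : L2I -> L2I) :=
  exists (s : cauchy_seq R n) (c : nat -> cuntz_poly),
    [/\ a = \pi_(CstarG R n) s, forall k, cseq s k = poly_fun (c k) &
        op_cvg (fun k => poly_op (c k)) T].

End VolterraRepresentation.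

Arguments PV : clear implicits.
Arguments volterra_nest : clear implicits.
Arguments cuntz_algebra : clear implicits.

(* Main.v *)
(* Call E_w = S_w S_w^* the multiplication by the indicator of the interval of the
   word w. An operator A lies in Alg V if and only if E_w A E_v = 0 for all words w, v
   of equal length with v before w.

   A polynomial in the S_w S_v^* has the same norm in every family that satisfies the
   Cuntz relations and admits vacuum vectors. Up to a factor linear in the degree,
   this norm is determined by the norms of matrices of coefficients, and the factor
   disappears on passing to high powers of c^* c. Hence the operator norm on L^2[0,1],
   the C*-norm and the norm in the regular representation on l^2(X * Z) agree on
   polynomials, and the values of a function on the groupoid are the matrix entries
   of its operator in the regular representation.

   In function terms, E_w A E_v is the restriction to the elements with range in the
   cylinder of w and source in that of v. For v before w, none of them lies in P_V, so
   that the restriction of a function of A(P_V) is zero. Conversely, each basic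
   neighbourhood of an element g outside P_V contains such an element h for some w and
   v, the function of an operator in Alg V vanishes at h, and the approximating
   polynomials are constant near g, so that the function vanishes at g. *)
Require Import Defs.
From HB Require Import structures.
From mathcomp Require Import all_boot all_order all_algebra.
From mathcomp Require Import sesquilinear complex.
From mathcomp Require Import all_classical all_reals all_analysis.
From mathcomp Require Import measurable_realfun.
From mathcomp Require Import ring lra zify.
Set Implicit Arguments.
Unset Strict Implicit.
Unset Printing Implicit Defensive.
Import Order.TTheory GRing.Theory Num.Theory.
Import numFieldNormedType.Exports.
Local Open Scope classical_set_scope.
Local Open Scope ring_scope.

(** * Inner products and bounded operators *)

(** The C*-norm is a supremum over all representations, about which nothing is known except the
    relations between the operators of the [chi w v]; these relations are what [cuntz_family]
    records. The ranges of the isometries of such a family exhaust the range of its unit, so there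
    is no vacuum in the strict sense. But a given polynomial only moves words up to some finite
    length, and for those it is enough that finitely many vectors S_w u are orthonormal, which a
    Cuntz family can offer. The comparison is one-sided: vacua are required of the family in which a
    bound is known, not of the one to which it is transferred. Hence they are constructed in the two
    concrete representations and nowhere else.

    A second obstacle lies in passing from functions to operators. That a function vanishes
    somewhere only says that single matrix entries of the approximating polynomials tend to zero,
    whereas a limit in norm is wanted; the Cauchy property in norm bridges the gap. *)

Lemma conj_real (R : realType) (x : R) : (x%:C%C)^* = x%:C%C :> R[i].
Proof. exact: conjc_real. Qed.

Section Prehilbert.
Context (R : realType) (H : prehilbert R).
Implicit Types (u v h k : H).
Local Notation "''[' u , v ]" := (hform H u v).

Lemma hformC u v : '[u, v] = ('[v, u])^*.
Proof. by rewrite (hermC (hform H)) /= expr0 mul1r. Qed.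

Lemma hformDl u v h : '[u + v, h] = '[u, h] + '[v, h].
Proof. exact: linearDl. Qed.
Lemma hformDr u v h : '[h, u + v] = '[h, u] + '[h, v].
Proof. exact: linearDr. Qed.
Lemma hformBl u v h : '[u - v, h] = '[u, h] - '[v, h].
Proof. exact: linearBl. Qed.
Lemma hformBr u v h : '[h, u - v] = '[h, u] - '[h, v].
Proof. exact: linearBr. Qed.
Lemma hformZl a u h : '[a *: u, h] = a * '[u, h].
Proof. exact: linearZl_LR. Qed.
Lemma hformZr a u h : '[h, a *: u] = a^* * '[h, u].
Proof. exact: linearZr_LR. Qed.
Lemma hform0l h : '[0, h] = 0.
Proof. exact: linear0l. Qed.
Lemma hform0r h : '[h, 0] = 0.
Proof. exact: linear0r. Qed.
Lemma hform_suml (I : Type) (r : seq I) (P : pred I) (F : I -> H) h :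
  '[\sum_(i <- r | P i) F i, h] = \sum_(i <- r | P i) '[F i, h].
Proof. exact: linear_sumlz. Qed.
Lemma hform_sumr (I : Type) (r : seq I) (P : pred I) (F : I -> H) h :
  '[h, \sum_(i <- r | P i) F i] = \sum_(i <- r | P i) '[h, F i].
Proof. exact: linear_sumr. Qed.

Lemma hnorm_ge0 u : 0 <= hnorm u.
Proof. exact: sqrtr_ge0. Qed.

Lemma hform_ge0 u : 0 <= '[u, u].
Proof. exact: dnorm_ge0. Qed.

Lemma hformI u v : (forall h, '[h, u] = '[h, v]) -> u = v.
Proof.
move=> uv; apply/eqP; rewrite -subr_eq0 -(dnorm_eq0 (hform H)).
by rewrite hformBr uv subrr.
Qed.

Lemma hnorm_sqr_le u (M : R) : '[u, u] <= M%:C%C -> hnorm u ^+ 2 <= M.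
Proof. by rewrite hform_norm lecR. Qed.

Lemma cauchy_schwarz u v : `|'[u, v]| <= (hnorm u * hnorm v)%:C%C.
Proof.
have [/hnorm_eq0 ->|v0] := eqVneq (hnorm v) 0.
  by rewrite hform0r normr0 ler0c mulr_ge0 ?hnorm_ge0.
have vv : 0 < '[v, v].
  by rewrite hform_norm -[0]/(0%:C%C) ltcR exprn_gt0 // lt_def v0 hnorm_ge0.
have := hform_ge0 (u - ('[u, v] / '[v, v]) *: v).
rewrite hformBl !hformBr hformZl !hformZr hformZl.
rewrite [in '[v, u]]hformC.
set a := '[u, v]; set b := '[v, v] in vv *.
have -> : (a / b)^* = a^* / b.
  by rewrite rmorphM fmorphV /= /b -hformC.
have -> : '[u, u] - a^* / b * a - (a / b * a^* - a^* / b * (a / b * b)) =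
    '[u, u] - a * a^* / b by rewrite divfK ?gt_eqF //; ring.
rewrite subr_ge0 ler_pdivrMr // -normCK /b !hform_norm -rmorphM /=.
rewrite -exprMn => ab.
rewrite -(ler_pXn2r (ltn0Sn 1)) ?nnegrE ?normr_ge0 ?ler0c ?mulr_ge0 ?hnorm_ge0 //.
by move: ab; rewrite rmorphXn.
Qed.

(** The form in which Cauchy-Schwarz is used below: a value of the form is recognized as the square
    of some norm, and one factor is then cancelled. *)
Lemma hform_le_norm u v (M : R) : '[u, v] = M%:C%C -> M <= hnorm u * hnorm v.
Proof.
move=> E; have := cauchy_schwarz u v; rewrite E normc_def /= expr0n addr0.
by rewrite sqrtr_sqr lecR; apply: le_trans; exact: ler_norm.
Qed.

(** From ||U h||^2 = <T U h, h> <= e ||U h|| ||h||, on dividing by ||U h||. No bound of [U] is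
    presupposed. *)
Lemma adjoint_bound (T U : H -> H) (e : R) : 0 <= e -> (forall u v, '[T u, v] = '[u, U v]) ->
  (forall h, hnorm (T h) <= e * hnorm h) -> forall h, hnorm (U h) <= e * hnorm h.
Proof.
move=> e0 TU Te h; have E : '[T (U h), h] = (hnorm (U h) ^+ 2)%:C%C.
  by rewrite TU hform_norm.
have := hform_le_norm E; have [->|z0] := eqVneq (hnorm (U h)) 0.
  by rewrite mulr_ge0 ?hnorm_ge0.
have zp : 0 < hnorm (U h) by rewrite lt_def z0 hnorm_ge0.
move=> /le_trans /(_ (ler_wpM2r (hnorm_ge0 h) (Te _))).
by rewrite expr2 mulrAC ler_pM2r.
Qed.

Lemma hnormZ a u : hnorm (a *: u) = complex.Re `|a| * hnorm u.
Proof.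
have r0 : 0 <= complex.Re `|a| by rewrite normc_def /= sqrtr_ge0.
apply/eqP; rewrite -(eqrXn2 (ltn0Sn 1)) ?mulr_ge0 ?hnorm_ge0 //.
apply/eqP/complexI; rewrite -hform_norm hformZl hformZr mulrA -normCK.
by rewrite hform_norm exprMn [RHS]rmorphM [X in _ = X * _]rmorphXn.
Qed.

Lemma hnorm_sum (I : Type) (r : seq I) (P : pred I) (F : I -> H) :
  hnorm (\sum_(i <- r | P i) F i) <= \sum_(i <- r | P i) hnorm (F i).
Proof.
elim/big_rec2: _ => [|i x y _ le_xy]; first by rewrite hnorm0.
by apply: le_trans (ler_hnormD _ _) _; rewrite lerD2l.
Qed.

Lemma hnormBC u v : hnorm (u - v) = hnorm (v - u).
Proof. by rewrite -Defs.hnormN opprB. Qed.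

(** The vectors may be dependent: one that already lies in the span adds nothing to the orthonormal
    family, and otherwise its normalized residual [r] is appended. *)
Lemma gram_schmidt (s : seq H) : exists m (e : 'I_m -> H),
  (forall i j, '[e i, e j] = (i == j)%:R) /\
  forall h, h \in s -> exists x : 'I_m -> R[i], h = \sum_j x j *: e j.
Proof.
elim: s => [|h s [m [e [on sp]]]]; first by exists 0%N, (fun=> 0); split=> [[]|].
pose r := h - \sum_j '[h, e j] *: e j.
have re j : '[r, e j] = 0.
  rewrite hformBl hform_suml (bigD1 j) //= hformZl on eqxx mulr1 big1 ?addr0 ?subrr //.
  by move=> i ij; rewrite hformZl on (negPf ij) mulr0.
have [r0|r0] := eqVneq r 0.
  exists m, e; split => // k; rewrite inE => /orP[/eqP ->|/sp //].
  by exists (fun j => '[h, e j]); apply/eqP; rewrite -subr_eq0; apply/eqP.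
have nr0 : (hnorm r)%:C%C != 0 :> R[i].
  by rewrite fmorph_eq0; apply: contra r0 => /eqP/hnorm_eq0 ->.
pose f (i : 'I_(m + 1)) :=
  match fintype.split i with inl j => e j | inr _ => ((hnorm r)%:C%C)^-1 *: r end.
exists (m + 1)%N, f; split => [p q|k].
  rewrite -[p]splitK -[q]splitK /f !unsplitK.
  case: (fintype.split p) (fintype.split q) => [a|a] [b|b] /=.
  - by rewrite on (inj_eq (@lshift_inj _ _)).
  - by rewrite hformZr hformC re rmorph0 mulr0 eq_lrshift.
  - by rewrite hformZl re mulr0 eq_rlshift.
  - have -> : '[((hnorm r)%:C%C)^-1 *: r, ((hnorm r)%:C%C)^-1 *: r] =
        ((hnorm r)%:C%C)^-1 * (((hnorm r)%:C%C)^-1 * (hnorm r ^+ 2)%:C%C).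
      rewrite hformZl hformZr hform_norm; congr (_ * (_ * _)).
      by rewrite fmorphV; congr (_^-1); exact: conj_real.
    rewrite !ord1 eqxx.
    by rewrite mulrA -invfM -expr2 rmorphXn /= mulVf // expf_neq0.
rewrite inE => /orP[/eqP ->|/sp[x ->]].
  exists (fun i => match fintype.split i with inl j => '[h, e j] | inr _ => (hnorm r)%:C%C end).
  rewrite big_split_ord /= big_ord1 /f (unsplitK (inr ord0)).
  rewrite scalerA mulfV // scale1r.
  under eq_bigr do rewrite (unsplitK (inl _)).
  by rewrite /r addrC subrK.
exists (fun i => match fintype.split i with inl j => x j | inr _ => 0 end).
rewrite big_split_ord /= big_ord1 /f (unsplitK (inr ord0)) scale0r addr0.
by apply: eq_bigr => j _; rewrite (unsplitK (inl _)).
Qed.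

(* The entries of [C] act as scalars, so a bound of [C] on scalar vectors passes
   to each coordinate in an orthonormal basis of the span of the [h v]. *)
Lemma scalar_mx_bound (V W : finType) (C : W -> V -> R[i])
    (M : R[i]) (h : V -> H) :
  (forall x : V -> R[i], \sum_w `|\sum_v C w v * x v| ^+ 2 <=
     M * \sum_v `|x v| ^+ 2) ->
  \sum_w '[\sum_v C w v *: h v, \sum_v C w v *: h v] <= M * \sum_v '[h v, h v].
Proof.
move=> CM; have [m [e [on sp]]] := gram_schmidt (map h (enum V)).
have /choice[x xh] (v : V) : exists x : 'I_m -> R[i], h v = \sum_j x j *: e j.
  by apply: sp; apply: map_f; rewrite mem_enum.
have nE (y : 'I_m -> R[i]) : '[\sum_j y j *: e j, \sum_j y j *: e j] =
    \sum_j `|y j| ^+ 2.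
  rewrite hform_suml; apply: eq_bigr => i _.
  rewrite hform_sumr (bigD1 i) //= hformZl hformZr on eqxx big1 ?addr0.
    by rewrite mulr1 -normCK.
  by move=> j ji; rewrite hformZl hformZr on eq_sym (negPf ji) !mulr0.
have -> : \sum_v '[h v, h v] = \sum_j \sum_v `|x v j| ^+ 2.
  by rewrite exchange_big; apply: eq_bigr => v _; rewrite xh nE.
rewrite (eq_bigr (fun w => \sum_j `|\sum_v C w v * x v j| ^+ 2)) => [|w _].
  by rewrite exchange_big mulr_sumr; apply: ler_sum => j _; exact: CM.
rewrite -nE; congr '[_, _]; under [RHS]eq_bigr do rewrite scaler_suml.
  all: rewrite exchange_big /=; apply: eq_bigr => v _; rewrite xh scaler_sumr.
  all: by apply: eq_bigr => j _; rewrite scalerA.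
Qed.

End Prehilbert.

(** * Cuntz families and the norms of polynomials *)

(* [s w v] plays the role of S_w S_v^*; [s [::] [::]] need not be the identity. *)
Record cuntz_family (R : realType) (n : nat) (H : prehilbert R)
    (s : seq 'I_n -> seq 'I_n -> H -> H) : Prop := CuntzFamily {
  fam_linear : forall w v, linear (s w v);
  fam_adj : forall w v h k, hform H (s w v h) k = hform H h (s v w k);
  fam_cat : forall w v u r h, s w v (s (v ++ r) u h) = s (w ++ r) u h;
  fam_neq : forall w v v' u h, ~~ prefix v v' -> ~~ prefix v' v ->
    s w v (s v' u h) = 0;
  fam_sum : forall w v h, \sum_i s (rcons w i) (rcons v i) h = s w v h }.

Section Polynomials.
Context (R : realType) (n : nat).
Local Notation word := (seq 'I_n).
Implicit Types (c : cuntz_poly R n).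

(** The product S_w S_v^* S_v' S_u^*, with pairs read as in [poly_op]. If one of v, v' extends the
    other by r, then S_v^* S_v' is S_r or S_r^*; otherwise it is zero, encoded by the empty list. *)
Definition mono_mul (p q : word * word) : seq (word * word) :=
  if prefix p.2 q.1 then [:: (p.1 ++ drop (size p.2) q.1, q.2)]
  else if prefix q.1 p.2 then [:: (p.1, q.2 ++ drop (size q.1) p.2)]
  else [::].

Definition poly_mul c c' : cuntz_poly R n :=
  flatten [seq flatten [seq [seq (m.1 * m'.1, p) | p <- mono_mul m.2 m'.2]
    | m' <- c'] | m <- c].

Definition poly_star c : cuntz_poly R n :=
  [seq ((m.1)^*, (m.2.2, m.2.1)) | m : R[i] * (word * word) <- c].

Definition poly_opp c : cuntz_poly R n :=
  [seq (- m.1, m.2) | m : R[i] * (word * word) <- c].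

(** The degree of [(w, v)] is [size w - size v], the integer carried by the groupoid elements of its
    cylinder; its absolute value is bounded here without subtraction. *)
Definition deg_le (D : nat) c := all (fun m : R[i] * (word * word) =>
  (size m.2.1 <= size m.2.2 + D)%N && (size m.2.2 <= size m.2.1 + D)%N) c.

Lemma mono_mul_deg D D' (p q r : word * word) :
  (size p.1 <= size p.2 + D)%N && (size p.2 <= size p.1 + D)%N ->
  (size q.1 <= size q.2 + D')%N && (size q.2 <= size q.1 + D')%N ->
  r \in mono_mul p q ->
  (size r.1 <= size r.2 + (D + D'))%N && (size r.2 <= size r.1 + (D + D'))%N.
Proof.
case: p q => [w v] [v' u] /=; rewrite /mono_mul /=.
case: ifP => [/prefixP[x ->]|_]; last case: ifP => [/prefixP[x ->]|//];
  rewrite drop_size_cat // inE => + + /eqP -> /=; rewrite !size_cat; lia.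
Qed.

Lemma poly_mul_deg D D' c c' : deg_le D c -> deg_le D' c' ->
  deg_le (D + D') (poly_mul c c').
Proof.
move=> /allP dc /allP dc'; apply/allP => m /flattenP[_ /mapP[p /dc dp ->]].
move=> /flattenP[_ /mapP[q /dc' dq ->]] /mapP[r rpq ->] /=.
exact: mono_mul_deg rpq.
Qed.

Lemma deg_le_exists c : exists D, deg_le D c.
Proof.
elim: c => [|m c [D Dc]]; first by exists 0%N.
exists (maxn D (maxn (size m.2.1) (size m.2.2))) => /=; apply/andP; split.
  by lia.
by apply: sub_all Dc => q /=; lia.
Qed.

Definition fam_poly (H : prehilbert R) (s : word -> word -> H -> H) c : H -> H :=
  fun h => \sum_(m <- c) m.1 *: s m.2.1 m.2.2 h.

Section Family.
Context (H : prehilbert R) (s : word -> word -> H -> H) (sF : cuntz_family s).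
Local Notation "''[' u , v ]" := (hform H u v).

Lemma famD w v h k : s w v (h + k) = s w v h + s w v k.
Proof. by have := fam_linear sF w v 1 h k; rewrite !scale1r. Qed.

Lemma fam0 w v : s w v 0 = 0.
Proof. by apply: (addrI (s w v 0)); rewrite -famD !addr0. Qed.

Lemma famZ w v a h : s w v (a *: h) = a *: s w v h.
Proof. by have := fam_linear sF w v a h 0; rewrite fam0 !addr0. Qed.

Lemma fam_suml w v (I : Type) (r : seq I) (P : pred I) (F : I -> H) :
  s w v (\sum_(i <- r | P i) F i) = \sum_(i <- r | P i) s w v (F i).
Proof. by elim/big_rec2: _ => [|i x y _ <-]; rewrite ?fam0 ?famD. Qed.

(** The adjoint of [fam_cat]; the record keeps only one of the two sides. *)
Lemma fam_catr w v u r h : s w (v ++ r) (s v u h) = s w (u ++ r) h.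
Proof. by apply: hformI => k; rewrite -!(fam_adj sF) (fam_cat sF). Qed.

Lemma fam_mulK w v u h : s w v (s v u h) = s w u h.
Proof. by have := fam_cat sF w v u [::] h; rewrite !cats0. Qed.

Lemma fam_unitl w v h : s w [::] (s [::] v h) = s w v h.
Proof. exact: fam_mulK. Qed.

Lemma fam_unitr w v h : s w v (s [::] [::] h) = s w v h.
Proof. exact: (fam_catr w [::] [::] v). Qed.

Lemma fam_neq_size w v v' u h : size v = size v' -> v != v' ->
  s w v (s v' u h) = 0.
Proof.
move=> vv' ne; apply: (fam_neq sF); apply: contra ne; rewrite prefixE.
  by rewrite vv' take_size eq_sym.
by rewrite -vv' take_size.
Qed.

Lemma fam_mono_mul (a : R[i]) (p q : word * word) h :
  \sum_(r <- mono_mul p q) a *: s r.1 r.2 h = a *: s p.1 p.2 (s q.1 q.2 h).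
Proof.
case: p q => [w v] [v' u]; rewrite /mono_mul /=.
case: ifPn => [/prefixP[x ->]|N1].
  by rewrite drop_size_cat // big_seq1 (fam_cat sF).
case: ifPn => [/prefixP[x ->]|N2].
  by rewrite drop_size_cat // big_seq1 fam_catr.
by rewrite big_nil (fam_neq sF) // scaler0.
Qed.

Lemma fam_poly_mul c c' h :
  fam_poly s (poly_mul c c') h = fam_poly s c (fam_poly s c' h).
Proof.
rewrite /fam_poly /poly_mul big_flatten big_map; apply: eq_bigr => m _.
rewrite fam_suml scaler_sumr big_flatten big_map; apply: eq_bigr => m' _.
by rewrite big_map famZ scalerA /= fam_mono_mul.
Qed.

Lemma fam_poly_star c h k : '[fam_poly s c h, k] = '[h, fam_poly s (poly_star c) k].
Proof.
rewrite /fam_poly big_map hform_suml hform_sumr; apply: eq_bigr => m _ /=.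
by rewrite hformZl hformZr conjCK (fam_adj sF).
Qed.

Lemma fam_poly_cat c c' h :
  fam_poly s (c ++ c') h = fam_poly s c h + fam_poly s c' h.
Proof. by rewrite /fam_poly big_cat. Qed.

Lemma fam_poly_opp c h : fam_poly s (poly_opp c) h = - fam_poly s c h.
Proof.
by rewrite /fam_poly big_map -sumrN; apply: eq_bigr => m _; rewrite scaleNr.
Qed.

Lemma fam_poly_scale a c h :
  fam_poly s [seq (a * m.1, m.2) | m <- c] h = a *: fam_poly s c h.
Proof.
by rewrite /fam_poly big_map scaler_sumr; apply: eq_bigr => m _; rewrite scalerA.
Qed.

Lemma fam_poly_linear c : linear (fam_poly s c).
Proof.
move=> a h k; rewrite /fam_poly scaler_sumr -big_split /=.
by apply: eq_bigr => m _; rewrite famD famZ scalerDr !scalerA mulrC.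
Qed.

Lemma fam_resolution L w v h :
  \sum_(r : L.-tuple 'I_n) s (w ++ r) (v ++ r) h = s w v h.
Proof.
elim: L w v => [|L IH] w v.
  by rewrite (big_pred1 [tuple]) ?cats0 // => r; apply/esym/eqP; exact: tuple0.
rewrite -(fam_sum sF).
rewrite (reindex (fun p : 'I_n * L.-tuple 'I_n => [tuple of p.1 :: p.2])) /=.
  rewrite -(pair_big xpredT xpredT (fun i (r : L.-tuple 'I_n) =>
    s (w ++ i :: r) (v ++ i :: r) h)) /=.
  by apply: eq_bigr => i _; rewrite -IH; apply: eq_bigr => r _; rewrite !cat_rcons.
exists (fun r => (thead r, [tuple of behead r])) => [[i r]|r] _ /=.
  by congr pair; apply: val_inj.
by rewrite -tuple_eta.
Qed.

(** [s v v] is a self-adjoint idempotent p, so that ||p h||^2 = <p h, h>. *)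
Lemma fam_proj_contract v h : hnorm (s v v h) <= hnorm h.
Proof.
set p := s v v h.
have pp : '[p, h] = (hnorm p ^+ 2)%:C%C.
  by rewrite -hform_norm /p !(fam_adj sF) fam_mulK.
have := hform_le_norm pp.
have [->|p0] := eqVneq (hnorm p) 0; first by rewrite hnorm_ge0.
by rewrite expr2 ler_pM2l // lt_def p0 hnorm_ge0.
Qed.

(** [s w v] is a partial isometry with initial projection [s v v]. *)
Lemma fam_contract w v h : hnorm (s w v h) <= hnorm h.
Proof.
apply: le_trans (fam_proj_contract v h); rewrite -(ler_pXn2r (ltn0Sn 1)) ?nnegrE ?hnorm_ge0 //.
by apply: hnorm_sqr_le; rewrite (fam_adj sF) fam_mulK -hform_norm (fam_adj sF) fam_mulK.
Qed.

Lemma fam_poly_bounded c : bounded_op (fam_poly s c).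
Proof.
split; first exact: fam_poly_linear.
exists (\sum_(m <- c) complex.Re `|m.1|) => h; apply: le_trans (hnorm_sum _ _ _) _.
rewrite mulr_suml; apply: ler_sum => m _; rewrite hnormZ ler_wpM2l ?fam_contract //.
by rewrite normc_def sqrtr_ge0.
Qed.

(* The coefficient of s_w in the product of the polynomial by s_v. *)
Definition poly_coef c (w v : word) : R[i] := \sum_(m <- c)
  m.1 * (prefix m.2.2 v && (w == m.2.1 ++ drop (size m.2.2) v))%:R.

(** A monomial [(a, b)] with [size b <= L] sends S_v k to S_(a r) k if v = b r, and kills it
    otherwise. The new word has length L plus the degree of the monomial. The index [d] is that
    degree shifted by [D], whence 2 D + 1 values; collecting equal words yields the matrices
    [poly_coef]. *)
Lemma fam_poly_expand c (D L : nat) (k : L.-tuple 'I_n -> H) : (D <= L)%N ->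
  deg_le D c -> all (fun m => size m.2.2 <= L)%N c ->
  fam_poly s c (\sum_(v : L.-tuple 'I_n) s v [::] (k v)) =
  \sum_(d < D.*2.+1) \sum_(w : (L + d - D).-tuple 'I_n)
    s w [::] (\sum_(v : L.-tuple 'I_n) poly_coef c w v *: k v).
Proof.
move=> DL /allP dc /allP Lc.
pose F (m : R[i] * (word * word)) (v : L.-tuple 'I_n) := m.1 * (prefix m.2.2 v)%:R *:
  s (m.2.1 ++ drop (size m.2.2) v) [::] (k v).
transitivity (\sum_(m <- c) \sum_v F m v).
  rewrite /fam_poly; apply: eq_big_seq => m /Lc /= mL.
  rewrite fam_suml scaler_sumr; apply: eq_bigr => v _; rewrite /F.
  case: (boolP (prefix m.2.2 v)) => [/prefixP[x ->]|Np].
    by rewrite drop_size_cat // (fam_cat sF) mulr1.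
  rewrite mulr0 scale0r (fam_neq sF) ?scaler0 //.
  (* The word [v] has length [L >= size m.2.2], so it can be a prefix of [m.2.2] only by being equal
     to it. *)
  apply: contra Np; rewrite !prefixE size_tuple => /eqP E.
  have e : size m.2.2 = L.
    by have := congr1 size E; rewrite size_take size_tuple; case: ltnP => //; rewrite ltnNge mL.
  by rewrite -E take_oversize ?e // take_oversize ?e.
pose G (m : R[i] * (word * word)) (d : 'I_D.*2.+1) (w : (L + d - D).-tuple 'I_n)
    (v : L.-tuple 'I_n) :=
  m.1 * (prefix m.2.2 v && (w == m.2.1 ++ drop (size m.2.2) v :> seq _))%:R *:
    s w [::] (k v).
transitivity (\sum_(m <- c) \sum_d \sum_w \sum_v G m d w v); last first.
  rewrite exchange_big /=; apply: eq_bigr => d _.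
  rewrite exchange_big /=; apply: eq_bigr => w _.
  rewrite fam_suml exchange_big /=; apply: eq_bigr => v _.
  by rewrite famZ /poly_coef scaler_suml.
apply: eq_big_seq => m mc.
under [RHS]eq_bigr do rewrite exchange_big.
rewrite exchange_big /=; apply: eq_bigr => v _; rewrite /F /G.
case: (boolP (prefix m.2.2 v)) => [/prefixP[x vE]|Np]; last first.
  rewrite mulr0 scale0r; symmetry; rewrite big1 // => d _; rewrite big1 // => w _.
  by rewrite scale0r.
have := dc m mc; have := Lc m mc; rewrite /= => mL /andP[d1 d2].
set z := m.2.1 ++ _.
have vs : (size m.2.2 + size x = L)%N by rewrite -size_cat -vE size_tuple.
have zs : size z = (size m.2.1 + size x)%N by rewrite /z size_cat vE drop_size_cat.
(* Of all pairs [(d, w)], only the shifted degree of [m] and the word [z] contribute. *)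
have dlt : (size m.2.1 + D - size m.2.2 < D.*2.+1)%N.
  have A (a b : nat) : (a <= b + D)%N -> (b <= a + D)%N -> (a + D - b < D.*2.+1)%N by lia.
  exact: A d1 d2.
rewrite (bigD1 (Ordinal dlt)) //= [X in _ + X]big1 ?addr0 => [|d nd]; last first.
  rewrite big1 // => w _; case: eqP => [wz|]; last by rewrite mulr0 scale0r.
  case/eqP: nd; apply: val_inj => /=.
  have A (a b e : nat) : (b + e = L)%N -> (a + e = L + d - D)%N -> (b <= a + D)%N ->
    d = (a + D - b)%N :> nat by have := ltn_ord d; lia.
  by apply: (A _ _ (size x)) => //; rewrite -zs -wz size_tuple.
have zt : size z == (L + (size m.2.1 + D - size m.2.2) - D)%N.
  have A (a b e : nat) : (b + e = L)%N -> (b <= a + D)%N ->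
    (a + e = L + (a + D - b) - D)%N by lia.
  by rewrite zs; apply/eqP; exact: A.
rewrite (bigD1 (Tuple zt)) //= eqxx [X in _ + X]big1 ?addr0 // => w nw.
case: eqP => [wz|]; last by rewrite mulr0 scale0r.
by case/eqP: nw; apply: val_inj.
Qed.

(** Distinct words of equal length have orthogonal ranges. The vectors must lie in the range of the
    unit, where S_w is isometric. *)
Lemma fam_expand_norm l (g : l.-tuple 'I_n -> H) :
  (forall w, s [::] [::] (g w) = g w) ->
  '[\sum_(w : l.-tuple 'I_n) s w [::] (g w), \sum_(w : l.-tuple 'I_n) s w [::] (g w)] = \sum_w '[g w, g w].
Proof.
move=> pg; rewrite hform_suml; apply: eq_bigr => w _.
rewrite hform_sumr (bigD1 w) //= (fam_adj sF) fam_mulK pg big1 ?addr0 // => v vw.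
by rewrite (fam_adj sF) fam_neq_size ?hform0r ?size_tuple // eq_sym.
Qed.

End Family.

(* Plays the part of the Fock vacuum for the words of length at most L. *)
Definition cuntz_vacuum (H : prehilbert R) (s : word -> word -> H -> H) L (u : H) :=
  forall w v, (size w <= L)%N -> (size v <= L)%N ->
    hform H (s w [::] u) (s v [::] u) = (w == v)%:R.

(** * Transfer of norm bounds between two Cuntz families *)

Section Comparison.
Context (K H : prehilbert R) (t : word -> word -> K -> K) (s : word -> word -> H -> H).
Hypotheses (tF : cuntz_family t) (sF : cuntz_family s).
Hypothesis tV : forall L, exists u, cuntz_vacuum t L u.

(** The block of coefficients of one degree is a compression of the polynomial. With xi = sum of S_v
    (x_v u) and eta = sum of S_w (y_w u), where y is the image of x under the block, the parts of c
    xi of other degrees involve words of other lengths and are orthogonal to eta. Thus ||eta||^2 =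
    <c xi, eta> <= M ||xi|| ||eta||, and the vacuum u turns both norms into sums of squares of
    coefficients. *)
Lemma poly_coef_bound c (D L : nat) (M : R) (d : 'I_D.*2.+1)
    (x : L.-tuple 'I_n -> R[i]) :
  0 <= M -> (D <= L)%N -> deg_le D c -> all (fun m => size m.2.2 <= L)%N c ->
  (forall k, hnorm (fam_poly t c k) <= M * hnorm k) ->
  \sum_(w : (L + d - D).-tuple 'I_n) `|\sum_(v : L.-tuple 'I_n) poly_coef c w v * x v| ^+ 2 <=
  (M ^+ 2)%:C%C * \sum_v `|x v| ^+ 2.
Proof.
(* All words that occur have length at most [L + D], since [d <= 2 D]. *)
move=> M0 DL dc Lc cM; have [u uV] := tV (L + D).
have on (l l' : nat) (y : l.-tuple 'I_n -> R[i]) (z : l'.-tuple 'I_n -> R[i]) :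
    (l <= L + D)%N -> (l' <= L + D)%N ->
    hform K (\sum_(w : l.-tuple 'I_n) t w [::] (y w *: u)) (\sum_(w : l'.-tuple 'I_n) t w [::] (z w *: u)) =
    \sum_w \sum_v y w * (z v)^* * (w == v :> seq _)%:R.
  move=> hl hl'; rewrite hform_suml; apply: eq_bigr => w _; rewrite hform_sumr.
  apply: eq_bigr => v _; rewrite !(famZ tF) hformZl hformZr uV ?size_tuple //.
  by rewrite mulrA.
have nE (l : nat) (y : l.-tuple 'I_n -> R[i]) : (l <= L + D)%N ->
    hform K (\sum_(w : l.-tuple 'I_n) t w [::] (y w *: u)) (\sum_(w : l.-tuple 'I_n) t w [::] (y w *: u)) =
    \sum_w `|y w| ^+ 2.
  move=> hl; rewrite on //; apply: eq_bigr => w _.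
  rewrite (bigD1 w) //= eqxx mulr1 -normCK big1 ?addr0 // => v vw.
  by rewrite -val_eqE eq_sym in vw; rewrite (negPf vw) mulr0.
pose y (w : (L + d - D).-tuple 'I_n) := \sum_(v : L.-tuple 'I_n) poly_coef c w v * x v.
pose xi := \sum_(v : L.-tuple 'I_n) t v [::] (x v *: u); pose eta := \sum_(w : (L + d - D).-tuple 'I_n) t w [::] (y w *: u).
have dL : (L + d - D <= L + D)%N by have := ltn_ord d; lia.
have Axi : hform K (fam_poly t c xi) eta = (hnorm eta ^+ 2)%:C%C.
  rewrite -hform_norm /xi (fam_poly_expand tF _ DL dc Lc) hform_suml.
  rewrite (bigD1 d) //= [X in _ + X]big1 ?addr0 => [|d' d'd]; last first.
    under eq_bigr do [under eq_bigr do rewrite scalerA; rewrite -scaler_suml].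
    rewrite on //; last by have := ltn_ord d'; lia.
    rewrite big1 // => w _; rewrite big1 // => v _; case: eqP => [E|]; rewrite ?mulr0 //.
    case/eqP: d'd; apply: val_inj => /=.
    by have := size_tuple w; rewrite E size_tuple; lia.
  congr (hform K _ _); apply: eq_bigr => w _; congr (t _ _ _).
  by rewrite /y scaler_suml; apply: eq_bigr => v _; rewrite scalerA.
have le_eta : hnorm eta <= M * hnorm xi.
  have := hform_le_norm Axi; have [->|e0] := eqVneq (hnorm eta) 0.
    by rewrite mulr_ge0 ?hnorm_ge0.
  have ep : 0 < hnorm eta by rewrite lt_def e0 hnorm_ge0.
  rewrite expr2 ler_pM2r // => /le_trans; apply; exact: cM.
rewrite -[X in X <= _]nE // -[X in _ * X]nE ?leq_addr // !hform_norm -rmorphM lecR.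
rewrite -exprMn ler_pXn2r ?nnegrE ?mulr_ge0 ?hnorm_ge0 //.
Qed.

(** Each of the 2 D + 1 homogeneous parts acts on the coordinates S_v^* h of [h] through one
    coefficient matrix. Its bound [M], known in [t] through the vacuum, holds for vector coordinates
    by [scalar_mx_bound]; the parts are added by the triangle inequality. *)
Lemma fam_poly_deg_bound c (D : nat) (M : R) h : 0 <= M -> deg_le D c ->
  (forall k, hnorm (fam_poly t c k) <= M * hnorm k) ->
  hnorm (fam_poly s c h) <= D.*2.+1%:R * M * hnorm h.
Proof.
move=> M0 dc cM.
have [L DL Lc] : exists2 L, (D <= L)%N & all (fun m => size m.2.2 <= L)%N c.
  exists (D + \max_(m <- c) size m.2.2)%N; first exact: leq_addr.
  apply/allP => m mc; apply: leq_trans (leq_addl _ _).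
  exact: (@leq_bigmax_seq _ c xpredT (fun m => size m.2.2)).
pose k (v : L.-tuple 'I_n) := s [::] v h.
(* The resolution over words of length [L] only recovers the image of [h] under the unit, but a
   polynomial does not see the difference. *)
have -> : fam_poly s c h = fam_poly s c (\sum_(v : L.-tuple 'I_n) s v [::] (k v)).
  rewrite /k; under eq_bigr do rewrite (fam_unitl sF).
  rewrite (fam_resolution sF L [::] [::]) /fam_poly.
  by apply: eq_bigr => m _; rewrite (fam_unitr sF).
rewrite (fam_poly_expand sF _ DL dc Lc).
apply: le_trans (hnorm_sum _ _ _) _.
rewrite -[D.*2.+1 in leRHS]card_ord -mulrA mulr_natl -sumr_const.
apply: ler_sum => d _.
rewrite -(ler_pXn2r (ltn0Sn 1)) ?nnegrE ?mulr_ge0 ?hnorm_ge0 //.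
have pk v : s [::] [::] (k v) = k v by rewrite /k (fam_unitl sF).
apply: hnorm_sqr_le; rewrite (fam_expand_norm sF) => [|w]; last first.
  by rewrite (fam_suml sF); apply: eq_bigr => v _; rewrite (famZ sF) pk.
apply: (@le_trans _ _ ((M ^+ 2)%:C%C * \sum_v hform H (k v) (k v))).
  by apply: scalar_mx_bound => x; exact: (@poly_coef_bound _ _ _ _ d).
have -> : \sum_v hform H (k v) (k v) = hform H (s [::] [::] h) (s [::] [::] h).
  under eq_bigr do rewrite /k (fam_adj sF) (fam_mulK sF).
  by rewrite -hform_sumr (fam_resolution sF L [::] [::]) (fam_adj sF) (fam_unitr sF).
rewrite hform_norm -rmorphM lecR exprMn ler_wpM2l ?sqr_ge0 //.
by rewrite ler_pXn2r ?nnegrE ?hnorm_ge0 // (fam_proj_contract sF).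
Qed.

(** The power of exponent 2 ^ j, by repeated squaring. *)
Definition poly_pow c j := iter j (fun b => poly_mul b b) c.

Lemma poly_pow_deg D c j : deg_le D c -> deg_le (2 ^ j * D) (poly_pow c j).
Proof.
move=> dc; elim: j => [|j IH]; first by rewrite mul1n.
by rewrite expnS mul2n -addnn mulnDl; exact: poly_mul_deg.
Qed.

Lemma poly_pow_bound c (M : R) j : 0 <= M ->
  (forall k, hnorm (fam_poly t c k) <= M * hnorm k) ->
  forall k, hnorm (fam_poly t (poly_pow c j) k) <= M ^+ (2 ^ j) * hnorm k.
Proof.
move=> M0 cM; elim: j => [|j IH] k //=.
rewrite (fam_poly_mul tF) (le_trans (IH _)) // expnS mul2n -addnn exprD -mulrA.
by rewrite ler_wpM2l // exprn_ge0.
Qed.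

Lemma poly_pow_sym c j :
  (forall h k, hform H (fam_poly s c h) k = hform H h (fam_poly s c k)) ->
  forall h k, hform H (fam_poly s (poly_pow c j) h) k =
              hform H h (fam_poly s (poly_pow c j) k).
Proof.
by move=> c0; elim: j => //= j IH h k; rewrite !(fam_poly_mul sF) !IH.
Qed.

(** For a self-adjoint operator a and ||h|| <= 1, ||a h||^2 = <a^2 h, h> <= ||a^2 h||; this is
    applied to the successive squares. *)
Lemma poly_pow_ge c j h :
  (forall h k, hform H (fam_poly s c h) k = hform H h (fam_poly s c k)) ->
  hnorm h <= 1 ->
  hnorm (fam_poly s c h) ^+ (2 ^ j) <= hnorm (fam_poly s (poly_pow c j) h).
Proof.
move=> c0 h1; elim: j => [|j IH]; first by rewrite expr1.
rewrite expnSr exprM (le_trans (lerXn2r _ _ _ IH)) ?nnegrE ?exprn_ge0 ?hnorm_ge0 //=.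
have E : hform H (fam_poly s (poly_mul (poly_pow c j) (poly_pow c j)) h) h =
    (hnorm (fam_poly s (poly_pow c j) h) ^+ 2)%:C%C.
  by rewrite (fam_poly_mul sF) poly_pow_sym // hform_norm.
by rewrite (le_trans (hform_le_norm E)) // ler_piMr ?hnorm_ge0.
Qed.

(** If x > M, the powers of x / M would outgrow a factor that is linear in the exponent. *)
Lemma le_of_pow (x M : R) (D : nat) : 0 <= M ->
  (forall j, x ^+ (2 ^ j) <= (2 ^ j * D).*2.+1%:R * M ^+ (2 ^ j)) -> x <= M.
Proof.
move=> M0 xM; rewrite leNgt; apply/negP => Mx.
have [M00|M1] := eqVneq M 0.
  have := xM 0%N; rewrite expn0 M00 mulr0 expr1 leNgt => /negP; apply.
  by rewrite -M00.
have {M1}Mp : 0 < M by rewrite lt_def M1.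
pose d := x / M - 1.
have d0 : 0 < d by rewrite subr_gt0 ltr_pdivlMr // mul1r.
have xE : x = M * (1 + d) by rewrite /d addrC subrK mulrC divfK ?gt_eqF.
clearbody d.
have bernoulli N : 1 + N%:R * d <= (1 + d) ^+ N.
  elim: N => [|N IH]; first by rewrite mul0r addr0.
  rewrite exprSr; apply: (@le_trans _ _ ((1 + N%:R * d) * (1 + d))).
    by rewrite -natr1; have : 0 <= N%:R :> R by []; nra.
  by rewrite ler_wpM2r // addr_ge0 // ltW.
(* With p = 2 ^ j, the hypothesis at exponent 2 p reads (1 + d)^(2 p) <= 4 p D + 1. Bernoulli at 2 p
   is itself only linear in p; the square of Bernoulli at p exceeds p^2 d^2, and this [j] makes p
   d^2 larger than 4 D + 1. *)
have [j jd] : exists j : nat, (4 * D + 1)%N%:R / d ^+ 2 < (2 ^ j)%:R.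
  exists (Num.bound ((4 * D + 1)%N%:R / d ^+ 2)).
  apply: lt_trans (archi_boundP _) _; first by rewrite divr_ge0 ?sqr_ge0.
  by rewrite ltr_nat ltn_expl.
set p := (2 ^ j)%N in jd.
have p1 : 1 <= p%:R :> R by rewrite ler1n expn_gt0.
rewrite ltr_pdivrMr ?exprn_gt0 // in jd.
have := xM j.+1; rewrite expnS mul2n -addnn -/p.
rewrite xE exprMn mulrC ler_pM2r ?exprn_gt0 // exprD.
have := bernoulli p; set y := _ ^+ p => yp.
have : (1 + p%:R * d) * (1 + p%:R * d) <= y * y.
  by apply: ler_pM => //; rewrite addr_ge0 // mulr_ge0 // ltW.
rewrite -!muln2 -natr1 !natrM !natrD in jd *.
have : 0 <= p%:R * d by rewrite mulr_ge0 // ltW.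
by move: p1 jd; set k := p%:R; nra.
Qed.

(* The norm is bounded up to a factor that is linear in the degree; applied to the
   powers of c^* c of order 2 ^ j, the factor disappears in the limit. *)
Lemma fam_poly_compare c (e : R) : 0 <= e ->
  (forall k, hnorm (fam_poly t c k) <= e * hnorm k) ->
  forall h, hnorm (fam_poly s c h) <= e * hnorm h.
Proof.
move=> e0 ce.
suff unit h : hnorm h <= 1 -> hnorm (fam_poly s c h) <= e.
  move=> h; have [/hnorm_eq0 ->|h0] := eqVneq (hnorm h) 0.
    have -> : fam_poly s c 0 = 0.
      by rewrite /fam_poly big1 // => m _; rewrite (fam0 sF) scaler0.
    by rewrite hnorm0 mulr0.
  have hp : 0 < hnorm h by rewrite lt_def h0 hnorm_ge0.
  pose a := ((hnorm h)^-1)%:C%C : R[i].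
  have na k : hnorm (a *: k) = (hnorm h)^-1 * hnorm k.
    by rewrite hnormZ ger0_norm //= ?lecR ?ler0c invr_ge0 ltW.
  have := unit (a *: h); rewrite na mulVf // => /(_ (lexx _)).
  have -> : fam_poly s c (a *: h) = a *: fam_poly s c h.
    have := fam_poly_linear sF c a h 0; rewrite !addr0 => ->.
    by rewrite [fam_poly s c 0]big1 ?addr0 // => m _; rewrite (fam0 sF) scaler0.
  by rewrite na mulrC ler_pdivrMr.
move=> h1; pose b := poly_mul (poly_star c) c.
have be k : hnorm (fam_poly t b k) <= e ^+ 2 * hnorm k.
  rewrite (fam_poly_mul tF) (le_trans (adjoint_bound e0 (fam_poly_star tF c) ce _)) //.
  by rewrite expr2 -mulrA ler_wpM2l.
have bsym x y : hform H (fam_poly s b x) y = hform H x (fam_poly s b y).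
  rewrite !(fam_poly_mul sF) -(fam_poly_star sF) hformC -(fam_poly_star sF).
  by rewrite -hformC.
have [D dc] := deg_le_exists b.
have bh : hnorm (fam_poly s b h) <= e ^+ 2.
  apply: (@le_of_pow _ _ D) => [|j]; first exact: sqr_ge0.
  apply: le_trans (poly_pow_ge _ bsym h1) _.
  apply: (@le_trans _ _ ((2 ^ j * D).*2.+1%:R * (e ^+ 2) ^+ (2 ^ j) * hnorm h)).
    apply: fam_poly_deg_bound (poly_pow_deg j dc) _.
      by rewrite exprn_ge0 // sqr_ge0.
    by apply: poly_pow_bound be; exact: sqr_ge0.
  by rewrite ler_piMr // mulr_ge0 // exprn_ge0 // sqr_ge0.
have E : hform H (fam_poly s b h) h = (hnorm (fam_poly s c h) ^+ 2)%:C%C.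
  by rewrite -hform_norm (fam_poly_mul sF) hformC -(fam_poly_star sF) -hformC.
have := le_trans (hform_le_norm E) (ler_piMr (hnorm_ge0 _) h1).
by move=> /le_trans /(_ bh); rewrite ler_pXn2r ?nnegrE ?hnorm_ge0.
Qed.

End Comparison.
End Polynomials.

(** * The convolution algebra of the groupoid *)

Section Paths.
Context (n : nat).
Local Notation word := (seq 'I_n).
Local Notation X := (path_space n).
Local Notation G := (cuntz_groupoid n).

Definition pdrop (l : nat) (x : X) : X := fun k => x (l + k)%N.
Definition ptake (l : nat) (x : X) : word := mkseq x l.

Lemma size_ptake l x : size (ptake l x) = l.
Proof. exact: size_mkseq. Qed.

Lemma wcat_head (w : word) (x : X) d k : (k < size w)%N -> wcat w x k = nth d w k.
Proof. by move=> kw; rewrite /wcat kw; exact: set_nth_default. Qed.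

Lemma wcat_tail (w : word) (x : X) k : wcat w x (size w + k)%N = x k.
Proof. by rewrite /wcat ltnNge leq_addr addKn. Qed.

Lemma wcat0 (x : X) : wcat [::] x = x.
Proof. by apply/funext => k; rewrite /wcat subn0. Qed.

Lemma pdrop_wcat (w : word) (x : X) : pdrop (size w) (wcat w x) = x.
Proof. by apply/funext => k; exact: wcat_tail. Qed.

Lemma ptake_wcat (w : word) (x : X) : ptake (size w) (wcat w x) = w.
Proof.
apply: (@eq_from_nth _ (x 0)); rewrite size_ptake // => k kw.
by rewrite nth_mkseq // (wcat_head _ (x 0)).
Qed.

Lemma ptakeK l (x : X) : wcat (ptake l x) (pdrop l x) = x.
Proof.
apply/funext => k; have [kl|lk] := ltnP k l.
  by rewrite (wcat_head _ (x 0)) ?size_ptake // nth_mkseq.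
by have := wcat_tail (ptake l x) (pdrop l x) (k - l)%N; rewrite size_ptake subnKC // => ->; rewrite /pdrop subnKC.
Qed.

Lemma wcatA (w v : word) (x : X) : wcat (w ++ v) x = wcat w (wcat v x).
Proof.
apply/funext => k; have [kw|wk] := ltnP k (size w).
  by rewrite !(wcat_head _ (x 0)) ?size_cat ?ltn_addr // nth_cat kw.
rewrite -(subnKC wk) wcat_tail; set j := (k - size w)%N.
have [jv|vj] := ltnP j (size v).
  by rewrite !(wcat_head _ (x 0)) ?size_cat ?ltn_add2l // nth_cat ltnNge leq_addr addKn.
by rewrite -(subnKC vj) wcat_tail addnA -size_cat wcat_tail.
Qed.

Lemma wcat_inj (w : word) : injective (wcat w).
Proof. by move=> x y /(congr1 (pdrop (size w))); rewrite !pdrop_wcat. Qed.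

Lemma wcat_eq (w v : word) (x y : X) : size w = size v -> wcat w x = wcat v y ->
  w = v /\ x = y.
Proof.
move=> wv E; have wv' : w = v by rewrite -(ptake_wcat w x) E wv ptake_wcat.
by split => //; apply: (@wcat_inj w); rewrite E wv'.
Qed.

(** Two initial words of one path are comparable; this is what composability of groupoid elements
    amounts to on representatives. *)
Lemma wcat_prefix (w v : word) (x y : X) : (size w <= size v)%N ->
  wcat w x = wcat v y -> exists2 r, v = w ++ r & x = wcat r y.
Proof.
move=> wv; rewrite -{1}(cat_take_drop (size w) v) wcatA => /wcat_eq[].
  by rewrite size_takel.
by move=> E ->; exists (drop (size w) v) => //; rewrite {1}E cat_take_drop.
Qed.

Lemma gelt_subproof (w v : word) (x : X) :
  `[< exists w' v' x', cuntz_triple w v x = cuntz_triple w' v' x' >].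
Proof. by apply/asboolP; exists w, v, x. Qed.

Definition gelt (w v : word) (x : X) : G := CuntzGroupoid (gelt_subproof w v x).

Lemma gcylinderP (w v : word) (g : G) :
  gcylinder w v g <-> exists x, g = gelt w v x.
Proof.
split=> [[x E]|[x ->]]; last by exists x.
by exists x; apply: val_inj.
Qed.

Lemma gelt_cylinder (w v : word) (x : X) : gcylinder w v (gelt w v x).
Proof. by exists x. Qed.

Lemma geltP (g : G) : exists w v x, g = gelt w v x.
Proof.
have /asboolP[w [v [x E]]] := gtripleP g.
by exists w, v, x; apply: val_inj.
Qed.

Lemma gelt_cat (w v r : word) (x : X) : gelt (w ++ r) (v ++ r) x = gelt w v (wcat r x).
Proof.
apply: val_inj; rewrite /= /cuntz_triple !wcatA !size_cat; congr (_, _, _).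
by lia.
Qed.

Lemma gext (g h : G) : grng g = grng h -> gsrc g = gsrc h -> gdeg g = gdeg h -> g = h.
Proof.
rewrite /grng /gsrc /gdeg => E1 E2 E3; apply: val_inj => /=.
case: (gtriple g) (gtriple h) E1 E2 E3 => [[a b] c] [[a' b'] c'] /=.
by move=> -> -> ->.
Qed.

Lemma ginvK (g : G) : ginv (ginv g) = g.
Proof. by apply: gext => //; rewrite /gdeg /ginv /= /gdeg /= opprK. Qed.

Lemma ginv_gelt (w v : word) (x : X) : ginv (gelt w v x) = gelt v w x.
Proof. by apply: gext => //; rewrite /gdeg /= /gdeg /= opprB. Qed.

Lemma gcylinder_inv (w v : word) (g : G) : gcylinder w v (ginv g) <-> gcylinder v w g.
Proof.
rewrite !gcylinderP; split=> [[x E]|[x ->]]; exists x; last by rewrite ginv_gelt.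
by rewrite -[g]ginvK E ginv_gelt.
Qed.

Lemma gelt_inj (w v : word) : injective (gelt w v).
Proof. by move=> x y /(congr1 (@grng n)); exact: wcat_inj. Qed.

(** The middle words [v] and [v'] start the same path, so one is the other followed by some [r];
    appending [r] to the outer word of the factor with the shorter middle word represents the
    product. *)
Lemma gmul_exists (g h : G) : gsrc g = grng h -> exists k : G,
  [/\ grng k = grng g, gsrc k = gsrc h & gdeg k = gdeg g + gdeg h].
Proof.
have [w [v [x ->]]] := geltP g; have [v' [u [y ->]]] := geltP h.
rewrite /gsrc /grng /= => E; have [vv'|/ltnW v'v] := leqP (size v) (size v').
  have [r v'E xE] := wcat_prefix vv' E.
  exists (gelt (w ++ r) u y); rewrite /gdeg /= xE v'E wcatA !size_cat; split => //.
  lia.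
have [r vE yE] := wcat_prefix v'v (esym E).
exists (gelt w (u ++ r) x); rewrite /gdeg /= yE vE wcatA !size_cat; split => //.
lia.
Qed.

Lemma gopenE (A : set G) : open A = gopen A.
Proof. reflexivity. Qed.

Lemma open_gcylinder (w v : word) : open (gcylinder w v : set G).
Proof. by rewrite gopenE => g wvg; exists w, v; split. Qed.

(** A cylinder around [g] whose first word is at least as long as [w] lies inside the cylinder of
    [(w, v)] as soon as it meets it. Hence it misses it if [g] does. *)
Lemma closed_gcylinder (w v : word) : closed (gcylinder w v : set G).
Proof.
(* Appending [size w] letters of the tail is enough for the length required by [gcylinder_sub]. *)
rewrite -openC gopenE => g Ng; have [w' [v' [x gE]]] := geltP g.
pose r := ptake (size w) x.
have gr : gcylinder (w' ++ r) (v' ++ r) g.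
  by apply/gcylinderP; exists (pdrop (size w) x); rewrite gelt_cat ptakeK.
exists (w' ++ r), (v' ++ r); split => // h hr hwv; apply: Ng.
apply: (gcylinder_sub _ hwv hr gr).
by rewrite size_cat size_ptake leq_addl.
Qed.

(** Compactness of the path space: as the alphabet is finite, an ultrafilter on the cylinder selects
    one letter at each coordinate of the tail, and the selected letters form the limit path. *)
Lemma gcylinder_ultra_cvg (w v : word) (F : set_system G) (FU : UltraFilter F) :
  F (gcylinder w v) -> exists x, F --> gelt w v x.
Proof.
move=> Fwv.
have /choice[x xF] k : exists i, F [set g | exists2 y : X, g = gelt w v y & y k = i].
  apply: contrapT => /forallNP N.
  pose A i : set G := [set g | exists2 y : X, g = gelt w v y & y k = i].
  have NA : F [set g | forall i, ~ A i g].
    apply: filter_forall => i.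
    by case: (in_ultra_setVsetC (A i) FU) => [/N[]|].
  have [g [/gcylinderP[y gE] /(_ (y k))]] := filter_ex (filterI Fwv NA).
  by apply; exists y.
exists x.
(* Finitely many selected coordinates amount to a smaller cylinder, and these cylinders form a
   neighbourhood base at the limit. *)
have Fm m : F (gcylinder (w ++ ptake m x) (v ++ ptake m x)).
  suff : F [set g | exists2 y : X, g = gelt w v y & ptake m y = ptake m x].
    apply: filterS => g [y -> E]; apply/gcylinderP; exists (pdrop m y).
    by rewrite gelt_cat -E ptakeK.
  elim: m => [|m IH].
    by apply: filterS Fwv => g /gcylinderP[y ->]; exists y.
  apply: filterS2 IH (xF m) => g [y -> E] [z /gelt_inj <- Em]; exists y => //.
  by rewrite /ptake -addn1 /mkseq iotaD !map_cat /= add0n Em; congr (_ ++ _).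
move=> A /=; rewrite nbhsE => -[B [oB Bx] BA].
rewrite gopenE in oB; have [w' [v' [xw'v' sB]]] := oB _ Bx.
apply: filterS (Fm (size w')) => g gw; apply/BA/sB.
apply: (gcylinder_sub _ xw'v' _ gw).
  by rewrite size_cat size_ptake leq_addl.
by apply/gcylinderP; exists (pdrop (size w') x); rewrite gelt_cat ptakeK.
Qed.

Lemma compact_gcylinder (w v : word) : compact (gcylinder w v : set G).
Proof.
rewrite compact_ultra => F FU Fwv; have [x Fx] := gcylinder_ultra_cvg FU Fwv.
by exists (gelt w v x); split => //; exact: gelt_cylinder.
Qed.

End Paths.

(** * Characteristic functions of cylinders and their images in representations *)

Section ConvolutionAlgebra.
Context (R : realType) (n : nat).
Local Notation word := (seq 'I_n).
Local Notation X := (path_space n).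
Local Notation G := (cuntz_groupoid n).
Implicit Types f : G -> R[i].

Lemma chiT (w v : word) (g : G) : gcylinder w v g -> chi R w v g = 1.
Proof. by move=> wvg; rewrite /chi asboolT. Qed.

Lemma chiF (w v : word) (g : G) : ~ gcylinder w v g -> chi R w v g = 0.
Proof. by move=> wvg; rewrite /chi asboolF. Qed.

Lemma chi_neq0 (w v : word) (g : G) : chi R w v g != 0 -> gcylinder w v g.
Proof. by apply: contra_neqP => /chiF. Qed.

Lemma Cc_lin (a : R[i]) f f' : Cc f -> Cc f' -> Cc (a *: f + f').
Proof.
move=> [cr ci cf] [cr' ci' cf']; split.
- rewrite (_ : (fun x => _) = (fun x => complex.Re a * complex.Re (f x) -
    complex.Im a * complex.Im (f x) + complex.Re (f' x))); last first.
    by apply/funext => x; rewrite /= !fctE; case: a (f x) (f' x) => [? ?] [? ?] [? ?].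
  move=> x; have := cvgD (cvgB (cvgMl_tmp (a := complex.Re a) (cr x))
    (cvgMl_tmp (a := complex.Im a) (ci x))) (cr' x); exact.
- rewrite (_ : (fun x => _) = (fun x => complex.Re a * complex.Im (f x) +
    complex.Im a * complex.Re (f x) + complex.Im (f' x))); last first.
    by apply/funext => x; rewrite /= !fctE; case: a (f x) (f' x) => [? ?] [? ?] [? ?].
  move=> x; have := cvgD (cvgD (cvgMl_tmp (a := complex.Re a) (ci x))
    (cvgMl_tmp (a := complex.Im a) (cr x))) (ci' x); exact.
- apply: (@subclosed_compact _ _
    (closure [set x | f x != 0] `|` closure [set x | f' x != 0])).
  + exact: closed_closure.
  + exact: compactU.
  + rewrite -closureU; apply: closureS => x /=; rewrite !fctE.
    have [->|f0] := eqVneq (f x) 0; last by left.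
    by rewrite scaler0 add0r => ?; right.
Qed.

Lemma locally_cst_continuous (T : topologicalType) (f : G -> T) :
  (forall g, exists w v, gcylinder w v g /\ forall h, gcylinder w v h -> f h = f g) ->
  continuous f.
Proof.
move=> lc g; have [w [v [wvg fE]]] := lc g.
have gn : nbhs g (gcylinder w v).
  by apply: open_nbhs_nbhs; split => //; exact: open_gcylinder.
apply: (@cvg_near_cst _ _ (f g) f (nbhs g)).
by apply: filterS gn => h; exact: fE.
Qed.

Lemma chi_locally_cst (w v : word) (g : G) :
  exists w' v', gcylinder w' v' g /\ forall h, gcylinder w' v' h -> chi R w v h = chi R w v g.
Proof.
have [wvg|Nwvg] := pselect (gcylinder w v g).
  by exists w, v; split => // h wvh; rewrite !chiT.
have := @closed_gcylinder n w v; rewrite -openC gopenE => /(_ g Nwvg)[w' [v' [gw' sw']]].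
by exists w', v'; split => // h /sw' ?; rewrite !chiF.
Qed.

Lemma Cc_chi (w v : word) : Cc (chi R w v).
Proof.
split.
- apply: locally_cst_continuous => g; have [w' [v' [gw' E]]] := chi_locally_cst w v g.
  by exists w', v'; split => // h /E ->.
- apply: locally_cst_continuous => g; have [w' [v' [gw' E]]] := chi_locally_cst w v g.
  by exists w', v'; split => // h /E ->.
- apply: subclosed_compact (@closed_closure _ _) (@compact_gcylinder n w v) _.
  rewrite [X in _ `<=` X](closure_id _).1; last exact: closed_gcylinder.
  by apply: closureS => g; exact: chi_neq0.
Qed.

Lemma Cc0 : Cc (0 : G -> R[i]).
Proof.
rewrite (_ : 0 = (-1) *: chi R [::] [::] + chi R [::] [::]).
  by apply: Cc_lin; exact: Cc_chi.
by rewrite scaleN1r addNr.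
Qed.

Lemma Cc_poly_fun (c : cuntz_poly R n) : Cc (poly_fun c).
Proof.
rewrite /poly_fun; elim/big_rec: _ => [|m f _]; first exact: Cc0.
by apply: Cc_lin; exact: Cc_chi.
Qed.

Lemma poly_funE (c : cuntz_poly R n) (g : G) :
  poly_fun c g = \sum_(m <- c) m.1 * chi R m.2.1 m.2.2 g.
Proof. by rewrite /poly_fun fct_sumE. Qed.

Lemma poly_fun_locally_cst (c : cuntz_poly R n) (g : G) :
  exists w v, gcylinder w v g /\ forall h, gcylinder w v h -> poly_fun c h = poly_fun c g.
Proof.
elim: c => [|m c [w [v [wvg E]]]].
  have [w [v [x ->]]] := geltP g; exists w, v; split; first exact: gelt_cylinder.
  by move=> h _; rewrite !poly_funE !big_nil.
have [w' [v' [wvg' E']]] := chi_locally_cst m.2.1 m.2.2 g.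
have [w2 [v2 [g2 s2]]] := gopenI (@open_gcylinder n w v) (@open_gcylinder n w' v')
  (conj wvg wvg').
exists w2, v2; split => // h /s2[/E e /E' e'].
by rewrite !poly_funE !big_cons e' -!poly_funE e.
Qed.

Lemma gstar_chi (w v : word) : gstar (chi R w v) = chi R v w.
Proof.
apply/funext => g; rewrite /gstar.
have [vwg|Nvwg] := pselect (gcylinder v w g).
  by rewrite !chiT ?rmorph1 //; apply/gcylinder_inv.
by rewrite !chiF ?rmorph0 // => /gcylinder_inv.
Qed.

(** An element of the cylinder of [(w ++ r, u)] factors in exactly one way through the two given
    cylinders, and no other element does; the convolution sum has one term or none. *)
Lemma conv_chi_cat (w v u r : word) :
  Defs.conv (chi R w v) (chi R (v ++ r) u) = chi R (w ++ r) u.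
Proof.
apply/funext => g; rewrite /Defs.conv.
have term (p : G * G) : gfactor g p -> chi R w v p.1 * chi R (v ++ r) u p.2 != 0 ->
    exists y, [/\ g = gelt (w ++ r) u y, p.1 = gelt w v (wcat r y) & p.2 = gelt (v ++ r) u y].
  case: p => p1 p2 [/= r1 sr s2 d12]; rewrite mulf_eq0 negb_or => /andP[].
  move=> /chi_neq0/gcylinderP[x p1E] /chi_neq0/gcylinderP[y p2E]; exists y.
  have xE : x = wcat r y.
    by apply: (@wcat_inj _ v); move: sr; rewrite p1E p2E /gsrc /grng /= wcatA.
  rewrite xE in p1E; split => //; apply: gext.
  - by rewrite -r1 p1E /grng /= wcatA.
  - by rewrite -s2 p2E.
  - by rewrite -d12 p1E p2E /gdeg /= !size_cat; lia.
have [/gcylinderP[y gE]|Ng] := pselect (gcylinder (w ++ r) u g); last first.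
  rewrite chiF // fsbig1 // => p gp; apply: contrapT => /eqP /(term p gp)[y [gE _ _]].
  by apply: Ng; apply/gcylinderP; exists y.
rewrite chiT; last by rewrite gE; exact: gelt_cylinder.
pose p0 := (gelt w v (wcat r y), gelt (v ++ r) u y).
rewrite -(@fsbig_widen _ _ _ _ [set p0]).
- by rewrite fsbig_set1 !chiT ?mulr1 //; exact: gelt_cylinder.
- move=> _ ->; rewrite gE; split; rewrite /grng /gsrc /gdeg /= ?wcatA //.
  by rewrite !size_cat; lia.
- move=> p [gp Np] /=; apply: contrapT => /eqP /(term p gp)[z [gE' p1E p2E]].
  apply: Np => /=; rewrite [p]surjective_pairing p1E p2E /p0.
  by have -> : z = y by apply: (@gelt_inj _ (w ++ r) u); rewrite -gE'.
Qed.

(** A composable pair would give one path that starts with both [v] and [v']. *)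
Lemma conv_chi_neq (w v v' u : word) : ~~ prefix v v' -> ~~ prefix v' v ->
  Defs.conv (chi R w v) (chi R v' u) = 0.
Proof.
move=> N1 N2; apply/funext => g; rewrite /Defs.conv fsbig1 // => -[p1 p2] [/= _ sr _ _].
apply: contrapT => /eqP; rewrite mulf_eq0 negb_or => /andP[/chi_neq0/gcylinderP[x p1E] /chi_neq0/gcylinderP[y p2E]].
move: sr; rewrite p1E p2E /gsrc /grng /= => E.
have [vv'|/ltnW v'v] := leqP (size v) (size v').
  have [r v'E _] := wcat_prefix vv' E.
  by move: N1; rewrite v'E prefix_prefix.
have [r vE _] := wcat_prefix v'v (esym E).
by move: N2; rewrite vE prefix_prefix.
Qed.

(** A cylinder is the disjoint union of its refinements by one letter, taken according to the first
    letter of the tail. *)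
Lemma sum_chi (w v : word) : \sum_i chi R (rcons w i) (rcons v i) = chi R w v.
Proof.
apply/funext => g; rewrite fct_sumE.
have sub i : gcylinder (rcons w i) (rcons v i) g -> gcylinder w v g.
  rewrite -!cats1 => /gcylinderP[x ->]; rewrite gelt_cat; exact: gelt_cylinder.
have [/gcylinderP[x gE]|N] := pselect (gcylinder w v g); last first.
  by rewrite chiF // big1 // => i _; rewrite chiF // => /sub.
rewrite chiT; last by rewrite gE; exact: gelt_cylinder.
rewrite (bigD1 (x 0%N)) //= chiT => [|]; last first.
  apply/gcylinderP; exists (pdrop 1 x); rewrite -!cats1 gelt_cat gE.
  by have := ptakeK 1 x; rewrite /ptake /= => ->.
rewrite big1 ?addr0 // => i ix; apply/chiF => /gcylinderP[y].
rewrite -!cats1 gelt_cat gE => /gelt_inj /(congr1 (fun z : X => z 0%N)).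
by rewrite (wcat_head _ i) //= => E; rewrite E eqxx in ix.
Qed.

Section StarRep.
Context (H : prehilbert R) (rho : (G -> R[i]) -> H -> H) (rhoR : star_rep rho).

Lemma star_rep_linear f : Cc f -> linear (rho f).
Proof. by case: rhoR => + _ _ _ => /[apply] -[]. Qed.

Lemma star_rep_lin (a : R[i]) f f' h : Cc f -> Cc f' ->
  rho (a *: f + f') h = a *: rho f h + rho f' h.
Proof. by case: rhoR => _ L _ _ fc fc'; rewrite L. Qed.

Lemma star_rep0 h : rho 0 h = 0.
Proof.
have := @star_rep_lin (-1) _ _ h (Cc_chi [::] [::]) (Cc_chi [::] [::]).
by rewrite !scaleN1r !addNr.
Qed.

Lemma star_rep_poly (c : cuntz_poly R n) h :
  rho (poly_fun c) h = fam_poly (fun w v => rho (chi R w v)) c h.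
Proof.
elim: c => [|m c IH]; first by rewrite /poly_fun /fam_poly !big_nil star_rep0.
rewrite /poly_fun /fam_poly !big_cons star_rep_lin; last 2 first.
- exact: Cc_chi.
- exact: Cc_poly_fun.
by congr (_ + _).
Qed.

Lemma star_rep_family : cuntz_family (fun w v => rho (chi R w v)).
Proof.
have [_ _ mul adj] := rhoR; split.
- by move=> w v; apply: star_rep_linear; exact: Cc_chi.
- by move=> w v h k; rewrite adj ?gstar_chi //; exact: Cc_chi.
- move=> w v u r h; rewrite -(conv_chi_cat w v) mul //; exact: Cc_chi.
- move=> w v v' u h N1 N2.
  have := mul _ _ (Cc_chi w v) (Cc_chi v' u).
  by rewrite conv_chi_neq // => /(congr1 (fun T : H -> H => T h)) /= <-; rewrite star_rep0.
- move=> w v h; rewrite -[in RHS]sum_chi.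
  (* The sum over letters is presented as a polynomial so that linearity of [rho] on long sums is
     already available. *)
  pose c : cuntz_poly R n := [seq (1, (rcons w i, rcons v i)) | i <- enum 'I_n].
  have -> : \sum_i chi R (rcons w i) (rcons v i) = poly_fun c.
    by rewrite /poly_fun big_map big_enum; apply: eq_bigr => i _; rewrite scale1r.
  rewrite star_rep_poly /fam_poly big_map big_enum.
  by apply: eq_bigr => i _; rewrite scale1r.
Qed.

End StarRep.
End ConvolutionAlgebra.

(** * Weighted compositions on L^2 *)

Section SquareIntegrable.
Local Open Scope quotient_scope.
Context d (T : measurableType d) (R : realType) (mu : {measure set T -> \bar R}).

(** The squared modulus as an element of [R], fit for integration; the norm of [R[i]] takes its
    values in [R[i]]. *)
Definition cnsq (z : R[i]) : R := complex.Re z ^+ 2 + complex.Im z ^+ 2.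

Definition cmeasurable (f : T -> R[i]) :=
  measurable_fun setT (fun t => complex.Re (f t)) /\
  measurable_fun setT (fun t => complex.Im (f t)).

Lemma cnsq_ge0 z : 0 <= cnsq z.
Proof. by rewrite addr_ge0 ?sqr_ge0. Qed.

Lemma cnsqM y z : cnsq (y * z) = cnsq y * cnsq z.
Proof. by case: y z => [a b] [e f]; rewrite /cnsq /=; ring. Qed.

Lemma cnsqE z : (cnsq z)%:C%C = `|z| ^+ 2.
Proof. exact: add_Re2_Im2. Qed.

Lemma cnsq_mulJ z : z * z^* = (cnsq z)%:C%C.
Proof. by rewrite -normCK cnsqE. Qed.

Lemma measurable_cnsq f : cmeasurable f -> measurable_fun setT (fun t => cnsq (f t)).
Proof.
move=> [mr mi]; apply: measurable_funD; exact: measurable_funX.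
Qed.

Lemma cmeasurableM f g : cmeasurable f -> cmeasurable g ->
  cmeasurable (fun t => f t * g t).
Proof.
move=> [fr fi] [gr gi]; split.
  rewrite (_ : (fun t => _) = (fun t => complex.Re (f t) * complex.Re (g t) -
    complex.Im (f t) * complex.Im (g t))).
    by apply: measurable_funB; exact: measurable_funM.
  by apply/funext => t; case: (f t) (g t) => [? ?] [? ?].
rewrite (_ : (fun t => _) = (fun t => complex.Re (f t) * complex.Im (g t) +
  complex.Im (f t) * complex.Re (g t))).
  by apply: measurable_funD; exact: measurable_funM.
by apply/funext => t; case: (f t) (g t) => [? ?] [? ?].
Qed.

Lemma cmeasurableJ f : cmeasurable f -> cmeasurable (fun t => (f t)^*).
Proof.
move=> [fr fi]; split.
  by rewrite (_ : (fun t => _) = (fun t => complex.Re (f t))) //;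
    apply/funext => t; case: (f t).
rewrite (_ : (fun t => _) = (fun t => - complex.Im (f t))); last first.
  by apply/funext => t; case: (f t).
exact: measurableT_comp.
Qed.

Lemma cmeasurable_comp f (th : T -> T) : measurable_fun setT th ->
  cmeasurable f -> cmeasurable (fun t => f (th t)).
Proof.
move=> mth [fr fi]; split.
  exact: (measurableT_comp fr).
exact: (measurableT_comp fi).
Qed.

Lemma cmeasurable_cst z : cmeasurable (fun=> z).
Proof. by split; exact: measurable_cst. Qed.

Lemma cmeasurable_if (P : T -> bool) f : measurable_fun setT P ->
  cmeasurable f -> cmeasurable (fun t => if P t then f t else 0).
Proof.
move=> mP [fr fi]; split.
  rewrite (_ : (fun t => _) = (fun t => if P t then complex.Re (f t) else 0)).
    by apply: measurable_fun_ifT => //; exact: measurable_cst.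
  by apply/funext => t; case: (P t).
rewrite (_ : (fun t => _) = (fun t => if P t then complex.Im (f t) else 0)).
  by apply: measurable_fun_ifT => //; exact: measurable_cst.
by apply/funext => t; case: (P t).
Qed.

Lemma Lfun2P (f : T -> R) : (f \in Lfun mu 2%:E) <->
  measurable_fun setT f /\ (\int[mu]_t ((f t) ^+ 2)%:E < +oo)%E.
Proof.
split=> [fL|[mf foo]].
  have /integrableP[_] := Lfun2_integrable_sqr fL.
  have -> : (\int[mu]_x `|(EFin \o (fun x => (f x ^+ 2)%R)) x| =
      \int[mu]_t ((f t) ^+ 2)%:E)%E.
    by apply: eq_integral => t _ /=; rewrite ger0_norm ?sqr_ge0.
  by split => //; move: fL; rewrite inE => /andP[]; rewrite inE.
rewrite inE; apply/andP; split; first by rewrite inE.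
rewrite inE /= /finite_norm unlock /Lnorm; apply: poweR_lty.
apply: le_lt_trans foo; rewrite le_eqVlt; apply/orP; left; apply/eqP.
apply: eq_integral => t _; rewrite [abse _]abse_EFin poweR_EFin.
by rewrite powR_mulrn // -normrX ger0_norm // sqr_ge0.
Qed.

Lemma CLfun2P (f : T -> R[i]) : f \in CLfun2 mu <->
  cmeasurable f /\ (\int[mu]_t (cnsq (f t))%:E < +oo)%E.
Proof.
have int2 (g h : T -> R) : measurable_fun setT g -> measurable_fun setT h ->
    (\int[mu]_t (g t ^+ 2 + h t ^+ 2)%:E =
     \int[mu]_t (g t ^+ 2)%:E + \int[mu]_t (h t ^+ 2)%:E)%E.
  move=> mg mh; under eq_integral do rewrite EFinD.
  rewrite ge0_integralD // => [t _||t _|]; rewrite ?lee_fin ?sqr_ge0 //;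
    by apply/measurable_EFinP; exact: measurable_funX.
have pos (g : T -> R) : (0 <= \int[mu]_t (g t ^+ 2)%:E)%E.
  by apply: integral_ge0 => t _; rewrite lee_fin sqr_ge0.
split=> [/andP[/Lfun2P[fr ifr] /Lfun2P[fi ifi]]|[[fr fi]]].
  by split => //; rewrite int2 // lte_add_pinfty.
rewrite int2 // => foo; apply/andP; split; apply/Lfun2P; split => //.
  by apply: le_lt_trans foo; rewrite leeDl.
by apply: le_lt_trans foo; rewrite leeDr.
Qed.

Lemma CL2_funP (x : CL2 mu) : (x : T -> R[i]) \in CLfun2 mu.
Proof. exact: (valP (repr x)). Qed.

Lemma CL2_meas (x : CL2 mu) : cmeasurable x.
Proof. by have /CLfun2P[] := CL2_funP x. Qed.

Definition CL2_of (f : T -> R[i]) : CL2 mu :=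
  \pi_(CL2 mu) (insubd (0 : CLfun2Type mu) f).

Lemma CL2_ofE f : f \in CLfun2 mu -> {ae mu, forall t, CL2_of f t = f t}.
Proof.
move=> fL; have := CL2_piE (insubd (0 : CLfun2Type mu) f).
by rewrite /CL2_of insubdK.
Qed.

Lemma cmeasurable_mulJ f g : cmeasurable f -> cmeasurable g ->
  cmeasurable (fun t => f t * (g t)^* ).
Proof. by move=> mf mg; apply: cmeasurableM => //; exact: cmeasurableJ. Qed.

Lemma CL2_dotE (x y : CL2 mu) f g : cmeasurable f -> cmeasurable g ->
  {ae mu, forall t, x t = f t} -> {ae mu, forall t, y t = g t} ->
  CL2_dot x y = Complex (\int[mu]_t complex.Re (f t * (g t)^* ))
                        (\int[mu]_t complex.Im (f t * (g t)^* )).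
Proof.
move=> mf mg xf yg.
have [m1 m2] := cmeasurable_mulJ (CL2_meas x) (CL2_meas y).
have [m3 m4] := cmeasurable_mulJ mf mg.
rewrite /CL2_dot; congr Complex; congr fine; apply: ae_eq_integral => //.
- exact/measurable_EFinP.
- exact/measurable_EFinP.
- by apply: filterS2 xf yg => t -> ->.
- exact/measurable_EFinP.
- exact/measurable_EFinP.
- by apply: filterS2 xf yg => t -> ->.
Qed.

(** Used twice: Lebesgue measure on [0, 1] gives back [L2I], counting measure gives l^2. *)
Definition CL2_space : prehilbert R := PreHilbert (@CL2_dot _ T R mu : {dot CL2 mu for _}).

Lemma CL2_hnorm (x : CL2_space) f : f \in CLfun2 mu ->
  {ae mu, forall t, (x : CL2 mu) t = f t} ->
  ((hnorm x) ^+ 2)%:E = (\int[mu]_t (cnsq (f t))%:E)%E.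
Proof.
move=> /CLfun2P[mf foo] xf.
have E : hform CL2_space x x = (hnorm x ^+ 2)%:C%C by rewrite hform_norm.
have [<- _] : Complex (\int[mu]_t complex.Re (f t * (f t)^* ))
    (\int[mu]_t complex.Im (f t * (f t)^* )) = (hnorm x ^+ 2)%:C%C.
  by rewrite -E -(CL2_dotE mf mf xf xf).
rewrite /Rintegral fineK.
  by apply: eq_integral => t _; rewrite cnsq_mulJ.
rewrite ge0_fin_numE.
  by under eq_integral do rewrite cnsq_mulJ.
by apply: integral_ge0 => t _; rewrite cnsq_mulJ lee_fin cnsq_ge0.
Qed.

End SquareIntegrable.

(* [th] maps [S] onto [S'] up to null sets, with inverse [th'], and divides the
   measure by [c]. *)
Record change_of_variable d (T : measurableType d) (R : realType)
    (mu : {measure set T -> \bar R}) (S S' : set T) (th th' : T -> T) (c : R) : Prop :=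
  ChangeOfVariable {
  cv_mS : measurable S;
  cv_mS' : measurable S';
  cv_th : measurable_fun setT th;
  cv_th' : measurable_fun setT th';
  cv_ge0 : 0 <= c;
  cv_inv : forall t, S t -> th' (th t) = t;
  cv_mu : forall A, measurable A -> mu (S `&` th @^-1` A) = (c%:E * mu (S' `&` A))%E }.

Section WeightedComposition.
Context d (T : measurableType d) (R : realType) (mu : {measure set T -> \bar R}).
Context (S S' : set T) (th th' : T -> T) (c : R).
Hypothesis cv : change_of_variable mu S S' th th' c.

Lemma integral_mrestr (D : set T) (mD : measurable D) (g : T -> \bar R) :
  measurable_fun setT g -> (forall t, 0 <= g t)%E ->
  (\int[mrestr mu mD]_t g t = \int[mu]_(t in D) g t)%E.
Proof.
move=> mg g0; rewrite -(setUv D) ge0_integral_setU //; last 3 first.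
- exact: measurableC.
- by rewrite setUv.
- by apply/disj_setPS; rewrite setICr.
rewrite [X in (_ + X)%E](_ : _ = 0%E) ?adde0; last first.
  rewrite (@eq_measure_integral _ _ _ _ mzero) ?integral_measure_zero //.
  move=> A mA AD; rewrite /= /mrestr /mzero.
  suff -> : A `&` D = set0 by rewrite measure0.
  by rewrite -subset0 => t [/AD].
apply: eq_measure_integral => A mA AD; rewrite /= /mrestr.
by rewrite setIidl.
Qed.

(** The image under [th] of the measure restricted to [S] is [c] times the measure restricted to
    [S']. *)
Lemma ge0_integral_cv (g : T -> \bar R) : measurable_fun setT g ->
  (forall t, 0 <= g t)%E ->
  (\int[mu]_(t in S) g (th t) = c%:E * \int[mu]_(s in S') g s)%E.
Proof.
move=> mg g0; have [mS mS' mth _ c0 _ Hmu] := cv.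
rewrite -(integral_mrestr mS) //; last exact: measurableT_comp.
rewrite -(integral_mrestr mS') //.
rewrite -[RHS](@ge0_integral_mscale _ _ _ (mrestr mu mS') setT measurableT
  (NngNum c0) g) //.
rewrite -[LHS](@ge0_integral_pushforward _ _ _ _ _ th mth (mrestr mu mS) setT g) //.
apply: eq_measure_integral => A mA _.
rewrite /= /pushforward /mscale /= /mrestr setIC Hmu //.
by rewrite setIC.
Qed.

Lemma integral_cv (g : T -> R) : measurable_fun setT g ->
  (\int[mu]_(t in S) (g (th t))%:E = \int[mu]_(s in S') (c * g s)%:E)%E.
Proof.
move=> mg; have [mS mS' mth _ c0 _ _] := cv.
have mg' : measurable_fun setT (EFin \o g) by exact/measurable_EFinP.
rewrite integralE [RHS]integralE; congr (_ - _)%E.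
  transitivity (\int[mu]_(t in S) ((EFin \o g)^\+ (th t)))%E; first by apply: eq_integral => t _; rewrite !unlock.
  rewrite ge0_integral_cv //; last exact: measurable_funepos.
  rewrite -ge0_integralZl //; last first.
    by apply: measurable_funTS; exact: measurable_funepos.
  by apply: eq_integral => s _; rewrite !unlock /= EFinM maxe_pMr // mule0.
transitivity (\int[mu]_(t in S) ((EFin \o g)^\- (th t)))%E; first by apply: eq_integral => t _; rewrite !unlock.
rewrite ge0_integral_cv //; last exact: measurable_funeneg.
rewrite -ge0_integralZl //; last first.
  by apply: measurable_funTS; exact: measurable_funeneg.
by apply: eq_integral => s _; rewrite !unlock /= -mulrN EFinM maxe_pMr // mule0.
Qed.

Lemma integral_on (D : set T) (g : T -> \bar R) : measurable D ->
  (forall t, ~ D t -> g t = 0%E) ->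
  (\int[mu]_t g t = \int[mu]_(t in D) g t)%E.
Proof.
move=> mD g0; rewrite [RHS]integral_mkcond; apply: eq_integral => t _.
by rewrite /patch; case: ifPn => // /negP; rewrite inE => /g0.
Qed.

Section Weight.
Context (a : T -> R[i]) (M : R).
Hypotheses (ma : cmeasurable a) (M0 : 0 <= M) (aM : forall t, cnsq (a t) <= M).
Hypothesis aS : forall t, ~ S t -> a t = 0.
Implicit Types (h k : CL2 mu).

(** One construction serves both representations: with affine [th] it is an isometry S_w on
    L^2[0, 1], and with a change of prefix it is the action on l^2 of a function supported in one
    cylinder. *)
Definition wcomp h : CL2 mu := CL2_of mu (fun t => a t * h (th t)).

(** The weight of the adjoint, found by substituting s = [th] t in the integral of a(t) h(th t)
    times the conjugate of k(t); [c] is the Jacobian factor. *)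
Definition wadj_weight (s : T) : R[i] :=
  if `[< S' s >] then c%:C%C * (a (th' s))^* else 0.

Definition wadj k : CL2 mu := CL2_of mu (fun s => wadj_weight s * k (th' s)).

Lemma cmeasurable_wadj_weight : cmeasurable wadj_weight.
Proof.
apply: cmeasurable_if.
  apply: (measurable_fun_bool true); rewrite setTI.
  rewrite (_ : _ @^-1` _ = S'); first exact: cv_mS' cv.
  by apply/seteqP; split=> t /= /asboolP.
apply: cmeasurableM; first exact: cmeasurable_cst.
by apply: cmeasurableJ; apply: cmeasurable_comp => //; exact: cv_th' cv.
Qed.

Lemma integral_wcomp_le (f : T -> R[i]) : cmeasurable f ->
  (\int[mu]_t (cnsq (a t * f (th t)))%:E <=
   (c * M)%:E * \int[mu]_t (cnsq (f t))%:E)%E.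
Proof.
move=> mf; have [mS mS' mth mth' c0 _ _] := cv.
have mcf := measurable_cnsq mf.
rewrite (integral_on mS) => [|t /aS ->]; last by rewrite mul0r /cnsq /= expr0n addr0.
apply: (@le_trans _ _ (\int[mu]_(t in S) (M * cnsq (f (th t)))%:E)%E).
  apply: ge0_le_integral => //.
  - by move=> t _; rewrite lee_fin cnsq_ge0.
  - apply/measurable_EFinP; apply: measurable_funTS; apply: measurable_cnsq.
    by apply: cmeasurableM => //; exact: cmeasurable_comp.
  - apply/measurable_EFinP; apply: measurable_funTS; apply: measurable_funM => //.
    exact: (measurableT_comp mcf).
  - by move=> t _; rewrite lee_fin cnsqM ler_wpM2r ?cnsq_ge0.
rewrite (@integral_cv (fun s => M * cnsq (f s))); last exact: measurable_funM.
under eq_integral do rewrite mulrA EFinM.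
rewrite ge0_integralZl //; last 3 first.
- by apply/measurable_EFinP; exact: measurable_funTS.
- by move=> s _; rewrite lee_fin cnsq_ge0.
- by rewrite lee_fin mulr_ge0.
apply: lee_wpmul2l; first by rewrite lee_fin mulr_ge0.
apply: ge0_subset_integral => //; first exact/measurable_EFinP.
by move=> s _; rewrite lee_fin cnsq_ge0.
Qed.

Lemma integral_wadj_le (f : T -> R[i]) : cmeasurable f ->
  (\int[mu]_s (cnsq (wadj_weight s * f (th' s)))%:E <=
   (c * M)%:E * \int[mu]_t (cnsq (f t))%:E)%E.
Proof.
move=> mf; have [mS mS' mth mth' c0 thK _] := cv.
have mcf := measurable_cnsq mf; have mca := measurable_cnsq ma.
pose F s := cnsq (a (th' s)) * cnsq (f (th' s)).
have mF : measurable_fun setT F.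
  by apply: measurable_funM; [exact: (measurableT_comp mca)|exact: (measurableT_comp mcf)].
have cF s : S' s -> cnsq (wadj_weight s * f (th' s)) = c * (c * F s).
  rewrite /wadj_weight => S's; rewrite asboolT // !cnsqM /F.
  have -> : cnsq (c%:C%C : R[i]) = c ^+ 2 by rewrite /cnsq /= expr0n addr0.
  have -> z : cnsq (z^* : R[i]) = cnsq z by case: z => x y; rewrite /cnsq /= sqrrN.
  by rewrite expr2 !mulrA.
rewrite (integral_on mS') => [|s Ns]; last first.
  by rewrite /wadj_weight asboolF // mul0r /cnsq /= expr0n addr0.
rewrite (eq_integral (fun s => (c * (c * F s))%:E)); last first.
  by move=> s; rewrite inE => /cF ->.
under eq_integral do rewrite EFinM.
rewrite ge0_integralZl //; last 2 first.
- by apply/measurable_EFinP; apply: measurable_funTS; exact: measurable_funM.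
- by move=> s _; rewrite lee_fin !mulr_ge0 ?cnsq_ge0.
(* The weight contributes [c] twice: one factor stays as a constant, the other is absorbed when the
   integral is carried back to [S]. *)
rewrite EFinM -muleA; apply: lee_wpmul2l; first by rewrite lee_fin.
rewrite -integral_cv //.
rewrite -ge0_integralZl //; last 2 first.
- exact/measurable_EFinP.
- by move=> s _; rewrite lee_fin cnsq_ge0.
rewrite (eq_integral (fun t => (cnsq (a t) * cnsq (f t))%:E)); last first.
  by move=> t; rewrite inE => St; rewrite /F thK.
apply: (@le_trans _ _ (\int[mu]_(t in S) (M%:E * (cnsq (f t))%:E))%E).
  apply: ge0_le_integral => //.
  - by move=> t _; rewrite lee_fin mulr_ge0 ?cnsq_ge0.
  - by apply/measurable_EFinP; apply: measurable_funTS; exact: measurable_funM.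
  - by apply/measurable_EFinP; apply: measurable_funTS; exact: measurable_funM.
  - by move=> t _; rewrite -EFinM lee_fin ler_wpM2r ?cnsq_ge0.
apply: ge0_subset_integral => //.
  by apply/measurable_EFinP; exact: measurable_funM.
by move=> s _; rewrite -EFinM lee_fin mulr_ge0 ?cnsq_ge0.
Qed.

Lemma wcomp_CLfun2 f : f \in CLfun2 mu -> (fun t => a t * f (th t)) \in CLfun2 mu.
Proof.
move=> /CLfun2P[mf foo]; apply/CLfun2P; split.
  by apply: cmeasurableM => //; apply: cmeasurable_comp => //; exact: cv_th cv.
by apply: le_lt_trans (integral_wcomp_le mf) _; rewrite lte_mul_pinfty ?lee_fin ?mulr_ge0 // (cv_ge0 cv).
Qed.

Lemma wadj_CLfun2 f : f \in CLfun2 mu -> (fun s => wadj_weight s * f (th' s)) \in CLfun2 mu.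
Proof.
move=> /CLfun2P[mf foo]; apply/CLfun2P; split.
  apply: cmeasurableM; first exact: cmeasurable_wadj_weight.
  by apply: cmeasurable_comp => //; exact: cv_th' cv.
by apply: le_lt_trans (integral_wadj_le mf) _; rewrite lte_mul_pinfty ?lee_fin ?mulr_ge0 // (cv_ge0 cv).
Qed.

Lemma wcompE h : {ae mu, forall t, wcomp h t = a t * h (th t)}.
Proof. by apply: CL2_ofE; apply: wcomp_CLfun2; exact: CL2_funP. Qed.

Lemma wadjE k : {ae mu, forall s, wadj k s = wadj_weight s * k (th' s)}.
Proof. by apply: CL2_ofE; apply: wadj_CLfun2; exact: CL2_funP. Qed.

Lemma wcomp_adj h k : CL2_dot (wcomp h) k = CL2_dot h (wadj k).
Proof.
have [mS mS' mth mth' c0 thK _] := cv.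
have /CLfun2P[mh _] := CL2_funP h; have /CLfun2P[mk _] := CL2_funP k.
have /CLfun2P[mah _] := wcomp_CLfun2 (CL2_funP h).
have /CLfun2P[mbk _] := wadj_CLfun2 (CL2_funP k).
rewrite (CL2_dotE mah mk (wcompE h) (aeW _ (fun=> erefl))).
rewrite (CL2_dotE mh mbk (aeW _ (fun=> erefl)) (wadjE k)).
pose F s := a (th' s) * h s * (k (th' s))^*.
have [mFr mFi] : cmeasurable F.
  apply: cmeasurableM; last by apply: cmeasurableJ; exact: cmeasurable_comp.
  by apply: cmeasurableM => //; exact: cmeasurable_comp.
have FS t : S t -> a t * h (th t) * (k t)^* = F (th t).
  by move=> St; rewrite /F thK.
have FS' s : S' s -> h s * (wadj_weight s * k (th' s))^* = c%:C%C * F s.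
  move=> S's; rewrite /wadj_weight asboolT // !rmorphM /= conjCK.
  by rewrite conj_real /F; ring.
congr Complex; congr fine.
- rewrite (integral_on mS) => [|t /aS ->]; last by rewrite !mul0r.
  rewrite [RHS](integral_on mS') => [|s Ns]; last first.
    by rewrite /wadj_weight asboolF // mul0r rmorph0 mulr0.
  rewrite (eq_integral (fun t => (complex.Re (F (th t)))%:E)); last first.
    by move=> t; rewrite inE => /FS ->.
  rewrite (@integral_cv (fun s => complex.Re (F s))) //; apply: eq_integral => s; rewrite inE => /FS' ->.
  by case: (F s) => x y /=; rewrite mul0r subr0.
- rewrite (integral_on mS) => [|t /aS ->]; last by rewrite !mul0r.
  rewrite [RHS](integral_on mS') => [|s Ns]; last first.
    by rewrite /wadj_weight asboolF // mul0r rmorph0 mulr0.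
  rewrite (eq_integral (fun t => (complex.Im (F (th t)))%:E)); last first.
    by move=> t; rewrite inE => /FS ->.
  rewrite (@integral_cv (fun s => complex.Im (F s))) //; apply: eq_integral => s; rewrite inE => /FS' ->.
  by case: (F s) => x y /=; rewrite mul0r addr0.
Qed.

Lemma wcomp_norm (h : CL2_space mu) :
  hnorm (wcomp h : CL2_space mu) ^+ 2 <= c * M * hnorm h ^+ 2.
Proof.
rewrite -lee_fin (CL2_hnorm (wcomp_CLfun2 (CL2_funP h)) (wcompE h)).
rewrite EFinM (CL2_hnorm (CL2_funP h) (aeW _ (fun=> erefl))).
by apply: integral_wcomp_le; exact: CL2_meas.
Qed.

End Weight.
End WeightedComposition.

Section AdjointPairs.
Context (R : realType) (H : prehilbert R).

(** Linearity comes for free from an adjoint, without any computation with classes of functions. *)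
Lemma adj_linear (A B : H -> H) :
  (forall h k, hform H (A h) k = hform H h (B k)) -> linear A.
Proof.
move=> AB z u v; apply: hformI => k.
have BA h l : hform H h (A l) = hform H (B h) l.
  by rewrite hformC AB -hformC.
by rewrite BA !(hformDr, hformZr) -!BA.
Qed.

Lemma adjointE (A B : H -> H) :
  (forall h k, hform H (A h) k = hform H h (B k)) -> adjoint A = B.
Proof.
move=> AB; apply: xget_unique => // B' AB'; apply/funext => k.
by apply: hformI => h; rewrite -AB -AB'.
Qed.

End AdjointPairs.

(** * The regular representation *)

Lemma cauchy_real (R : realType) (u : nat -> R) :
  (forall e : R, 0 < e -> exists N, forall i j, (N <= i)%N -> (N <= j)%N ->
    `|u i - u j| < e) -> exists l : R, u @ \oo --> l.
Proof.
move=> uC; suff ul : cvgn u by exists (limn u).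
apply: cauchy_cvg; apply: cauchy_exP => e e0; have [N HN] := uC e e0; exists (u N).
by exists N => // k /= Nk; rewrite /ball /=; exact: HN.
Qed.

Lemma einf_le (R : realType) (u : nat -> \bar R) (e : \bar R) :
  (forall k, (u k <= e)%E) -> (limn_einf u <= e)%E.
Proof.
move=> ue; rewrite limn_einf_lim.
apply: lime_le; first exact: is_cvg_einfs.
apply: nearW => k; apply: le_trans (ue k).
by apply: ereal_inf_lbound; exists k => //=.
Qed.

(** * The space l^2 as L^2 of a counting measure *)

Section LittleL2.
Context d (T : measurableType d) (R : realType).
Hypothesis discreteT : forall A : set T, measurable A.
Local Notation mu := (@counting T R : {measure set T -> \bar R}).
Local Notation L := (@CL2_space d T R mu).
Implicit Types (xi eta : L).

Lemma discrete_meas d' (T' : measurableType d') (f : T -> T') : measurable_fun setT f.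
Proof. by move=> _ A _; exact: discreteT. Qed.

Lemma discrete_cmeas (f : T -> R[i]) : cmeasurable f.
Proof. by split; exact: discrete_meas. Qed.

Lemma counting1 (t : T) : mu [set t] = 1%E.
Proof. by rewrite /= /counting asboolT // fset_set1 finmap.cardfs1. Qed.

Lemma counting_ae (P : T -> Prop) : {ae mu, forall t, P t} -> forall t, P t.
Proof.
move=> [N [mN N0 PN]] t; apply: contrapT => Pt.
have : (mu [set t] <= mu N)%E.
  by apply: le_measure; rewrite ?inE // => _ ->; exact: PN.
by rewrite N0 counting1 leNgt lte01.
Qed.

Lemma counting_image (A : set T) (f : T -> T) : {in A &, injective f} ->
  mu (f @` A) = mu A.
Proof.
move=> fA; have E := inj_card_eq fA; rewrite /= /counting.
rewrite (eq_finite_set E); case: (pselect (finite_set A)) => [finA|infA].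
  rewrite asboolT //; congr (_%:R%:E).
  have /finite_setP[m Am] := finA.
  by rewrite (card_fset_set Am); apply: card_fset_set; exact: card_eq_trans Am.
by rewrite asboolF.
Qed.

Lemma L2_ext xi eta : (forall t, (xi : CL2 mu) t = (eta : CL2 mu) t) -> xi = eta.
Proof. by move=> E; apply: CL2_ext; exact: aeW. Qed.

Lemma L2_ofE f : f \in CLfun2 mu -> forall t, CL2_of mu f t = f t.
Proof. by move=> fL; apply: counting_ae; exact: CL2_ofE. Qed.

Lemma L2_addE xi eta t : (xi + eta : CL2 mu) t = (xi : CL2 mu) t + (eta : CL2 mu) t.
Proof. by move: t; apply: counting_ae; exact: CL2_addE. Qed.

Lemma L2_scaleE (a : R[i]) xi t : (a *: xi : CL2 mu) t = a * (xi : CL2 mu) t.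
Proof. by move: t; apply: counting_ae; exact: CL2_scaleE. Qed.

Lemma L2_oppE xi t : (- xi : CL2 mu) t = - (xi : CL2 mu) t.
Proof. by rewrite -scaleN1r L2_scaleE mulN1r. Qed.

Lemma integral_point (t : T) (g : T -> \bar R) : (forall s, s != t -> g s = 0%E) ->
  (\int[mu]_s g s = g t)%E.
Proof.
move=> g0; rewrite (@integral_on _ _ _ mu [set t]) // => [|s]; last first.
  by move=> /= /eqP/g0.
rewrite (eq_integral (cst (g t))) => [|s]; last by rewrite inE => ->.
by rewrite integral_cst ?counting1 ?mule1.
Qed.

Definition L2_delta (t : T) : L := CL2_of mu (fun s => (s == t)%:R).

Lemma L2_delta_CLfun2 t : (fun s : T => (s == t)%:R : R[i]) \in CLfun2 mu.
Proof.
apply/CLfun2P; split; first exact: discrete_cmeas.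
rewrite (@integral_point t) ?ltry // => s /negPf ->.
by rewrite /cnsq /= expr0n addr0.
Qed.

Lemma L2_deltaE t s : (L2_delta t : CL2 mu) s = (s == t)%:R.
Proof. exact: L2_ofE (L2_delta_CLfun2 t) s. Qed.

Lemma L2_dot_delta xi t : hform L xi (L2_delta t) = (xi : CL2 mu) t.
Proof.
rewrite /= /CL2_dot /Rintegral.
rewrite (@integral_point t) => [|s st]; last first.
  by rewrite L2_deltaE (negPf st) rmorph0 mulr0.
rewrite (@integral_point t) => [|s st]; last first.
  by rewrite L2_deltaE (negPf st) rmorph0 mulr0.
by rewrite L2_deltaE eqxx rmorph1 mulr1 /=; case: ((xi : CL2 mu) t).
Qed.

Lemma L2_delta_norm t : hnorm (L2_delta t) = 1.
Proof.
by rewrite /hnorm L2_dot_delta L2_deltaE eqxx sqrtr1.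
Qed.

Lemma L2_coef_le xi t : `|(xi : CL2 mu) t| <= (hnorm xi)%:C%C.
Proof. by rewrite -L2_dot_delta (le_trans (cauchy_schwarz _ _)) // L2_delta_norm mulr1. Qed.

Lemma normc_ge_ReIm (z : R[i]) (e : R) : `|z| <= e%:C%C ->
  `|complex.Re z| <= e /\ `|complex.Im z| <= e.
Proof.
rewrite normc_def lecR => ze; split; apply: le_trans ze; rewrite -sqrtr_sqr ler_wsqrtr //.
  by rewrite lerDl sqr_ge0.
by rewrite lerDr sqr_ge0.
Qed.

(** [cstar_norm] ranges over complete spaces, so the regular representation counts only because of
    this. The limit is taken coordinatewise, and Fatou's lemma bounds its distance to the terms of
    the sequence. *)
Lemma L2_complete : hcomplete L.
Proof.
move=> u uC.
have uE i j t : (u i - u j : CL2 mu) t = (u i : CL2 mu) t - (u j : CL2 mu) t.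
  by rewrite L2_addE L2_oppE.
have uCt t e : 0 < e -> exists N, forall i j, (N <= i)%N -> (N <= j)%N ->
    `|complex.Re ((u i : CL2 mu) t) - complex.Re ((u j : CL2 mu) t)| < e /\
    `|complex.Im ((u i : CL2 mu) t) - complex.Im ((u j : CL2 mu) t)| < e.
  move=> /uC[N HN]; exists N => i j Ni Nj.
  have [h1 h2] := normc_ge_ReIm (L2_coef_le (u i - u j) t).
  move: h1 h2; rewrite uE.
  case: ((u i : CL2 mu) t) ((u j : CL2 mu) t) => [a b] [a' b'] /= h1 h2.
  by split; [apply: le_lt_trans h1 _|apply: le_lt_trans h2 _]; exact: HN.
have clr t : exists l : R, complex.Re ((u k : CL2 mu) t) @[k --> \oo] --> l.
  by apply: cauchy_real => e /(uCt t)[N HN]; exists N => i j Ni Nj; have [] := HN i j Ni Nj.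
have [lr lrP] := boolp.choice clr.
have cli t : exists l : R, complex.Im ((u k : CL2 mu) t) @[k --> \oo] --> l.
  by apply: cauchy_real => e /(uCt t)[N HN]; exists N => i j Ni Nj; have [] := HN i j Ni Nj.
have [li liP] := boolp.choice cli.
pose l t := Complex (lr t) (li t).
have bound N e i : (N <= i)%N -> 0 < e ->
    (forall i' j, (N <= i')%N -> (N <= j)%N -> hnorm (u i' - u j) < e) ->
    (\int[mu]_t (cnsq ((u i : CL2 mu) t - l t))%:E <= (e ^+ 2)%:E)%E.
  move=> Ni e0 HN.
  (* Starting at index [N] keeps every [u (N + j)] within [e] of [u i]. *)
  pose F (j : nat) t := (cnsq ((u i - u (N + j)%N : CL2 mu) t))%:E : \bar R.
  have F0 j t : (0 <= F j t)%E by rewrite lee_fin cnsq_ge0.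
  have -> : (\int[mu]_t (cnsq ((u i : CL2 mu) t - l t))%:E =
      \int[mu]_t limn_einf (F^~ t))%E.
    apply: eq_integral => t _; apply/esym.
    suff FE : F^~ t @ \oo --> (cnsq ((u i : CL2 mu) t - l t))%:E.
      by rewrite is_cvg_limn_einfE; [apply/cvg_lim|apply/cvg_ex; eexists; exact: FE].
    apply/fine_cvgP; split; first exact: nearW.
    have sh (v : nat -> R) (a x : R) : v @ \oo --> x ->
        (a - v (N + k)%N) * (a - v (N + k)%N) @[k --> \oo] --> (a - x) * (a - x).
      move=> vx; have vN : v (N + k)%N @[k --> \oo] --> x.
        rewrite (_ : (fun k => v (N + k)%N) = (fun k => v (k + N)%N)).
          by rewrite cvg_shiftn; exact: vx.
        by apply/funext => k; rewrite addnC.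
      have aB : a - v (N + k)%N @[k --> \oo] --> a - x.
        by apply: cvgB => //; exact: cvg_cst.
      exact: (cvgM aB aB).
    have FE := cvgD (sh _ (complex.Re ((u i : CL2 mu) t)) _ (lrP t))
                    (sh _ (complex.Im ((u i : CL2 mu) t)) _ (liP t)).
    have -> : cnsq ((u i : CL2 mu) t - l t) =
        (complex.Re ((u i : CL2 mu) t) - lr t) * (complex.Re ((u i : CL2 mu) t) - lr t) +
        (complex.Im ((u i : CL2 mu) t) - li t) * (complex.Im ((u i : CL2 mu) t) - li t).
      by rewrite /cnsq /l !expr2; case: ((u i : CL2 mu) t).
    apply: cvg_trans (FE _); apply: near_eq_cvg; apply: nearW => k; rewrite /= uE /cnsq !expr2 !fctE.
    by case: ((u i : CL2 mu) t) ((u (N + k)%N : CL2 mu) t) => [? ?] [? ?].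
  have := @fatou _ T R mu setT measurableT F (fun j => discrete_meas (F j))
    (fun j t _ => F0 j t).
  move=> /le_trans; apply; apply: einf_le => j; rewrite -(CL2_hnorm (CL2_funP (u i - u (N + j)%N : CL2 mu)) (aeW _ (fun=> erefl))).
  by rewrite lee_fin ler_pXn2r ?nnegrE ?hnorm_ge0 ?ltW // HN // leq_addr.
have [N1 HN1] := uC 1 ltr01.
have dL (m N : nat) (e : R) : (N <= m)%N -> 0 < e ->
    (forall i' j, (N <= i')%N -> (N <= j)%N -> hnorm (u i' - u j) < e) ->
    (fun t => (u m : CL2 mu) t - l t) \in CLfun2 mu.
  move=> Nm e0 HN; apply/CLfun2P; split; first exact: discrete_cmeas.
  by apply: le_lt_trans (bound N e m Nm e0 HN) _; rewrite ltry.
(* The limit is square integrable as the difference of [u N1] and [u N1 - l]. *)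
have lL : l \in CLfun2 mu.
  pose v : T -> R[i] := (u N1 : CL2 mu).
  rewrite (_ : l = v - (fun t => v t - l t)); last first.
    by apply/funext => t; rewrite !fctE /= opprB addrC subrK.
  by apply: rpredB; [exact: CL2_funP|exact: dL HN1].
exists (CL2_of mu l); apply/cvgrPdist_le => e e0.
have [N HN] := uC e e0; exists N => // i /= Ni.
rewrite sub0r normrN ger0_norm ?hnorm_ge0 //.
rewrite -(ler_pXn2r (ltn0Sn 1)) ?nnegrE ?hnorm_ge0 ?(ltW e0) // -lee_fin.
rewrite (CL2_hnorm (dL i N e Ni e0 HN)); first exact: bound HN.
by apply: aeW => t; rewrite L2_addE L2_oppE L2_ofE.
Qed.

(** By completeness the sequence has a limit, all of whose coordinates are zero. *)
Lemma L2_coef_cvg0 (u : nat -> L) :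
  (forall e : R, 0 < e -> exists N, forall i j, (N <= i)%N -> (N <= j)%N ->
    hnorm (u i - u j) < e) ->
  (forall t (e : R), 0 < e -> exists N, forall i, (N <= i)%N ->
    `|hform L (u i) (L2_delta t)| <= e%:C%C) ->
  forall e : R, 0 < e -> exists N, forall i, (N <= i)%N -> hnorm (u i) <= e.
Proof.
move=> uC u0; have [l /cvgrPdist_le ul] := L2_complete uC.
have l0 : l = 0.
  apply: L2_ext => t; have -> : (0 : CL2 mu) t = 0.
    by have := L2_scaleE 0 l t; rewrite scale0r mul0r.
  rewrite -L2_dot_delta; apply/eqP; rewrite -normr_le0.
  have [//|] := boolP (`|hform L l (L2_delta t)| <= 0).
  rewrite normc_def -[0]/(0%:C%C) lecR -ltNge => p0; exfalso.
  set p := Num.sqrt _ in p0; have p3 : 0 < p / 3 by rewrite divr_gt0.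
  have [N HN] := u0 t _ p3; have [M _ HM] := ul _ p3.
  have := HM (maxn M N) (leq_maxl _ _) => /=.
  rewrite sub0r normrN ger0_norm ?hnorm_ge0 // => h1.
  have h2 := HN (maxn M N) (leq_maxr _ _).
  have h3 : `|hform L (u (maxn M N) - l) (L2_delta t)| <= (p / 3)%:C%C.
    by rewrite (le_trans (cauchy_schwarz _ _)) // L2_delta_norm mulr1 lecR.
  have : p%:C%C <= (p / 3)%:C%C + (p / 3)%:C%C :> R[i].
    have -> : p%:C%C = `|hform L l (L2_delta t)| by rewrite normc_def.
    apply: le_trans (lerD h2 h3); rewrite hformBl.
    by rewrite -[X in `|X| <= _](subKr (hform L (u (maxn M N)) (L2_delta t))) ler_normB.
  by rewrite -rmorphD lecR; lra.
move=> e e0; have [N _ HN] := ul e e0; exists N => i /HN /=.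
by rewrite l0 subr0 sub0r normrN ger0_norm ?hnorm_ge0.
Qed.

End LittleL2.

Definition tail_point (m : nat) := (path_space m.+1 * int)%type.
HB.instance Definition _ m := Choice.on (tail_point m).
HB.instance Definition _ m := isPointed.Build (tail_point m) ((fun=> ord0), 0).
HB.instance Definition _ m := @isMeasurable.Build default_measure_display
  (tail_point m) discrete_measurable discrete_measurable0
  discrete_measurableC discrete_measurableU.

HB.instance Definition _ m := isPointed.Build (cuntz_groupoid m.+1)
  (gelt [::] [::] (fun=> ord0)).

Lemma mem_asbool (U : Type) (A : set U) (x : U) : (x \in A) = `[< A x >].
Proof. by apply/idP/asboolP; rewrite in_setE. Qed.

(** * The representation on square-summable functions of a path and an integer *)

Section RegularRepresentation.
Context (R : realType) (m : nat).
Local Notation n := m.+1.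
Local Notation word := (seq 'I_n).
Local Notation X := (path_space n).
Local Notation G := (cuntz_groupoid n).
Local Notation T := (tail_point m).
Local Notation mu := (@counting T R : {measure set T -> \bar R}).
Local Notation L := (@CL2_space _ T R mu).
Implicit Types (f : G -> R[i]) (p : T).

Lemma tail_discrete (A : set T) : measurable A.
Proof. by []. Qed.

Local Notation ofE := (L2_ofE tail_discrete).

(* The groupoid acts on the left of its range fibres; the integer records the
   degree, which keeps distinct elements with the same range and source apart. *)
Definition reg_fun f (xi : T -> R[i]) : T -> R[i] := fun p =>
  \sum_(g \in [set g : G | grng g = p.1]) f g * xi (gsrc g, p.2 - gdeg g).

Definition reg_rep f (xi : L) : L := CL2_of mu (reg_fun f (xi : CL2 mu)).

Definition supported (cs : seq (word * word)) f :=
  forall g, f g != 0 -> exists2 c, c \in cs & gcylinder c.1 c.2 g.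

(** All that boundedness of the regular representation requires of a function of [Cc]: finitely many
    cylinders cover the support, and the values are bounded. *)
Definition tame f := exists cs (M : R), supported cs f /\ forall g, cnsq (f g) <= M.

Lemma Cc_tame f : Cc f -> tame f.
Proof.
move=> [fr fi fc]; have cK : cover_compact (closure [set x | f x != 0]).
  by rewrite -compact_cover.
pose loc g (c : word * word) := gcylinder c.1 c.2 g /\
  exists M : R, forall h, gcylinder c.1 c.2 h -> cnsq (f h) <= M.
have locP g : exists c, loc g c.
  have cn : cnsq (f h) @[h --> g] --> cnsq (f g).
    have H := cvgD (cvgM (fr g) (fr g)) (cvgM (fi g) (fi g)).
    have -> : cnsq (f g) = complex.Re (f g) * complex.Re (f g) +
      complex.Im (f g) * complex.Im (f g) by rewrite /cnsq !expr2.
    have -> : (fun h => cnsq (f h)) = ((fun x => complex.Re (f x)) \*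
        (fun x => complex.Re (f x)) + (fun x => complex.Im (f x)) \*
        (fun x => complex.Im (f x))).
      by apply/funext => h; rewrite !fctE /cnsq !expr2.
    exact: (H _ _ _).
  have : nbhs g [set h | cnsq (f h) <= cnsq (f g) + 1].
    apply: (cn [set y : R | y <= cnsq (f g) + 1]); apply/nbhs_ballP; exists 1 => //= y.
    by rewrite /ball /= ltr_distlC => /andP[_ /ltW].
  rewrite nbhsE => -[B [oB Bg] sB]; rewrite gopenE in oB.
  have [w [v [wvg wvB]]] := oB _ Bg.
  exists (w, v); split => //; exists (cnsq (f g) + 1) => h /wvB /sB.
  exact.
have [c cP] := boolp.choice locP.
have [||D _ KD] := cK G setT (fun g => gcylinder (c g).1 (c g).2).
- by move=> g _; exact: open_gcylinder.
- by move=> g _; exists g => //; have [] := cP g.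
have bnd : exists M : R, forall g, g \in finmap.enum_fset D ->
    forall h, gcylinder (c g).1 (c g).2 h -> cnsq (f h) <= M.
  elim: (finmap.enum_fset D) => [|g s [M HM]]; first by exists 0.
  have [_ [M' HM']] := cP g; exists (Num.max M M') => g'.
  rewrite inE => /orP[/eqP -> h /HM' H|/HM HM2 h /HM2 H].
    by rewrite le_max H orbT.
  by rewrite le_max H.
have [M HM] := bnd.
(* The maximum with 0 keeps the bound valid where [f] vanishes. *)
exists [seq c g | g <- finmap.enum_fset D], (Num.max M 0).
have sup g : f g != 0 -> exists2 h, h \in finmap.enum_fset D & gcylinder (c h).1 (c h).2 g.
  by move=> f0; have [h Dh hg] := KD g (@subset_closure _ [set x | f x != 0] g f0); exists h.
split=> g.
  by move=> /sup[h Dh hg]; exists (c h) => //; exact: map_f.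
have [->|/sup[h Dh /(HM _ Dh) H]] := eqVneq (f g) 0.
  by rewrite /cnsq /= expr0n addr0 le_max lexx orbT.
by rewrite le_max H.
Qed.

(** The only element of the cylinder of [c] that can have range [x]; its range is [x] only if [x]
    begins with [c.1]. *)
Definition row_elt (x : X) (c : word * word) : G := gelt c.1 c.2 (pdrop (size c.1) x).

Lemma row_eltP (x : X) c g : gcylinder c.1 c.2 g -> grng g = x -> g = row_elt x c.
Proof.
move=> /gcylinderP[y ->] <-; rewrite /row_elt; congr gelt.
by rewrite /grng /= pdrop_wcat.
Qed.

(** A cylinder contains at most one element of a given range, so the sum in [reg_fun] is finite. *)
Lemma row_finite cs f (x : X) : supported cs f ->
  finite_set [set g : G | grng g = x /\ f g != 0].
Proof.
move=> fs; apply: (@sub_finite_set _ _ [set` [seq row_elt x c | c <- cs]]).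
  by move=> g [gx /fs[c ccs cg]]; rewrite /= (row_eltP cg gx); exact: map_f.
exact: finite_seq.
Qed.

Lemma reg_fun_support f xi p (D : set G) :
  [set g : G | grng g = p.1 /\ f g != 0] `<=` D -> D `<=` [set g : G | grng g = p.1] ->
  reg_fun f xi p = \sum_(g \in D) f g * xi (gsrc g, p.2 - gdeg g).
Proof.
move=> sD Ds; rewrite /reg_fun; apply/esym/fsbig_widen => // g [gp Dg] /=.
have [->|f0] := eqVneq (f g) 0; first by rewrite mul0r.
by case: Dg; apply: sD.
Qed.

Lemma reg_funDl f f' xi p : tame f -> tame f' ->
  reg_fun (f + f') xi p = reg_fun f xi p + reg_fun f' xi p.
Proof.
move=> [cs [_ [fs _]]] [cs' [_ [fs' _]]].
pose D := [set g : G | grng g = p.1 /\ f g != 0] `|` [set g : G | grng g = p.1 /\ f' g != 0].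
have finD : finite_set D by rewrite finite_setU; split; apply: row_finite; eassumption.
have Ds : D `<=` [set g : G | grng g = p.1] by move=> g [[]|[]].
rewrite !(@reg_fun_support _ _ _ D) //.
- rewrite -fsbig_split //; apply: eq_fsbigr => g _.
  by rewrite fctE mulrDl.
- by move=> g ?; right.
- by move=> g ?; left.
- move=> g [gp]; rewrite fctE => fg.
  have [f0|f0] := eqVneq (f g) 0; last by left.
  by right; split => //; rewrite f0 add0r in fg.
Qed.

Lemma reg_funZl (a : R[i]) f xi p : tame f ->
  reg_fun (a *: f) xi p = a * reg_fun f xi p.
Proof.
move=> [cs [_ [fs _]]]; pose D := [set g : G | grng g = p.1 /\ f g != 0].
have finD : finite_set D by exact: row_finite fs.
have Ds : D `<=` [set g : G | grng g = p.1] by move=> g [].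
rewrite !(@reg_fun_support _ _ _ D) //.
  rewrite !fsbig_finite // mulr_sumr; apply: eq_bigr => g _.
  by rewrite fctE mulrA.
move=> g [gp]; rewrite fctE => fg; split => //.
by apply: contra_neq fg => ->; rewrite scaler0.
Qed.

Lemma tameD f f' : tame f -> tame f' -> tame (f + f').
Proof.
move=> [cs [M [fs fM]]] [cs' [M' [fs' fM']]].
exists (cs ++ cs'), (2 * M + 2 * M'); split => g; rewrite fctE.
  have [f0|/fs[c ccs cg] _] := eqVneq (f g) 0.
    by rewrite f0 add0r => /fs'[c ccs cg]; exists c; rewrite // mem_cat ccs orbT.
  by exists c; rewrite // mem_cat ccs.
have := fM g; have := fM' g; rewrite /cnsq.
case: (f g) (f' g) => [a b] [a' b'] /=.
by have := sqr_ge0 (a - a'); have := sqr_ge0 (b - b'); rewrite !expr2; nra.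
Qed.

Lemma tameZ (a : R[i]) f : tame f -> tame (a *: f).
Proof.
move=> [cs [M [fs fM]]]; exists cs, (cnsq a * M); split => g; rewrite fctE.
  by move=> af; apply: fs; apply: contra_neq af => ->; rewrite scaler0.
by rewrite cnsqM ler_wpM2l ?cnsq_ge0.
Qed.

Lemma tame_star f : tame f -> tame (gstar f).
Proof.
move=> [cs [M [fs fM]]]; exists [seq (c.2, c.1) | c <- cs], M; split => g.
  rewrite /gstar conjC_eq0 => /fs[c ccs cg]; exists (c.2, c.1).
    by apply/mapP; exists c.
  by apply/gcylinder_inv.
by rewrite /gstar (le_trans _ (fM (ginv g))) //; case: (f _) => a b; rewrite /cnsq /= sqrrN.
Qed.

(** Stated through some operators with prescribed values, since [reg_rep f] has the intended values
    only once [reg_fun f xi] is known to be square integrable, which is one of the consequences. *)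
Definition reg_good f := exists A B : L -> L,
  [/\ forall xi p, (A xi : CL2 mu) p = reg_fun f (xi : CL2 mu) p,
      forall xi p, (B xi : CL2 mu) p = reg_fun (gstar f) (xi : CL2 mu) p,
      forall xi eta, hform L (A xi) eta = hform L xi (B eta) &
      exists M : R, forall xi, hnorm (A xi) <= M * hnorm xi].

Section Piece.
Context (w v : word) (f : G -> R[i]) (M : R).
Hypotheses (fs : supported [:: (w, v)] f) (fM : forall g, cnsq (f g) <= M).

(** The prefix [a] of the path is replaced by [b], and the integer is lowered by the degree of
    [(a, b)]: for a function supported in that cylinder, this is the one point at which [reg_fun]
    evaluates. *)
Definition piece_th (a b : word) (p : T) : T :=
  (wcat b (pdrop (size a) p.1), p.2 - ((size a)%:Z - (size b)%:Z)).

Definition piece_weight (a b : word) (h : G -> R[i]) (p : T) : R[i] :=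
  if `[< ptake (size a) p.1 = a >] then h (row_elt p.1 (a, b)) else 0.

Lemma reg_fun_piece (a b : word) (h : G -> R[i]) xi p : supported [:: (a, b)] h ->
  reg_fun h xi p = piece_weight a b h p * xi (piece_th a b p).
Proof.
move=> hs; rewrite /piece_weight; case: asboolP => [ap|Nap].
  have pa : grng (row_elt p.1 (a, b)) = p.1.
    by rewrite /grng /row_elt /= -{1}ap ptakeK.
  rewrite (@reg_fun_support _ _ _ [set row_elt p.1 (a, b)]) ?fsbig_set1 //.
    by move=> g [gp /hs[c]]; rewrite inE => /eqP -> cg; exact: row_eltP cg gp.
  by move=> _ ->.
rewrite mul0r /reg_fun fsbig1 // => g gp.
have [->|/hs[c]] := eqVneq (h g) 0; first by rewrite mul0r.
rewrite inE => /eqP -> /gcylinderP[y gE]; case: Nap.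
by rewrite -gp gE /grng /= ptake_wcat.
Qed.

Lemma piece_thK (a b : word) p : ptake (size a) p.1 = a ->
  piece_th b a (piece_th a b p) = p.
Proof.
case: p => x k /= ax; rewrite /piece_th /= pdrop_wcat -{1}ax ptakeK.
by congr pair; lia.
Qed.

Lemma piece_cv (a b : word) : change_of_variable mu
  [set p : T | ptake (size a) p.1 = a] [set p : T | ptake (size b) p.1 = b]
  (piece_th a b) (piece_th b a) 1.
Proof.
split => //; first by move=> p /piece_thK.
move=> A _; rewrite mul1e.
rewrite -(counting_image R (A := _ `&` _) (f := piece_th a b)).
  congr counting; apply/seteqP; split=> [_ [p [ap Ap] <-]|q [bq Aq]] /=.
    by split => //; rewrite /piece_th /= ptake_wcat.
  exists (piece_th b a q); last exact: piece_thK.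
  by split; [rewrite /piece_th /= ptake_wcat|rewrite /= piece_thK].
move=> p q; rewrite !inE => -[ap _] [aq _] E.
by rewrite -(piece_thK b ap) E piece_thK.
Qed.

Lemma supported_star (a b : word) (h : G -> R[i]) :
  supported [:: (a, b)] h -> supported [:: (b, a)] (gstar h).
Proof.
move=> hs g; rewrite /gstar conjC_eq0 => /hs[c]; rewrite inE => /eqP -> /= cg.
by exists (b, a); [rewrite inE|apply/gcylinder_inv].
Qed.

Lemma reg_good_piece : reg_good f.
Proof.
have cv := piece_cv w v; have M0 : 0 <= M.
  by apply: le_trans (fM (gelt [::] [::] (fun=> ord0))); exact: cnsq_ge0.
pose a := piece_weight w v f.
have ma : cmeasurable a by exact: discrete_cmeas.
have aM p : cnsq (a p) <= M.
  rewrite /a /piece_weight; case: asboolP => // _.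
  by rewrite /cnsq /= expr0n addr0.
have aS p : ~ [set p : T | ptake (size w) p.1 = w] p -> a p = 0.
  by move=> Np; rewrite /a /piece_weight asboolF.
exists (wcomp (piece_th w v) a),
  (wadj [set p : T | ptake (size v) p.1 = v] (piece_th v w) 1 a); split.
- move=> xi p; rewrite (reg_fun_piece _ _ fs).
  by rewrite ofE //; apply: (wcomp_CLfun2 cv ma M0 aM aS); exact: CL2_funP.
- move=> xi p; rewrite (reg_fun_piece _ _ (supported_star fs)).
  rewrite ofE //; last by apply: (wadj_CLfun2 cv ma M0 aM); exact: CL2_funP.
  congr (_ * _); rewrite /wadj_weight /piece_weight; case: asboolP => // vp.
  rewrite mul1r /a /piece_weight /= ptake_wcat asboolT // /gstar; congr (_^*); congr f.
  by rewrite /row_elt /= pdrop_wcat ginv_gelt.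
- by move=> xi eta; exact: (wcomp_adj cv ma M0 aM aS).
- exists (Num.sqrt (1 * M)) => xi.
  rewrite -(ler_pXn2r (ltn0Sn 1)) ?nnegrE ?mulr_ge0 ?hnorm_ge0 ?sqrtr_ge0 //.
  rewrite exprMn [X in _ <= X * _]sqr_sqrtr ?mulr_ge0 //; exact: (wcomp_norm cv ma M0 aM aS).
Qed.

End Piece.

Lemma reg_goodD f f' : tame f -> tame f' -> reg_good f -> reg_good f' ->
  reg_good (f + f').
Proof.
move=> tf tf' [A [B [AE BE AB [M AM]]]] [A' [B' [AE' BE' AB' [M' AM']]]].
exists (fun xi => A xi + A' xi), (fun xi => B xi + B' xi); split.
- by move=> xi p; rewrite L2_addE // AE AE' reg_funDl.
- move=> xi p; rewrite L2_addE // BE BE'.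
  rewrite (_ : gstar (f + f') = gstar f + gstar f').
    by rewrite reg_funDl //; exact: tame_star.
  by apply/funext => g; rewrite /gstar !fctE rmorphD.
- by move=> xi eta; rewrite hformDl hformDr AB AB'.
- exists (M + M') => xi; rewrite mulrDl.
  by apply: le_trans (ler_hnormD _ _) _; apply: lerD.
Qed.

(** By induction on the cylinders covering the support, splitting off the part of [f] in the first
    one, which acts by a weighted composition. *)
Lemma tame_good f : tame f -> reg_good f.
Proof.
move=> [cs [M [fs fM]]]; elim: cs f fs fM => [|[w v] cs IH] f fs fM.
  (* With no cylinder left [f] is zero, and any pair of words will do. *)
  by apply: (@reg_good_piece [::] [::] f M) => // g /fs[].
have M0 : 0 <= M.
  by apply: le_trans (fM (gelt [::] [::] (fun=> ord0))); exact: cnsq_ge0.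
have z0 : cnsq (0 : R[i]) = 0 by rewrite /cnsq /= expr0n addr0.
pose f1 g := if `[< gcylinder w v g >] then f g else 0.
pose f2 g := if `[< gcylinder w v g >] then 0 else f g.
have f1s : supported [:: (w, v)] f1.
  move=> g; rewrite /f1; case: asboolP => [wg _|_ /eqP//].
  by exists (w, v) => //; rewrite inE.
have f1M g : cnsq (f1 g) <= M by rewrite /f1; case: asboolP => //; rewrite z0.
have f2s : supported cs f2.
  move=> g; rewrite /f2; case: asboolP => [_ /eqP//|Ng /fs[c]].
  by rewrite inE => /orP[/eqP -> //|ccs cg]; exists c.
have f2M g : cnsq (f2 g) <= M by rewrite /f2; case: asboolP => //; rewrite z0.
rewrite (_ : f = f1 + f2); last first.
  by apply/funext => g; rewrite fctE /f1 /f2; case: asboolP => _; rewrite ?addr0 ?add0r.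
apply: reg_goodD.
- by exists [:: (w, v)], M.
- by exists cs, M.
- exact: reg_good_piece f1s f1M.
- exact: IH.
Qed.

Lemma tame_reg_CLfun2 f (xi : CL2 mu) : tame f -> reg_fun f xi \in CLfun2 mu.
Proof.
move=> /tame_good[A [_ [AE _ _ _]]].
by rewrite (_ : reg_fun f xi = (A xi : CL2 mu)) ?CL2_funP //; apply/funext => p; rewrite AE.
Qed.

Lemma reg_repE f (xi : L) p : tame f -> (reg_rep f xi : CL2 mu) p = reg_fun f (xi : CL2 mu) p.
Proof. by move=> tf; rewrite ofE // tame_reg_CLfun2. Qed.

Lemma reg_rep_bounded f : tame f -> bounded_op (reg_rep f).
Proof.
move=> tf; have [A [B [AE BE AB [M AM]]]] := tame_good tf.
have -> : reg_rep f = A.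
  by apply/funext => xi; apply: L2_ext => p; rewrite reg_repE // AE.
by split; [exact: adj_linear AB|exists M].
Qed.

Lemma reg_rep_adj f xi eta : tame f ->
  hform L (reg_rep f xi) eta = hform L xi (reg_rep (gstar f) eta).
Proof.
move=> tf; have [A [B [AE BE AB _]]] := tame_good tf.
have -> : reg_rep f xi = A xi by apply: L2_ext => p; rewrite reg_repE // AE.
have -> : reg_rep (gstar f) eta = B eta.
  by apply: L2_ext => p; rewrite reg_repE ?BE //; exact: tame_star.
exact: AB.
Qed.

(** Both sides are the sum of f(g) f'(h) xi(...) over the finite set [Q] of composable pairs of
    possibly nonzero weight with g of range [p.1], grouped on the left by the product and on the
    right by the first factor. *)
Lemma reg_fun_conv f f' xi p : tame f -> tame f' ->
  reg_fun (Defs.conv f f') xi p = reg_fun f (reg_fun f' xi) p.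
Proof.
move=> [cs [_ [fs _]]] [cs' [_ [fs' _]]].
pose P := [set g : G | grng g = p.1 /\ f g != 0].
have finP : finite_set P by exact: row_finite fs.
pose W := \bigcup_(g in P) [set h : G | grng h = gsrc g /\ f' h != 0].
have finW : finite_set W by apply: bigcup_finite => // g _; exact: row_finite fs'.
pose F (q : G * G) := f q.1 * f' q.2 * xi (gsrc q.2, p.2 - gdeg q.1 - gdeg q.2).
pose Q := (P `*` W) `&` [set q : G * G | gsrc q.1 = grng q.2].
have finQ : finite_set Q by apply: finite_setIl; exact: finite_setX.
(* A total choice of products, arbitrary on pairs that are not composable. *)
have mulP (q : G * G) : exists k : G, gsrc q.1 = grng q.2 ->
    [/\ grng k = grng q.1, gsrc k = gsrc q.2 & gdeg k = gdeg q.1 + gdeg q.2].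
  have [/gmul_exists[k kq]|N] := pselect (gsrc q.1 = grng q.2); first by exists k.
  by exists q.1 => /N.
have [mulg mulgP] := boolp.choice mulP.
transitivity (\sum_(q \in Q) F q).
  pose D := mulg @` Q.
  have finD : finite_set D by exact: finite_image.
  have inQ (g : G) (q : G * G) : grng g = p.1 -> gfactor g q -> f q.1 * f' q.2 != 0 -> Q q.
    move=> gp [q1 q12 q2 qd]; rewrite mulf_eq0 negb_or => /andP[f1 f2].
    have Pq : P q.1 by split => //; rewrite q1.
    by split => //; split => //; exists q.1 => //; split.
  have fac (q : G * G) : Q q -> gfactor (mulg q) q /\ grng (mulg q) = p.1.
    move=> [[[qp _] _] /= q12]; have [k1 k2 k3] := mulgP q q12.
    by rewrite k1; split => //; split; rewrite ?k1 ?k2 ?k3.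
  have facU (g : G) (q : G * G) : Q q -> gfactor g q -> g = mulg q.
    move=> Qq [q1 q12 q2 qd]; have [[q1' _ q2' qd'] _] := fac q Qq.
    by apply: gext; rewrite -?q1 -?q2 -?qd.
  rewrite (@reg_fun_support _ _ _ D); last 2 first.
  - move=> g [gp]; rewrite /Defs.conv => c0.
    have [q gq fq0] : exists2 q, gfactor g q & f q.1 * f' q.2 != 0.
      apply: contrapT => N; case/eqP: c0; apply: fsbig1 => q gq.
      by apply: contrapT => /eqP fq0; apply: N; exists q.
    have Qq := inQ _ _ gp gq fq0; exists q => //.
    by rewrite -(facU _ _ Qq gq).
  - by move=> _ [q Qq <-]; have [] := fac q Qq.
  transitivity (\sum_(g \in D) \sum_(q \in Q) (if `[< gfactor g q >] then F q else 0)).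
    apply: eq_fsbigr => g; rewrite inE => -[q0 Qq0 gE].
    have gp : grng g = p.1 by rewrite -gE; have [] := fac q0 Qq0.
    have -> : Defs.conv f f' g = \sum_(q \in Q) (if `[< gfactor g q >] then f q.1 * f' q.2 else 0).
      transitivity (\sum_(q \in Q `&` gfactor g) (f q.1 * f' q.2)).
        apply/esym/fsbig_widen => [q []//|q [gq Nq] /=].
        apply: contrapT => /eqP fq0; apply: Nq; split => //; exact: (inQ g).
      rewrite fsbig_mkcondr; apply: eq_fsbigr => q _.
      by rewrite mem_asbool.
    rewrite !fsbig_finite // mulr_suml; apply: eq_bigr => q _.
    case: asboolP => [[q1 q12 q2 qd]|]; last by rewrite mul0r.
    by rewrite /F -q2 -qd opprD addrA.
  (* Each pair of [Q] is a factorization of its own product only. *)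
  rewrite exchange_fsbig //; apply: eq_fsbigr => q; rewrite inE => Qq.
  rewrite -(@fsbig_widen _ _ _ _ [set mulg q]).
  - by rewrite fsbig_set1 asboolT //; have [] := fac q Qq.
  - by move=> _ ->; exists q.
  - by move=> g [Dg Ng] /=; case: asboolP => // /(facU g q Qq).
rewrite (@reg_fun_support f _ p P) //; last by move=> g [].
have -> : \sum_(g \in P) f g * reg_fun f' xi (gsrc g, p.2 - gdeg g) =
    \sum_(g \in P) \sum_(h \in W) (if `[< gsrc g = grng h >] then F (g, h) else 0).
  apply: eq_fsbigr => g; rewrite inE => Pg.
  rewrite (@reg_fun_support f' _ _ (W `&` [set h | gsrc g = grng h])); last 2 first.
  - by move=> h [/= hg f0]; split => //; exists g.
  - by move=> h [_ /= ->].
  rewrite fsbig_mkcondr !fsbig_finite // mulr_sumr; apply: eq_bigr => h _.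
  rewrite mem_asbool; case: asboolP => _; last by rewrite mulr0.
  by rewrite /F /= mulrA.
rewrite pair_fsbig // /Q fsbig_mkcondr; apply: eq_fsbigr => -[g h] _ /=.
by rewrite mem_asbool.
Qed.

Lemma reg_star_rep : star_rep reg_rep.
Proof.
split.
- by move=> f /Cc_tame; exact: reg_rep_bounded.
- move=> a f f' /Cc_tame tf /Cc_tame tf'; apply/funext => xi; apply: L2_ext => p.
  rewrite L2_addE // L2_scaleE // !reg_repE //; last first.
    by apply: tameD => //; exact: tameZ.
  by rewrite reg_funDl ?reg_funZl //; exact: tameZ.
- move=> f f' /Cc_tame tf /Cc_tame tf'; apply/funext => xi; rewrite /= /reg_rep.
  have E : reg_fun (Defs.conv f f') (xi : CL2 mu) =
      reg_fun f (CL2_of mu (reg_fun f' (xi : CL2 mu))).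
    apply/funext => q; rewrite reg_fun_conv //; congr (reg_fun f _ q).
    by apply/funext => r; rewrite ofE // tame_reg_CLfun2.
  by rewrite E.
- by move=> f /Cc_tame tf xi eta; exact: reg_rep_adj.
Qed.

Lemma reg_fun_delta f (y : X) (i : int) (x : X) (k : int) :
  reg_fun f (fun s => (s == (y, i) :> T)%:R) (x, k) =
  \sum_(g \in [set g : G | [/\ grng g = x, gsrc g = y & gdeg g = k - i]]) f g.
Proof.
rewrite /reg_fun; set D := [set g : G | [/\ _, _ & _]].
rewrite -(@fsbig_widen _ _ _ _ D); last 2 first.
- by move=> g [].
- move=> g [/= gx Dg]; case: eqP => [[gy gi]|]; last by rewrite mulr0.
  by case: Dg; split => //; rewrite -gi; lia.
apply: eq_fsbigr => g; rewrite inE => -[_ <- ->].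
by rewrite (_ : k - (k - i) = i) ?eqxx ?mulr1 //; lia.
Qed.

Lemma reg_rep_dot_delta f (y : X) (i : int) (x : X) (k : int) : tame f ->
  hform L (reg_rep f (L2_delta R ((y, i) : T))) (L2_delta R ((x, k) : T)) =
  \sum_(g \in [set g : G | [/\ grng g = x, gsrc g = y & gdeg g = k - i]]) f g.
Proof.
move=> tf; rewrite L2_dot_delta // reg_repE // -reg_fun_delta; congr (reg_fun f _ _).
by apply/funext => s; rewrite L2_deltaE.
Qed.

Lemma reg_rep_coef f (g : G) : tame f ->
  hform L (reg_rep f (L2_delta R ((gsrc g, 0) : T))) (L2_delta R ((grng g, gdeg g) : T)) = f g.
Proof.
move=> tf; rewrite reg_rep_dot_delta // (_ : [set h : G | _] = [set g]) ?fsbig_set1 //.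
apply/seteqP; split=> [h [h1 h2]|_ ->]; rewrite subr0 // => h3.
exact: gext.
Qed.

Lemma reg_rep_proj_delta (v : word) (y : X) (i : int) :
  reg_rep (chi R v v) (L2_delta R ((y, i) : T)) =
  if ptake (size v) y == v then L2_delta R ((y, i) : T) else 0.
Proof.
apply: L2_ext => -[x k]; rewrite -!L2_dot_delta //.
rewrite reg_rep_dot_delta; last exact/Cc_tame/Cc_chi.
set D := [set g : G | _].
have chiE g : gcylinder v v g -> [/\ ptake (size v) (gsrc g) = v, grng g = gsrc g & gdeg g = 0].
  by move=> /gcylinderP[z ->]; rewrite /gsrc /grng /gdeg /= ptake_wcat subrr.
have z0 : ~ (ptake (size v) y = v /\ (x, k) = (y, i)) -> \sum_(g \in D) chi R v v g = 0.
  move=> N; apply: fsbig1 => g [gx gy gk]; apply: chiF => /chiE[gv gg g0]; apply: N.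
  by rewrite -gx gg gy -gy; split => //; congr pair; lia.
case: eqP => [yv|Nv]; last by rewrite z0 ?hform0l // => -[].
rewrite L2_dot_delta // L2_deltaE //; case: eqP => [E|N]; last by rewrite z0 // => -[].
have yE : y = wcat v (pdrop (size v) y) by rewrite -{1}yv ptakeK.
rewrite (_ : D = [set gelt v v (pdrop (size v) y)]) ?fsbig_set1 ?chiT //; first exact: gelt_cylinder.
case: E => xy ki; rewrite /D xy ki; apply/seteqP; split=> [g [g1 g2 g3]|_ ->].
  by apply: gext; rewrite ?g1 ?g2 ?g3 /grng /gsrc /gdeg /= -?yE // !subrr.
by rewrite /grng /gsrc /gdeg /= -yE !subrr.
Qed.

(** The values of [f] are matrix entries in one of the representations over which the supremum is
    taken. *)
Lemma coef_le_cstar_norm f (g : G) (e : R) : Cc f -> (cstar_norm f <= e%:E)%E ->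
  `|f g| <= e%:C%C.
Proof.
move=> fc fe; rewrite -(reg_rep_coef g (Cc_tame fc)).
apply: le_trans (cauchy_schwarz _ _) _; rewrite L2_delta_norm // mulr1 lecR -lee_fin.
apply: le_trans fe; apply: ereal_sup_ubound.
exists L, reg_rep, (L2_delta R ((gsrc g, 0) : T)); split => //.
- exact: L2_complete.
- exact: reg_star_rep.
- by rewrite L2_delta_norm.
Qed.

Lemma reg_family : cuntz_family (fun w v => reg_rep (chi R w v)).
Proof. exact: star_rep_family reg_star_rep. Qed.

(** S_a sends the basis vector at (y, 0) to the one at (a y, |a|). The integer separates lengths,
    which the path could not do for the constant path y, and the path separates words of equal
    length. *)
Lemma reg_vacuum l : exists u : L, cuntz_vacuum (fun w v => reg_rep (chi R w v)) l u.
Proof.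
pose y : X := fun=> ord0; exists (L2_delta R ((y, 0) : T)) => w v _ _.
have E a : reg_rep (chi R a [::]) (L2_delta R ((y, 0) : T)) = L2_delta R ((wcat a y, (size a)%:Z) : T).
  apply: L2_ext => -[x k]; rewrite reg_repE; last exact/Cc_tame/Cc_chi.
  have -> : (L2_delta R ((y, 0) : T) : CL2 mu) = (fun s => (s == (y, 0) :> T)%:R) :> (T -> R[i]).
    by apply/funext => s; rewrite L2_deltaE.
  rewrite reg_fun_delta L2_deltaE //; case: eqP => [[-> ->]|N].
    rewrite (_ : [set h : G | _] = [set gelt a [::] y]) ?fsbig_set1 ?chiT //.
      exact: gelt_cylinder.
    apply/seteqP; split=> [h [h1 h2]|_ ->]; rewrite /= subr0 => //.
      by move=> h3; apply: gext => //; rewrite ?h2 ?h3 /gsrc /gdeg /= ?wcat0 ?subr0.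
    by rewrite /grng /gsrc /gdeg /= wcat0 subr0.
  rewrite fsbig1 // => h [h1 h2]; rewrite subr0 => h3; apply/chiF => /gcylinderP[z hE].
  case: N; move: h1 h2 h3; rewrite hE /grng /gsrc /gdeg /= wcat0 subr0 => <- <- <-.
  by [].
rewrite !E L2_dot_delta // L2_deltaE //; congr (_%:R); congr nat_of_bool.
apply/eqP/eqP => [[wv [sz]]|-> //].
by have [] := wcat_eq sz wv.
Qed.

End RegularRepresentation.

(** * The Volterra representation *)

Section ChangeOfVariableAE.
Context d (T : measurableType d) (R : realType) (mu : {measure set T -> \bar R}).
Context (S S' : set T) (th th' : T -> T) (c : R).
Hypothesis cv : change_of_variable mu S S' th th' c.

Lemma cv_ae (P : T -> Prop) : {ae mu, forall t, P t} ->
  {ae mu, forall t, S t -> P (th t)}.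
Proof.
move=> [N [mN N0 PN]]; have [mS mS' mth _ _ _ Hmu] := cv.
exists (S `&` th @^-1` N); split.
- by apply: measurableI => //; rewrite -[X in measurable X]setTI; exact: mth.
- rewrite Hmu // (_ : mu _ = 0%E) ?mule0 //; apply/eqP.
  rewrite eq_le measure_ge0 andbT -N0; apply: le_measure; rewrite ?inE //.
  exact: measurableI.
- by move=> t /= /not_implyP[St Pt]; split => //; exact: PN.
Qed.

Lemma cv_ae' (P : T -> Prop) : 0 < c -> {ae mu, forall t, P t} ->
  {ae mu, forall s, S' s -> P (th' s)}.
Proof.
move=> c0 [N [mN N0 PN]]; have [mS mS' mth mth' _ thK Hmu] := cv.
have mN' : measurable (th' @^-1` N).
  by rewrite -[X in measurable X]setTI; exact: mth'.
exists (S' `&` th' @^-1` N); split; first exact: measurableI.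
- have := Hmu _ mN'; rewrite (_ : mu _ = 0%E) => [|].
    by move/esym/eqP; rewrite mule_eq0 eqe gt_eqF //= => /eqP.
  apply/eqP; rewrite eq_le measure_ge0 andbT -N0; apply: le_measure; rewrite ?inE //.
    by apply: measurableI => //; rewrite -[X in measurable X]setTI; exact: mth.
  by move=> t [St]; rewrite /= thK.
- by move=> t /= /not_implyP[St Pt]; split => //; exact: PN.
Qed.

End ChangeOfVariableAE.

(** * Dilations onto the intervals [j / N, (j + 1) / N] *)

Section Dilations.
Context (R : realType).
Local Notation T := (measurableTypeR R).
Local Notation mu := (I01 R).
Local Notation H := (L2I R).
Implicit Types (h k : CL2 mu).

Lemma I01_unit : {ae mu, forall t : T, 0 <= t <= 1}.
Proof.
exists (~` [set` `[(0:R), 1]]); split.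
- exact: measurableC.
- by rewrite /= /mrestr setICl measure0.
- by move=> t /= N01 /=; rewrite in_itv /=.
Qed.

Lemma I01_neq (x : R) : {ae mu, forall t : T, t <> x}.
Proof.
exists [set x]; split => //; last by move=> t /= /contrapT.
apply/eqP; rewrite eq_le measure_ge0 andbT /= /mrestr.
rewrite -(lebesgue_measure_set1 x); apply: le_measure; rewrite ?inE //.
exact: measurableI.
Qed.

Lemma I01_notin (s : seq R) : {ae mu, forall t : T, t \notin s}.
Proof.
elim: s => [|x s IH]; first exact: aeW.
by apply: filterS2 IH (I01_neq x) => t ts /eqP tx; rewrite inE negb_or tx.
Qed.

(** The number [N] of intervals is kept arbitrary, so that the isometry of a word is again a
    dilation, with N = n ^ size w and [j] the numeral of [w], rather than an iterate. *)
Definition dil_th (N j : nat) (t : R) : R := N%:R * t - j%:R.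
Definition dil_th' (N j : nat) (s : R) : R := (s + j%:R) / N%:R.
Definition dil_mem (N j : nat) (t : R) : bool := j%:R / N%:R <= t <= j.+1%:R / N%:R.
Definition dil_set (N j : nat) : set T := [set t | dil_mem N j t].
Definition dil_weight (N j : nat) (t : R) : R[i] :=
  if dil_mem N j t then (Num.sqrt N%:R)%:C%C else 0.

(** [N] times the image of Lebesgue measure under the affine map agrees with Lebesgue measure on
    half-open intervals, hence everywhere. *)
Lemma lebesgue_measure_affine (N j : nat) (A : set T) : (0 < N)%N -> measurable A ->
  lebesgue_measure ((dil_th N j : T -> T) @^-1` A) = ((N%:R^-1)%:E * lebesgue_measure A)%E.
Proof.
move=> N0 mA; have Np : 0 < N%:R :> R by rewrite ltr0n.
have mth : measurable_fun setT (dil_th N j : T -> T).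
  by apply: measurable_funB => //; apply: measurable_funM.
pose thm : {mfun T >-> T} := HB.pack (dil_th N j : T -> T) (isMeasurableFun.Build _ _ _ _ _ mth).
pose nu : {measure set T -> \bar R} :=
  mscale (NngNum (ler0n R N)) (pushforward lebesgue_measure thm).
have E : lebesgue_measure A = nu mth A.
  apply: lebesgue_measure_unique => // _ [[a b]] _ <-.
  rewrite /nu /= /mscale /= /pushforward.
  rewrite (_ : _ @^-1` _ = [set` `](a + j%:R) / N%:R, (b + j%:R) / N%:R]]); last first.
    apply/seteqP; split=> [t|t] /=; rewrite !in_itv /= /dil_th;
      by rewrite ltr_pdivrMr // ler_pdivlMr // ltrBrDr lerBlDr mulrC.
  rewrite !lebesgue_measure_itv /= !lte_fin ltr_pM2r ?invr_gt0 // ltrD2r.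
  case: ifP => _; last by rewrite mule0.
  by rewrite -!EFinB -EFinM -mulrBl mulrCA divff ?gt_eqF // mulr1; congr (_%:E); ring.
rewrite E /nu /= /mscale /= /pushforward muleA -EFinM mulVf ?gt_eqF // mul1e.
by [].
Qed.

Lemma dil_cv (N j : nat) : (j < N)%N ->
  change_of_variable mu (dil_set N j) [set` `[(0:R), 1]] (dil_th N j) (dil_th' N j) (N%:R^-1).
Proof.
move=> jN; have N0 : (0 < N)%N by exact: leq_trans jN.
have Np : 0 < N%:R :> R by rewrite ltr0n.
have SE : dil_set N j = dil_th N j @^-1` [set` `[(0:R), 1]].
  apply/seteqP; split=> t; rewrite /dil_set /= in_itv /= /dil_mem /dil_th;
    by rewrite ler_pdivrMr // ler_pdivlMr // subr_ge0 lerBlDr -natr1 [t * _]mulrC [1 + _]addrC.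
have mth : measurable_fun setT (dil_th N j : T -> T).
  by apply: measurable_funB => //; apply: measurable_funM.
have mS : measurable (dil_set N j).
  by rewrite SE -[X in measurable X]setTI; exact: mth.
have S01 : dil_set N j `<=` [set` `[(0:R), 1]].
  move=> t; rewrite /dil_set /= in_itv /= => /andP[t1 t2]; apply/andP; split.
    by apply: le_trans t1; rewrite divr_ge0.
  by apply: le_trans t2 _; rewrite ler_pdivrMr // mul1r ler_nat.
have thK (t : R) : dil_th' N j (dil_th N j t) = t.
  by rewrite /dil_th' /dil_th subrK mulrC mulKf // gt_eqF.
split => //.
- by apply: measurable_funM => //; apply: measurable_funD.
- move=> A mA; rewrite /= /mrestr.
  rewrite (_ : _ `&` _ `&` _ = dil_th N j @^-1` (A `&` [set` `[(0:R), 1]])).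
    rewrite lebesgue_measure_affine //; last exact: measurableI.
    by congr (_ * lebesgue_measure _)%E; rewrite setIAC setIid setIC.
  rewrite preimage_setI -SE [RHS]setIC; apply/seteqP; split=> [t [] //|t [St At]].
  by split => //; exact: S01.
Qed.

Section Fixed.
Context (N j : nat) (jN : (j < N)%N).

Let N0 : 0 < N%:R :> R. Proof. by rewrite ltr0n; exact: leq_trans jN. Qed.
Let cv := dil_cv jN.

Lemma cmeasurable_dil_weight : cmeasurable (dil_weight N j : T -> R[i]).
Proof.
apply: cmeasurable_if; last exact: cmeasurable_cst.
apply: (measurable_fun_bool true); rewrite setTI; exact: cv_mS cv.
Qed.

Lemma cnsq_dil_weight t : cnsq (dil_weight N j t) <= N%:R.
Proof.
rewrite /dil_weight; case: ifP => _; rewrite /cnsq /= expr0n addr0 ?expr0n ?(ltW N0) //.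
by rewrite sqr_sqrtr ?(ltW N0).
Qed.

Lemma dil_weight0 t : ~ dil_set N j t -> dil_weight N j t = 0.
Proof. by move=> /negP /= /negPf Nt; rewrite /dil_weight Nt. Qed.

Definition dil h : CL2 mu := @wcomp _ T R mu (dil_th N j) (dil_weight N j) h.
Definition dil' h : CL2 mu :=
  @wadj _ T R mu [set` `[(0:R), 1]] (dil_th' N j) (N%:R^-1) (dil_weight N j) h.

Lemma dilE h : {ae mu, forall t, dil h t =
  dil_weight N j t * h (dil_th N j t)}.
Proof. exact: (wcompE cv cmeasurable_dil_weight (ltW N0) cnsq_dil_weight dil_weight0). Qed.

Lemma dil'E h : {ae mu, forall s, dil' h s =
  (Num.sqrt N%:R)^-1%:C%C * h (dil_th' N j s)}.
Proof.
have := wadjE cv cmeasurable_dil_weight (ltW N0) cnsq_dil_weight h.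
apply: filterS2 I01_unit => s s01 ->; congr (_ * _).
rewrite /wadj_weight asboolT ?in_itv //= /dil_weight.
have -> : dil_mem N j (dil_th' N j s).
  move: s01 => /andP[s0 s1]; rewrite /dil_mem /dil_th'.
  by rewrite !ler_pM2r ?invr_gt0 // lerDr s0 -natr1 addrC lerD2l.
rewrite conj_real -rmorphM; congr (_%:C%C).
by rewrite -{1}(sqr_sqrtr (ltW N0)) expr2 invfM -mulrA mulVf ?mulr1 // gt_eqF // sqrtr_gt0.
Qed.

Lemma dil_adj h k : CL2_dot (dil h) k = CL2_dot h (dil' k).
Proof. exact: (wcomp_adj cv cmeasurable_dil_weight (ltW N0) cnsq_dil_weight dil_weight0). Qed.

Lemma dil_projE h : {ae mu, forall t, dil (dil' h) t =
  if dil_mem N j t then h t else 0}.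
Proof.
have A := cv_ae cv (dil'E h).
apply: filterS2 (dilE (dil' h)) A => t -> At; rewrite /dil_weight.
case: ifPn => [St|_]; last by rewrite mul0r.
rewrite At // mulrA -rmorphM mulfV ?gt_eqF ?sqrtr_gt0 // mul1r.
by have := cv_inv cv St; rewrite /= => ->.
Qed.

End Fixed.

Lemma CL2_zeroE : {ae mu, forall t, (0 : CL2 mu) t = 0}.
Proof. exact: (CL2_piE (0 : CLfun2Type mu)). Qed.

Lemma CL2_sumE (I : Type) (r : seq I) (F : I -> CL2 mu) :
  {ae mu, forall t, (\sum_(i <- r) F i : CL2 mu) t = \sum_(i <- r) F i t}.
Proof.
elim: r => [|i r IH].
  by apply: filterS CL2_zeroE => t; rewrite !big_nil.
apply: filterS2 IH (CL2_addE (F i) (\sum_(j <- r) F j)) => t IHt Et.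
by rewrite !big_cons Et IHt.
Qed.

Lemma dil'_dil (N j k : nat) h : (j < N)%N -> (k < N)%N ->
  dil' N j (dil N k h) = if j == k then h else 0.
Proof.
move=> jN kN; have Np : 0 < N%:R :> R by rewrite ltr0n; exact: leq_trans jN.
have Ni : 0 < N%:R^-1 :> R by rewrite invr_gt0.
apply: (@CL2_ext _ T R mu).
have A := cv_ae' (dil_cv jN) Ni (dilE kN h).
near=> s.
have /andP[s0 s1] : 0 <= s <= 1 by near: s; exact: I01_unit.
(* Neighbouring closed intervals share an endpoint, the image of 0 or 1. *)
have : s \notin [:: 0; 1] by near: s; exact: I01_notin.
rewrite !inE negb_or => /andP[n0 n1].
have Zs : (0 : CL2 mu) s = 0 by near: s; exact: CL2_zeroE.
have -> : dil' N j (dil N k h) s = (Num.sqrt N%:R)^-1%:C%C * dil N k h (dil_th' N j s).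
  by near: s; exact: dil'E.
have -> : dil N k h (dil_th' N j s) =
    dil_weight N k (dil_th' N j s) * h (dil_th N k (dil_th' N j s)).
  suff : [set` `[(0:R), 1]] s -> dil N k h (dil_th' N j s) =
      dil_weight N k (dil_th' N j s) * h (dil_th N k (dil_th' N j s)).
    by apply; rewrite /= in_itv /= s0.
  by near: s; exact: A.
have {}s0 : 0 < s by rewrite lt_def n0.
have {n0 n1}s1 : s < 1 by rewrite lt_def eq_sym n1.
rewrite /dil_weight /dil_mem /dil_th' !ler_pM2r //.
case: (ltngtP j k) => [jk|kj|<-].
- have : (j.+1)%:R <= k%:R :> R by rewrite ler_nat.
  rewrite -natr1 => jk'; rewrite ifF; last by apply/negP => /andP[h1 _]; lra.
  by rewrite mul0r mulr0 Zs.
- have : (k.+1)%:R <= j%:R :> R by rewrite ler_nat.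
  rewrite -natr1 => jk'; rewrite ifF; last by apply/negP => /andP[_]; lra.
  by rewrite mul0r mulr0 Zs.
- rewrite ifT; last by rewrite -natr1; apply/andP; split; lra.
  rewrite mulrA -rmorphM mulVf ?gt_eqF ?sqrtr_gt0 // mul1r /dil_th.
  by rewrite [N%:R * _]mulrC divfK ?gt_eqF // addrK.
Unshelve. all: by end_near. Qed.

Lemma dil_resolution (N : nat) h : (0 < N)%N ->
  \sum_(j < N) dil N j (dil' N j h) = h.
Proof.
move=> N0; have Np : 0 < N%:R :> R by rewrite ltr0n.
apply: (@CL2_ext _ T R mu).
have A : {ae mu, forall t, forall j : 'I_N, dil N j (dil' N j h) t =
    if dil_mem N j t then h t else 0}.
  by apply: filter_forall => j; exact: dil_projE.
have B := CL2_sumE (index_enum 'I_N) (fun j : 'I_N => dil N j (dil' N j h)).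
near=> t.
have /andP[t0 t1] : 0 <= t <= 1 by near: t; exact: I01_unit.
(* Off the grid, [t] lies in exactly one of the closed intervals, that of the integer part of N
   t. *)
have tN : t \notin [seq j%:R / N%:R | j <- iota 0 N.+1] by near: t; exact: I01_notin.
have -> : (\sum_(j < N) dil N j (dil' N j h) : CL2 mu) t =
    \sum_(j < N) dil N j (dil' N j h) t by near: t; exact: B.
have At (j : 'I_N) : dil N j (dil' N j h) t = if dil_mem N j t then h t else 0.
  by move: j; near: t; exact: A.
under eq_bigr do rewrite At.
have tneq (j : nat) : (j <= N)%N -> t <> j%:R / N%:R.
  move=> jN tj; move/negP: tN; apply; apply/mapP; exists j => //.
  by rewrite mem_iota.
have Nt0 : 0 <= N%:R * t by rewrite mulr_ge0 // ltW.
have /andP[k1 k2] := truncn_itv Nt0; set k := Num.truncn _ in k1 k2.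
have kN : (k < N)%N.
  rewrite -(ltr_nat R); apply: le_lt_trans k1 _.
  rewrite -[X in _ < X]mulr1 ltr_pM2l // lt_def t1 andbT.
  apply/negP => /eqP t1'; apply: (tneq N) => //.
  by rewrite divff ?gt_eqF.
have tk : k%:R / N%:R < t.
  rewrite lt_def ler_pdivrMr // [t * _]mulrC k1 andbT; apply/eqP/tneq; exact: ltnW.
have tk' : t < k.+1%:R / N%:R by rewrite ltr_pdivlMr // [t * _]mulrC.
rewrite (bigD1 (Ordinal kN)) //= /dil_mem !ltW // big1 ?addr0 // => j jk.
rewrite ifF //; apply/negP => /andP[h1 h2].
case: (ltngtP j k) => [jk'|kj'|jk'].
- have : j.+1%:R / N%:R <= k%:R / N%:R :> R by rewrite ler_pM2r ?invr_gt0 // ler_nat.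
  by move=> H; have := le_lt_trans (le_trans h2 H) tk; rewrite ltxx.
- have : k.+1%:R / N%:R <= j%:R / N%:R :> R by rewrite ler_pM2r ?invr_gt0 // ler_nat.
  by move=> H; have := lt_le_trans tk' (le_trans H h1); rewrite ltxx.
- by case/eqP: jk; apply: val_inj.
Unshelve. all: by end_near. Qed.

(** Interval [j] of a subdivision in [N'] parts of interval [i] is the interval i N' + j of the
    subdivision of [0, 1] in N N' parts. *)
Lemma dil_comp (N N' i j : nat) h : (i < N)%N -> (j < N')%N ->
  dil N i (dil N' j h) = dil (N * N') (i * N' + j) h.
Proof.
move=> iN jN'.
have Np : 0 < N%:R :> R by rewrite ltr0n; exact: leq_trans iN.
have Np' : 0 < N'%:R :> R by rewrite ltr0n; exact: leq_trans jN'.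
have ij : (i * N' + j < N * N')%N.
  by apply: (@leq_trans (i.+1 * N')); rewrite ?leq_mul2r ?iN ?orbT // mulSn addnC ltn_add2r.
apply: (@CL2_ext _ T R mu).
have A := cv_ae (dil_cv iN) (dilE jN' h).
near=> t.
have -> : dil N i (dil N' j h) t = dil_weight N i t * dil N' j h (dil_th N i t).
  by near: t; exact: dilE.
have -> : dil (N * N') (i * N' + j) h t = dil_weight (N * N') (i * N' + j) t *
  h (dil_th (N * N') (i * N' + j) t) by near: t; exact: dilE.
have At : dil_set N i t -> dil N' j h (dil_th N i t) =
    dil_weight N' j (dil_th N i t) * h (dil_th N' j (dil_th N i t)).
  by near: t; exact: A.
have le_j : j%:R / N'%:R <= 1 :> R by rewrite ler_pdivrMr // mul1r ler_nat ltnW.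
have ge_j : 0 <= j%:R / N'%:R :> R by rewrite divr_ge0.
have le_j1 : j.+1%:R / N'%:R <= 1 :> R by rewrite ler_pdivrMr // mul1r ler_nat.
have memE : dil_mem (N * N') (i * N' + j) t =
    dil_mem N i t && dil_mem N' j (N%:R * t - i%:R).
  rewrite /dil_mem -addnS !natrD !natrM.
  have E x : (i%:R * N'%:R + x) / (N%:R * N'%:R) = (i%:R + x / N'%:R) / N%:R :> R.
    by field; rewrite !gt_eqF.
  have D1 x : (x / N%:R <= t) = (x <= N%:R * t) by rewrite ler_pdivrMr // mulrC.
  have D2 x : (t <= x / N%:R) = (N%:R * t <= x) by rewrite ler_pdivlMr // mulrC.
  rewrite !E !D1 !D2 -(natr1 i).
  by apply/idP/idP => [/andP[h1 h2]|/andP[/andP[h1 h2] /andP[h3 h4]]];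
    do ?[apply/andP; split]; lra.
rewrite /dil_weight memE; case: ifPn => [St|_]; last by rewrite !mul0r.
rewrite At // /dil_weight /dil_th /=; case: ifP => _; last by rewrite mul0r mulr0 mul0r.
rewrite mulrA -rmorphM natrM sqrtrM ?ltW //; congr (_ * h _).
by rewrite natrD natrM; ring.
Unshelve. all: by end_near. Qed.

Lemma dil1 h : dil 1 0 h = h.
Proof.
apply: (@CL2_ext _ T R mu).
apply: filterS2 I01_unit (dilE (ltn0Sn 0) h) => t t01 ->.
by rewrite /dil_weight /dil_mem mul0r divr1 t01 sqrtr1 mul1r /dil_th mul1r subr0.
Qed.

End Dilations.

(** * Words as numerals and the lexicographic order *)

Section WordIndex.
Context (n : nat).
Local Notation word := (seq 'I_n).

(* The word w as a numeral in base n: the interval of w is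
   [widx w / n ^ size w, (widx w + 1) / n ^ size w]. *)
Fixpoint widx (w : word) : nat :=
  if w is i :: w' then (i * n ^ size w' + widx w')%N else 0%N.

Lemma widx_cat (w v : word) : widx (w ++ v) = (widx w * n ^ size v + widx v)%N.
Proof.
elim: w => //= i w ->; rewrite size_cat expnD mulnDl addnA.
by rewrite mulnA.
Qed.

Lemma widx_lt (w : word) : (widx w < n ^ size w)%N.
Proof.
elim: w => //= i w IH; rewrite expnS.
apply: (@leq_trans (i.+1 * n ^ size w)%N); first by rewrite mulSn addnC ltn_add2r.
by rewrite leq_mul2r ltn_ord orbT.
Qed.

Lemma widx_cons_le (i j : 'I_n) (w v : word) : size w = size v ->
  (widx (i :: w) <= widx (j :: v))%N = (i < j)%N || (i == j :> nat) && (widx w <= widx v)%N.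
Proof.
move=> wv /=; rewrite wv; have := widx_lt w; have := widx_lt v; rewrite wv.
set N := (n ^ _)%N => vN wN; case: (ltngtP i j) => [ij|ji|<-] /=.
- apply: (@leq_trans (i.+1 * N)%N); first by rewrite mulSn addnC leq_add2r ltnW.
  by apply: leq_trans (leq_addr _ _); rewrite leq_mul2r ij orbT.
- apply/negbTE; rewrite -ltnNge; apply: (@leq_trans (j.+1 * N)%N).
    by rewrite mulSn addnC ltn_add2r.
  by apply: leq_trans (leq_addr _ _); rewrite leq_mul2r ji orbT.
- by rewrite leq_add2l.
Qed.

Lemma widx_inj (w v : word) : size w = size v -> widx w = widx v -> w = v.
Proof.
elim: w v => [|i w IH] [|j v] //= [wv] E.
have h1 : (widx (i :: w) <= widx (j :: v))%N by rewrite /= E.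
have h2 : (widx (j :: v) <= widx (i :: w))%N by rewrite /= E.
move: h1 h2; rewrite !widx_cons_le // eq_sym.
case: (ltngtP i j) => //= ij h1 h2; congr cons; first exact: val_inj.
by apply: IH => //; apply/eqP; rewrite eqn_leq h1 h2.
Qed.

Lemma lexi_widx (w v : word) : size w = size v ->
  ((w : seqlexi 'I_n) <= v)%O = (widx w <= widx v)%N.
Proof.
elim: w v => [|i w IH] [|j v] //= [wv].
rewrite -[RHS]/(widx (i :: w) <= widx (j :: v))%N widx_cons_le //.
rewrite Order.SeqLexiOrder.Exports.lexi_cons IH // !leEord.
by case: (ltngtP i j).
Qed.

Lemma ltxi_widx (w v : word) : size w = size v ->
  ((w : seqlexi 'I_n) < v)%O = (widx w < widx v)%N.
Proof. by move=> wv; rewrite !ltNge !lexi_widx // ltnNge. Qed.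

Lemma widx_all0 (w : word) : all (fun i : 'I_n => i == 0 :> nat) w = (widx w == 0%N).
Proof.
elim: w => //= i w ->; rewrite addn_eq0 muln_eq0 expn_eq0.
by rewrite (gtn_eqF (leq_ltn_trans _ (ltn_ord i))) //= orbF.
Qed.

Lemma widx_allmax (w : word) :
  all (fun i : 'I_n => i == n.-1 :> nat) w = ((widx w).+1 == n ^ size w)%N.
Proof.
elim: w => //= i w ->; have wN := widx_lt w; have iN := ltn_ord i.
rewrite expnS; set N := (n ^ _)%N in wN *.
have n0 : (0 < n)%N by exact: leq_ltn_trans iN.
have [iE|ine] /= := eqVneq (i : nat) n.-1.
  have -> : (n * N = n.-1 * N + N)%N by rewrite -{1}(prednK n0) mulSn addnC.
  by rewrite iE -addnS eqn_add2l.
apply/esym/negbTE; rewrite neq_ltn; apply/orP; left; rewrite -addnS.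
apply: (@leq_ltn_trans (i * N + N)%N); first by rewrite leq_add2l.
rewrite addnC -mulSn ltn_mul2r (leq_ltn_trans _ wN) //=.
by rewrite ltn_neqAle iN andbT; apply: contra ine => /eqP E; apply/eqP/succn_inj; rewrite prednK.
Qed.

End WordIndex.

(** * The Cuntz isometries on L^2[0, 1] *)

Section VolterraWords.
Context (R : realType) (n : nat) (n_ge2 : (2 <= n)%N).
Local Notation T := (measurableTypeR R).
Local Notation mu := (I01 R).
Local Notation H := (L2I R).
Local Notation word := (seq 'I_n).

Let n_gt0 : (0 < n)%N. Proof. exact: leq_trans n_ge2. Qed.

Lemma cuntz_isometryE (i : 'I_n) (h : H) : cuntz_isometry i h = dil n i h.
Proof.
rewrite /cuntz_isometry /L2I_of /dil /wcomp /CL2_of; congr (\pi_(_) (insubd _ _))%qT.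
apply/funext => t; rewrite /dil_weight /dil_mem; case: ifP => // _.
by rewrite mul0r.
Qed.

Lemma cuntz_wordE (w : word) (h : H) : cuntz_word w h = dil (n ^ size w) (widx w) h.
Proof.
elim: w h => [|i w IH] h /=; first by rewrite dil1.
by rewrite IH cuntz_isometryE dil_comp ?widx_lt // expnS.
Qed.

Definition cuntz_coword (w : word) (h : H) : H := dil' (n ^ size w) (widx w) h.

Lemma cuntz_word_adj (w : word) (h k : H) :
  hform H (cuntz_word w h) k = hform H h (cuntz_coword w k).
Proof. by rewrite cuntz_wordE; apply: dil_adj; exact: widx_lt. Qed.

Lemma adjoint_cuntz_word (w : word) : adjoint (cuntz_word w : H -> H) = cuntz_coword w.
Proof. by apply: adjointE; exact: cuntz_word_adj. Qed.

Lemma cuntz_word_linear (w : word) : linear (cuntz_word w : H -> H).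
Proof. exact: adj_linear (cuntz_word_adj w). Qed.

Lemma cuntz_word_cat (w v : word) (h : H) :
  cuntz_word (w ++ v) h = cuntz_word w (cuntz_word v h).
Proof. by elim: w => //= i w ->. Qed.

Lemma cuntz_coword_cat (w v : word) (h : H) :
  cuntz_coword (w ++ v) h = cuntz_coword v (cuntz_coword w h).
Proof. by apply: hformI => k; rewrite -!cuntz_word_adj cuntz_word_cat. Qed.

Lemma cuntz_coword_word (w v : word) (h : H) : size w = size v ->
  cuntz_coword w (cuntz_word v h) = if w == v then h else 0.
Proof.
move=> wv; rewrite cuntz_wordE /cuntz_coword -wv dil'_dil ?widx_lt //; last first.
  by rewrite wv widx_lt.
have -> // : (widx w == widx v) = (w == v).
by apply/eqP/eqP => [/widx_inj -> //|->].
Qed.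

Definition volterra_mono (w v : word) (h : H) : H :=
  cuntz_word w (adjoint (cuntz_word v) h).

Lemma volterra_monoE (w v : word) (h : H) :
  volterra_mono w v h = cuntz_word w (cuntz_coword v h).
Proof. by rewrite /volterra_mono adjoint_cuntz_word. Qed.

Lemma cuntz_word0 (w : word) : cuntz_word w (0 : H) = 0.
Proof.
by apply: hformI => k; rewrite hform0r hformC cuntz_word_adj hform0l rmorph0.
Qed.

Lemma cuntz_coword0 (w : word) : cuntz_coword w (0 : H) = 0.
Proof. by apply: hformI => k; rewrite -cuntz_word_adj !hform0r. Qed.

Lemma cuntz_wordD (w : word) (h k : H) :
  cuntz_word w (h + k) = cuntz_word w h + cuntz_word w k :> H.
Proof. by have := cuntz_word_linear w 1 h k; rewrite !scale1r. Qed.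

Lemma volterra_mono_adj (w v : word) (h k : H) :
  hform H (volterra_mono w v h) k = hform H h (volterra_mono v w k).
Proof.
rewrite !volterra_monoE cuntz_word_adj [RHS]hformC cuntz_word_adj.
by rewrite -hformC.
Qed.

Lemma volterra_family : cuntz_family volterra_mono.
Proof.
split.
- by move=> w v; exact: adj_linear (volterra_mono_adj w v).
- exact: volterra_mono_adj.
- move=> w v u r h; rewrite !volterra_monoE !cuntz_word_cat.
  by rewrite cuntz_coword_word // eqxx.
- move=> w v v' u h N1 N2; rewrite !volterra_monoE.
  (* Words of which neither is a prefix of the other already differ within the shorter length, where
     orthogonality of equal-length words applies. *)
  set l := minn (size v) (size v').
  have sl x : (l <= size x)%N -> size (take l x) = l by exact: size_takel.
  rewrite -[v](cat_take_drop l) -[v'](cat_take_drop l) cuntz_coword_cat cuntz_word_cat.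
  rewrite cuntz_coword_word ?sl ?geq_minl ?geq_minr //.
  case: eqP => [E|_]; last by rewrite cuntz_coword0 cuntz_word0.
  case: (leqP (size v) (size v')) => [le|/ltnW le].
    have lE : l = size v by exact/minn_idPl.
    by case/negP: N1; rewrite prefixE -lE -E lE take_size.
  have lE : l = size v' by exact/minn_idPr.
  by case/negP: N2; rewrite prefixE -lE E lE take_size.
- move=> w v h; rewrite volterra_monoE.
  under eq_bigr do rewrite volterra_monoE -!cats1 cuntz_word_cat cuntz_coword_cat.
  set y := cuntz_coword v h.
  rewrite -(@big_morph _ _ (cuntz_word w : H -> H) 0 +%R 0 +%R (cuntz_wordD w) (cuntz_word0 w)).
  congr cuntz_word; rewrite -[RHS](dil_resolution y n_gt0).
  apply: eq_bigr => i _; rewrite cuntz_wordE /cuntz_coword /= expn1.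
  by rewrite expn0 muln1 addn0.
Qed.

Definition L2I_one : H := CL2_of mu (fun=> 1).

Lemma L2I_one_norm : hform H L2I_one L2I_one = 1.
Proof.
have one2 : (fun=> 1 : R[i]) \in CLfun2 mu.
  apply/CLfun2P; split; first exact: cmeasurable_cst.
  rewrite (_ : (fun _ => _) = cst 1%E); last first.
    by apply/funext => t; rewrite /cnsq /= expr0n addr0 expr1n.
  rewrite integral_cst // mul1e /= /mrestr setTI lebesgue_measure_itv /= lte_fin ltr01.
  by rewrite -EFinB ltry.
have /= E := CL2_hnorm one2 (CL2_ofE one2).
rewrite [LHS](hform_norm L2I_one); suff -> : hnorm L2I_one ^+ 2 = 1 by [].
apply: EFin_inj; rewrite E.
rewrite (_ : (fun _ => _) = cst 1%E); last first.
  by apply/funext => t; rewrite /cnsq /= expr0n addr0 expr1n.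
rewrite integral_cst // mul1e /= /mrestr setTI lebesgue_measure_itv /= lte_fin ltr01.
by rewrite -EFinB subr0.
Qed.

(* The word 0 ... 0 1 does not begin with a nonempty proper shift of itself. *)
Lemma volterra_vacuum L : exists u : H, cuntz_vacuum volterra_mono L u.
Proof.
pose o : 'I_n := Ordinal n_gt0; pose i : 'I_n := Ordinal n_ge2.
pose gam : word := rcons (nseq L o) i.
exists (cuntz_word gam L2I_one) => w v wL vL.
have E a : volterra_mono a [::] (cuntz_word gam L2I_one) = cuntz_word (a ++ gam) L2I_one.
  rewrite volterra_monoE cuntz_word_cat; congr cuntz_word.
  by apply: hformI => k; rewrite -cuntz_word_adj.
rewrite !E.
have gsz : size gam = L.+1 by rewrite size_rcons size_nseq.
have np (a b : word) : (size a < size b)%N -> (size b <= L)%N ->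
    ~~ prefix (a ++ gam) (b ++ gam).
  move=> ab bL; apply/negP => /prefixP[r rE].
  (* At this position [a ++ gam] has its final letter 1, whereas [b ++ gam] is still within its
     block of zeros. *)
  have := congr1 (fun x => nth o x (size a + L)) rE.
  rewrite !nth_cat size_cat gsz.
  have -> : (size a + L < size b)%N = false by apply/negbTE; rewrite -leqNgt; lia.
  have -> : (size a + L < size a + L.+1)%N by rewrite ltn_add2l.
  rewrite (ltnNge (size a + L)) leq_addr /= addKn !nth_rcons size_nseq ltnn eqxx.
  have -> : (size a + L - size b < L)%N by lia.
  by rewrite nth_nseq if_same => /(congr1 val).
have orth (a b : word) : (size a < size b)%N -> (size b <= L)%N ->
    hform H (cuntz_word (a ++ gam) L2I_one) (cuntz_word (b ++ gam) L2I_one) = 0.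
  move=> ab bL; have N1 := np a b ab bL.
  have N2 : ~~ prefix (b ++ gam) (a ++ gam).
    by apply/negP => /size_prefix; rewrite !size_cat leq_add2r leqNgt ab.
  have coE c : cuntz_word c L2I_one = volterra_mono c [::] L2I_one.
    rewrite volterra_monoE; congr cuntz_word.
    by apply: hformI => k; rewrite -cuntz_word_adj.
  rewrite !coE volterra_mono_adj (fam_neq volterra_family) ?hform0r //.
have [wv|vw|wv] := ltngtP (size w) (size v).
- by rewrite orth //; case: eqP => // E'; rewrite E' ltnn in wv.
- by rewrite hformC orth // rmorph0; case: eqP => // E'; rewrite E' ltnn in vw.
- rewrite cuntz_word_adj cuntz_coword_word; last by rewrite !size_cat wv.
  rewrite eqseq_cat // eqxx andbT eq_sym; case: eqP => _; first exact: L2I_one_norm.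
  by rewrite hform0r.
Qed.

End VolterraWords.

Section VanishOn.
Context d (T : measurableType d) (R : realType) (mu : {measure set T -> \bar R}).
Implicit Types (P Q : T -> Prop) (h k : CL2 mu).

Definition vanish_on P h := {ae mu, forall t, P t -> h t = 0}.

Lemma vanish_onD P h k : vanish_on P h -> vanish_on P k -> vanish_on P (h + k).
Proof.
rewrite /vanish_on => hP kP; near=> t => Pt.
have -> : (h + k : CL2 mu) t = h t + k t by near: t; exact: CL2_addE.
have -> : h t = 0 by move: Pt; near: t; exact: hP.
have -> : k t = 0 by move: Pt; near: t; exact: kP.
by rewrite addr0.
Unshelve. all: by end_near. Qed.

Lemma vanish_on0 P : vanish_on P (0 : CL2 mu).
Proof. by apply: filterS (CL2_piE (0 : CLfun2Type mu)) => t. Qed.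

Lemma vanish_on_bigcup (P : nat -> T -> Prop) Q h : (forall l, vanish_on (P l) h) ->
  (forall t, Q t -> exists l, P l t) -> vanish_on Q h.
Proof.
move=> hP QP; have : {ae mu, forall t, forall l, P l t -> h t = 0}.
  exact/ae_foralln.
by apply: filterS => t ht /QP[l]; exact: ht.
Qed.

Lemma vanish_onW P Q h : (forall t, Q t -> P t) -> vanish_on P h -> vanish_on Q h.
Proof. by move=> QP; apply: filterS => t hP /QP. Qed.

End VanishOn.

(** * The Volterra nest and the projections of words *)

Section VolterraNest.
Context (R : realType).
Local Notation T := (measurableTypeR R).
Local Notation mu := (I01 R).
Local Notation H := (L2I R).
Implicit Types (h k : H).

Definition supp_le (x : R) (h : CL2 mu) :=
  @vanish_on _ T R mu (fun t : R => x < t) h.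

Lemma CLfun2_restrict (P : T -> bool) (f : T -> R[i]) : measurable_fun setT P ->
  f \in CLfun2 mu -> (fun t => if P t then f t else 0) \in CLfun2 mu.
Proof.
move=> mP /CLfun2P[mf foo]; have mPf := cmeasurable_if mP mf.
apply/CLfun2P; split => //; apply: le_lt_trans foo; apply: ge0_le_integral => //.
- by move=> t _; rewrite lee_fin cnsq_ge0.
- by apply/measurable_EFinP; exact: (measurable_cnsq mPf).
- by apply/measurable_EFinP; exact: measurable_cnsq.
- move=> t _; rewrite lee_fin; case: (P t) => //.
  by rewrite [X in X <= _](_ : _ = 0) ?cnsq_ge0 // /cnsq /= expr0n addr0.
Qed.

Lemma volterra_projE (x : R) h :
  {ae mu, forall t, (volterra_proj x h : CL2 mu) t = if 0 <= t <= x then (h : CL2 mu) t else 0}.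
Proof.
apply: CL2_ofE; apply: (@CLfun2_restrict (fun t : R => 0 <= t <= x)); last exact: CL2_funP.
apply: (measurable_fun_bool true); rewrite setTI.
by rewrite (_ : _ @^-1` _ = [set` `[0, x]]).
Qed.

Lemma range_volterra_proj (x : R) h : range (volterra_proj x) h <-> supp_le x h.
Proof.
split=> [[k _ <-]|hx].
  apply: filterS (volterra_projE x k) => t -> xt.
  by rewrite [t <= x]leNgt xt andbF.
exists h => //; apply: (@CL2_ext _ T R mu); near=> t.
have -> : (volterra_proj x h : CL2 mu) t = if 0 <= t <= x then (h : CL2 mu) t else 0.
  by near: t; exact: volterra_projE.
have /andP[-> _] : 0 <= t <= 1 by near: t; exact: I01_unit.
have xt : x < t -> (h : CL2 mu) t = 0 by near: t; exact: hx.
by rewrite /=; case: leP => // /xt ->.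
Unshelve. all: by end_near. Qed.

Lemma nest_algebraP (A : H -> H) : nest_algebra (volterra_nest R) A <->
  bounded_op A /\ forall x h, 0 <= x <= 1 -> supp_le x h -> supp_le x (A h).
Proof.
split=> [[bA HA]|[bA HA]]; split => //.
  move=> x h x01 hx; apply/range_volterra_proj; apply: HA; first by exists x.
  exact/range_volterra_proj.
move=> _ [x x01 ->] h.
by move=> /range_volterra_proj/(HA _ _ x01)/range_volterra_proj.
Qed.

Lemma supp_leD (x : R) h k : supp_le x h -> supp_le x k -> supp_le x (h + k).
Proof.
exact: vanish_onD.
Qed.

Lemma supp_le0 (x : R) : supp_le x (0 : CL2 mu).
Proof. exact: vanish_on0. Qed.

Lemma supp_le_sum (x : R) (I : Type) (r : seq I) (P : pred I) (F : I -> H) :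
  (forall i, P i -> supp_le x (F i)) -> supp_le x (\sum_(i <- r | P i) F i).
Proof.
move=> Fx; elim/big_ind: _ => //; first exact: supp_le0.
by move=> h k; exact: supp_leD.
Qed.

Lemma supp_leW (x y : R) h : x <= y -> supp_le x h -> supp_le y h.
Proof.
by move=> xy; apply: vanish_onW => t; exact: le_lt_trans.
Qed.

Context (n : nat) (n_ge2 : (2 <= n)%N).
Local Notation word := (seq 'I_n).
Local Notation E w := (@volterra_mono R n w w).

Let Nn0 L : 0 < (n ^ L)%:R :> R.
Proof. by rewrite ltr0n expn_gt0 (leq_trans _ n_ge2). Qed.

Lemma volterra_monoE_ae (w : word) h : {ae mu, forall t, (E w h : CL2 mu) t =
  if dil_mem (n ^ size w) (widx w) t then (h : CL2 mu) t else 0}.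
Proof.
rewrite volterra_monoE cuntz_wordE; apply: dil_projE.
exact: widx_lt.
Qed.

Lemma volterra_mono_supp (w : word) h :
  supp_le ((widx w).+1%:R / (n ^ size w)%:R) (E w h).
Proof.
apply: filterS (volterra_monoE_ae w h) => t -> xt.
by rewrite /dil_mem [X in _ && X]leNgt xt andbF.
Qed.

Lemma volterra_mono_kill (w : word) (x : R) h : x <= (widx w)%:R / (n ^ size w)%:R ->
  supp_le x h -> E w h = 0.
Proof.
move=> xw hx; apply: (@CL2_ext _ T R mu); near=> t.
have -> : (E w h : CL2 mu) t =
    if dil_mem (n ^ size w) (widx w) t then (h : CL2 mu) t else 0.
  by near: t; exact: volterra_monoE_ae.
have -> : (0 : CL2 mu) t = 0 by near: t; exact: CL2_zeroE.
have tx : t <> x by near: t; exact: I01_neq.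
have ht : x < t -> (h : CL2 mu) t = 0 by near: t; exact: hx.
case: ifP => // /andP[wt _]; apply: ht; rewrite lt_def (le_trans xw wt) andbT.
exact/eqP.
Unshelve. all: by end_near. Qed.

(** E_v h is supported to the left of the interval of [w]; [A] keeps it there, and E_w kills what
    remains. *)
Lemma nest_algebra_mono (A : H -> H) (w v : word) h :
  nest_algebra (volterra_nest R) A -> size w = size v -> (widx v < widx w)%N ->
  E w (A (E v h)) = 0.
Proof.
move=> /nest_algebraP[_ HA] wv vw.
apply: (@volterra_mono_kill _ ((widx w)%:R / (n ^ size w)%:R)) => //.
apply: HA.
  rewrite divr_ge0 //= ler_pdivrMr // mul1r ler_nat ltnW //; exact: widx_lt.
apply: supp_leW (volterra_mono_supp v h).
by rewrite wv ler_pM2r ?invr_gt0 // ler_nat.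
Qed.

(** On the grid of step n ^ -L, the hypothesis says that [A] does not move any interval to the
    right. An arbitrary [x] is approached from above by grid points, and countably many null sets
    are discarded in the limit. *)
Lemma mono_nest_algebra (A : H -> H) : bounded_op A ->
  (forall (w v : word) h, size w = size v -> (widx v < widx w)%N -> E w (A (E v h)) = 0) ->
  nest_algebra (volterra_nest R) A.
Proof.
move=> bA HA; apply/nest_algebraP; split => // x h /andP[x0 x1] hx.
have [lA _] := bA.
have A0 : A 0 = 0 by have := lA (-1) 0 0; rewrite scaler0 addr0 scaleN1r addNr.
have AD (u v : H) : A (u + v) = A u + A v by have := lA 1 u v; rewrite !scale1r.
have res L (u : H) : u = \sum_(r : L.-tuple 'I_n) E r u.
  rewrite (fam_resolution (volterra_family R n_ge2) L [::] [::]) volterra_monoE /=.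
  by apply: (@hformI _ (L2I R) u _) => k; rewrite -cuntz_word_adj.
(* For intervals [v] from [K] on, E_v h is zero because [h] is supported up to [x]; for the others,
   A E_v h only has components in intervals up to that of [v]. *)
have step L (K : nat) : x <= K%:R / (n ^ L)%:R -> supp_le (K%:R / (n ^ L)%:R) (A h).
  move=> xK; rewrite {1}(res L h) (big_morph A AD A0); apply: supp_le_sum => v _.
  have [Kv|vK] := leqP K (widx v).
    rewrite (@volterra_mono_kill _ x) ?A0 //; first exact: supp_le0.
    by apply: le_trans xK _; rewrite size_tuple ler_pM2r ?invr_gt0 // ler_nat.
  rewrite (res L (A _)); apply: supp_le_sum => w _.
  have [vw|wv] := ltnP (widx v) (widx w).
    by rewrite HA ?size_tuple //; exact: supp_le0.
  apply: supp_leW (volterra_mono_supp w _).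
  rewrite size_tuple ler_pM2r ?invr_gt0 // ler_nat; exact: leq_ltn_trans vK.
pose K L := (Num.truncn ((n ^ L)%:R * x)).+1.
have xK L : x <= (K L)%:R / (n ^ L)%:R.
  rewrite ler_pdivlMr // mulrC.
  have : 0 <= (n ^ L)%:R * x by rewrite mulr_ge0 // ltW.
  by move=> /truncn_itv/andP[_ /ltW].
apply: (vanish_on_bigcup (fun L => step L (K L) (xK L))) => t xt.
have [L tL] : exists L : nat, (t - x)^-1 < (n ^ L)%:R.
  exists (Num.bound (t - x)^-1).
  apply: lt_trans (archi_boundP _) _; first by rewrite invr_ge0 subr_ge0 ltW.
  by rewrite ltr_nat ltn_expl.
exists L; rewrite ltr_pdivrMr //.
have /truncn_itv/andP[k1 _] : 0 <= (n ^ L)%:R * x by rewrite mulr_ge0 // ltW.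
rewrite -natr1; apply: le_lt_trans (lerD k1 (lexx 1)) _.
have d0 : 0 < t - x by rewrite subr_gt0.
move: tL; rewrite -(ltr_pM2r d0) mulVf ?gt_eqF // mulrBr.
by rewrite ltrBrDl mulrC [_ * t]mulrC.
Qed.

End VolterraNest.

(** * The order on paths and PV *)

Section VolterraOrder.
Context (n : nat).
Local Notation word := (seq 'I_n).
Local Notation X := (path_space n).
Local Notation G := (cuntz_groupoid n).

Lemma widx_cat_lt (w v r t : word) : size r = size t -> (widx w < widx v)%N ->
  (widx (w ++ r) < widx (v ++ t))%N.
Proof.
move=> rt wv; rewrite !widx_cat rt; have := widx_lt r; rewrite rt => rN.
apply: (@leq_trans (widx w * n ^ size t + n ^ size t)%N); first by rewrite -addnS leq_add2l.
by rewrite addnC -mulSn (leq_trans (leq_mul wv (leqnn _))) ?leq_addr.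
Qed.

Lemma widx_cat_leP (w v r t : word) : size r = size t ->
  (widx (w ++ r) <= widx (v ++ t))%N -> (widx w <= widx v)%N.
Proof. by move=> rt; apply: contraTT; rewrite -!ltnNge; exact: widx_cat_lt. Qed.

Lemma ptakeD (k l : nat) (x : X) : ptake (k + l) x = ptake k x ++ ptake l (pdrop k x).
Proof.
apply: (@eq_from_nth _ (x 0)); first by rewrite size_cat !size_ptake.
move=> i; rewrite size_ptake => il; rewrite nth_cat size_ptake nth_mkseq //.
have [ik|ki] := ltnP i k; rewrite nth_mkseq //; last by rewrite ltn_subLR.
by rewrite /pdrop subnKC.
Qed.

Lemma ptake_wcatD (l : nat) (w : word) (x : X) :
  ptake (size w + l) (wcat w x) = w ++ ptake l x.
Proof. by rewrite ptakeD ptake_wcat pdrop_wcat. Qed.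

Lemma ptake_cst (l : nat) (i : 'I_n) : ptake l (fun=> i) = nseq l i.
Proof.
apply: (@eq_from_nth _ i) => [|j]; rewrite size_ptake ?size_nseq // => jl.
by rewrite nth_mkseq // nth_nseq jl.
Qed.

(** Prefixes are compared at a length that exceeds both words, where all five kinds of admissible
    pairs can be read as numerals; the order of longer prefixes implies that of shorter ones. *)
Lemma PV_widx_le (g : G) (l : nat) : PV n g ->
  (widx (ptake l (grng g)) <= widx (ptake l (gsrc g)))%N.
Proof.
move=> [w [v [x [gE wv]]]]; rewrite /grng /gsrc gE /=.
pose k := (size w + size v)%N.
suff : (widx (ptake (l + k) (wcat w x)) <= widx (ptake (l + k) (wcat v x)))%N.
  by rewrite !(ptakeD l); apply: widx_cat_leP; rewrite !size_ptake.
have kw : (l + k = size w + (l + size v))%N by rewrite /k; lia.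
have kv : (l + k = size v + (l + size w))%N by rewrite /k; lia.
rewrite {1}kw kv !ptake_wcatD.
case: wv => [[sz le]|[sz lt]|[[sz wE vmax]|[sz lt]|[sz wE v0]]].
- by move: le; rewrite lexi_widx // sz !widx_cat !size_ptake leq_add2r leq_mul2r orbC => ->.
- have ts : size (take (size w) v) = size w by rewrite size_takel // ltnW.
  rewrite ltxi_widx // in lt; rewrite -[X in (_ <= widx (X ++ _))%N](cat_take_drop (size w)).
  rewrite -catA; apply/ltnW/widx_cat_lt; rewrite ?ts // size_cat !size_ptake size_drop.
  by lia.
- have vE : v = w ++ drop (size w) v by rewrite {1}wE cat_take_drop.
  move: vmax vE; set d := drop _ _; rewrite widx_allmax => /eqP dE ->.
  rewrite size_cat (_ : l + (size w + size d) = (l + size w) + size d)%N; last by rewrite addnA.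
  rewrite (ptakeD (l + size w)) -catA.
  (* After the common word [w], it remains to compare y b with d y, where the numeral of d is n^|d|
     - 1. The inequality follows from widx y + 1 <= n^|y|. *)
  set y := ptake _ x; set b := ptake _ _.
  have sb : size b = size d by exact: size_ptake.
  rewrite !(widx_cat w) !size_cat sb (addnC (size d)) leq_add2l !widx_cat sb.
  by have := widx_lt y; have := widx_lt b; rewrite sb; nia.
- have ts : size (take (size v) w) = size v by rewrite size_takel // ltnW.
  rewrite ltxi_widx // in lt; rewrite -[X in (widx (X ++ _) <= _)%N](cat_take_drop (size v)).
  rewrite -catA; apply/ltnW/widx_cat_lt; rewrite ?ts // size_cat !size_ptake size_drop.
  by lia.
- have E : w = v ++ drop (size v) w by rewrite -{1}wE cat_take_drop.
  move: v0 E; set d := drop _ _; rewrite widx_all0 => /eqP dE ->.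
  rewrite size_cat (_ : l + (size v + size d) = (l + size v) + size d)%N; last by rewrite addnA.
  rewrite (ptakeD (l + size v)) -catA.
  (* After the common word [v], it remains to compare d y with y b, where the numeral of d is 0. *)
  set y := ptake _ x; set b := ptake _ _.
  have sb : size b = size d by exact: size_ptake.
  rewrite !(widx_cat v) !size_cat sb (addnC (size d)) leq_add2l !widx_cat dE sb.
  have := widx_lt d; rewrite dE; nia.
Qed.

(** The element [g] itself need not do, since its range and source may coincide; the tail is free to
    be changed. If the words differ within the shorter length, they do so in the wrong order, and
    any tail serves. If one extends the other, the constant tail of last letters (for [v] longer) or
    first letters (for [w] longer) serves, precisely because the extension does not consist of those
    letters. *)
Lemma PV_cylinder_gt (g : G) (w v : word) : gcylinder w v g -> ~ PV n g ->
  exists (h : G) (l : nat), gcylinder w v h /\ (widx (ptake l (gsrc h)) < widx (ptake l (grng h)))%N.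
Proof.
move=> wvg NP; have [x gE] := wvg.
have {NP}N : ~ volterra_pair w v by move=> wv; apply: NP; exists w, v, x.
suff [y [l H]] : exists (y : X) (l : nat),
    (widx (ptake l (wcat v y)) < widx (ptake l (wcat w y)))%N.
  by exists (gelt w v y), l; split => //; exact: gelt_cylinder.
have [sz|sz|sz] := ltngtP (size w) (size v).
- have ts : size (take (size w) v) = size w by rewrite size_takel // ltnW.
  have vE := cat_take_drop (size w) v; move: ts vE.
  set v1 := take _ _; set v2 := drop _ _ => ts vE.
  have [E|ne] := eqVneq (widx w) (widx v1); last first.
    exists x, (size w); rewrite ptake_wcat -vE wcatA -ts ptake_wcat ltn_neqAle eq_sym ne.
    rewrite leqNgt /=; apply/negP => lt; apply: N; apply: Or32; split => //.
    by rewrite ltxi_widx.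
  have wE : w = v1 by exact: widx_inj.
  have n0 : (0 < n)%N by exact: leq_ltn_trans (ltn_ord (x 0%N)).
  pose i : 'I_n := Ordinal (etrans (ltn_predL n) n0).
  exists (fun=> i), (size v); rewrite ptake_wcat -vE size_cat wE ptake_wcatD ptake_cst.
  rewrite !widx_cat size_nseq ltn_add2l.
  have imax : (widx (nseq (size v2) i)).+1 = (n ^ size v2)%N.
    by apply/eqP; rewrite -[in (n ^ _)%N](size_nseq (size v2) i) -widx_allmax all_nseq eqxx orbT.
  have := widx_lt v2; rewrite -imax ltnS leq_eqVlt => /orP[/eqP E2|//]; case: N; apply: Or33; apply: Or31.
  by split => //; rewrite widx_allmax -/v2 E2 imax.
- have ts : size (take (size v) w) = size v by rewrite size_takel // ltnW.
  have E := cat_take_drop (size v) w; move: ts E.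
  set w1 := take _ _; set w2 := drop _ _ => ts E.
  have [Ev|ne] := eqVneq (widx v) (widx w1); last first.
    exists x, (size v); rewrite ptake_wcat -E wcatA -ts ptake_wcat ltn_neqAle ne.
    rewrite leqNgt /=; apply/negP => lt; apply: N; apply: Or33; apply: Or32; split => //.
    by rewrite ltxi_widx.
  have vE : v = w1 by exact: widx_inj.
  have n0 : (0 < n)%N by exact: leq_ltn_trans (ltn_ord (x 0%N)).
  exists (fun=> Ordinal n0), (size w); rewrite ptake_wcat -E size_cat vE ptake_wcatD ptake_cst.
  rewrite !widx_cat size_nseq ltn_add2l.
  have -> : widx (nseq (size w2) (Ordinal n0)) = 0%N.
    by apply/eqP; rewrite -widx_all0 all_nseq eqxx orbT.
  rewrite lt0n; apply/negP => /eqP w20; case: N; apply: Or33; apply: Or33.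
  by split => //; rewrite widx_all0 -/w2 w20.
- exists x, (size v); rewrite ptake_wcat -sz ptake_wcat ltnNge; apply/negP => le.
  by apply: N; apply: Or31; split => //; rewrite lexi_widx.
Qed.
End VolterraOrder.

(** * Comparison of the two algebras *)

Section NormComparison.
Context (R : realType).

Lemma star_rep_bound (n : nat) (H : prehilbert R) (rho : (cuntz_groupoid n -> R[i]) -> H -> H)
    f (e : R) h : hcomplete H -> star_rep rho -> Cc f -> 0 <= e -> (cstar_norm f <= e%:E)%E ->
  hnorm (rho f h) <= e * hnorm h.
Proof.
move=> HC rhoR fc e0 fe.
have unit k : hnorm k <= 1 -> hnorm (rho f k) <= e.
  move=> k1; rewrite -lee_fin (le_trans _ fe) //.
  by apply: ereal_sup_ubound; exists H, rho, k.
have rl := star_rep_linear rhoR fc.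
have r0 : rho f 0 = 0 by have := rl (-1) 0 0; rewrite scaler0 addr0 scaleN1r addNr.
have [/hnorm_eq0 ->|h0] := eqVneq (hnorm h) 0; first by rewrite r0 hnorm0 mulr0.
have hp : 0 < hnorm h by rewrite lt_def h0 hnorm_ge0.
pose a := ((hnorm h)^-1)%:C%C : R[i].
have na k : hnorm (a *: k) = (hnorm h)^-1 * hnorm k.
  by rewrite hnormZ ger0_norm //= ?lecR ?ler0c invr_ge0 ltW.
have := unit (a *: h); rewrite na mulVf // => /(_ (lexx _)).
have := rl a h 0; rewrite r0 !addr0 => ->.
by rewrite na mulrC ler_pdivrMr.
Qed.

Lemma poly_fun_cat_opp (n : nat) (c c' : cuntz_poly R n) :
  poly_fun (c ++ poly_opp c') = poly_fun c - poly_fun c'.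
Proof.
rewrite /poly_fun big_cat big_map -sumrN; congr (_ + _).
by apply: eq_bigr => m _; rewrite scaleNr.
Qed.

Context (m : nat).
Local Notation n := m.+2.
Local Notation word := (seq 'I_n).
Local Notation G := (cuntz_groupoid n).
Local Notation vol := (@volterra_mono R n).
Local Notation reg := (fun w v : word => reg_rep (chi R w v)).
Implicit Types (c : cuntz_poly R n) (e : R).

Let volF : cuntz_family vol. Proof. exact: volterra_family. Qed.
Let volV L : exists u, cuntz_vacuum vol L u. Proof. exact: volterra_vacuum. Qed.

Lemma poly_op_regP c e : 0 <= e ->
  (forall h, hnorm (poly_op c h) <= e * hnorm h) <->
  (forall h, hnorm (fam_poly reg c h) <= e * hnorm h).
Proof.
move=> e0; split => H h.
  exact: (fam_poly_compare volF (reg_family R m.+1) volV).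
exact: (fam_poly_compare (reg_family R m.+1) volF (@reg_vacuum R m.+1)).
Qed.

Lemma poly_op_cstar_norm c e : 0 <= e ->
  (forall h, hnorm (poly_op c h) <= e * hnorm h) <-> (cstar_norm (poly_fun c) <= e%:E)%E.
Proof.
move=> e0; split=> [H|H].
  apply: ge_ereal_sup => _ [K [rho [u [KC rhoR u1 ->]]]]; rewrite lee_fin.
  rewrite star_rep_poly //.
  apply: le_trans (fam_poly_compare volF (star_rep_family rhoR) volV e0 H _) _.
  by rewrite ler_piMr.
apply/(poly_op_regP c e0) => h; rewrite -(star_rep_poly (reg_star_rep R m.+1)).
apply: star_rep_bound => //; [exact: L2_complete|exact: reg_star_rep|exact: Cc_poly_fun].
Qed.

Lemma poly_fun_le c (g : G) e : 0 <= e ->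
  (forall h, hnorm (poly_op c h) <= e * hnorm h) -> `|poly_fun c g| <= e%:C%C.
Proof.
move=> e0 /(poly_op_cstar_norm c e0); exact/coef_le_cstar_norm/Cc_poly_fun.
Qed.

(** [cstar_fun] is defined along a chosen representative of the class; domination of values by the
    C*-norm transfers the limit to any other one. *)
Lemma cstar_fun_cvg (s : cauchy_seq R n) (g : G) e : 0 < e ->
  exists N, forall k, (N <= k)%N ->
    `|s k g - cstar_fun (\pi_(CstarG R n)%qT s) g| <= e%:C%C.
Proof.
move=> e0; set a := \pi_(_)%qT s; pose r : cauchy_seq R n := repr a.
have rs : forall d : R, 0 < d -> exists N, forall k, (N <= k)%N ->
    (cstar_norm (r k - s k)%R < d%:E)%E.
  apply/asboolP; rewrite -[`[< _ >]]/(cauchy_equiv_rel R n r s); apply/eqmodP.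
  by rewrite reprK.
have CcB (f h : G -> R[i]) : Cc f -> Cc h -> Cc (f - h).
  by move=> fc hc; rewrite addrC -scaleN1r; exact: Cc_lin.
have le_norm (f h : G -> R[i]) (d : R) : Cc f -> Cc h -> (cstar_norm (f - h)%R < d%:E)%E ->
    `|f g - h g| <= d%:C%C.
  by move=> fc hc /ltW; exact/coef_le_cstar_norm/CcB.
have rC (d : R) : 0 < d -> exists N, forall i j, (N <= i)%N -> (N <= j)%N ->
    `|complex.Re (r i g) - complex.Re (r j g)| <= d /\
    `|complex.Im (r i g) - complex.Im (r j g)| <= d.
  move=> /(cseq_cauchy r)[N HN]; exists N => i j Ni Nj.
  have := normc_ge_ReIm (le_norm _ _ _ (cseq_Cc r i) (cseq_Cc r j) (HN i j Ni Nj)).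
  by case: (r i g) (r j g) => [? ?] [? ?].
have lim_le (F : R[i] -> R) (d : R) : 0 < d -> (forall d : R, 0 < d -> exists N, forall i j, (N <= i)%N -> (N <= j)%N ->
    `|F (r i g) - F (r j g)| <= d) -> exists N, forall k, (N <= k)%N ->
    `|F (r k g) - limn (fun k => F (r k g))| <= d.
  move=> d0 FC; have [|l rl] := @cauchy_real R (fun k => F (r k g)).
    move=> d' d'0; have [N HN] := FC (d' / 2) (divr_gt0 d'0 (ltr0n _ 2)).
    exists N => i j Ni Nj; apply: le_lt_trans (HN i j Ni Nj) _.
    by rewrite gtr_pMr // invf_lt1 // ltr1n.
  have -> : limn (fun k => F (r k g)) = l by exact/cvg_lim.
  move/cvgrPdist_le: rl => /(_ d d0)[N _ HN]; exists N => k Nk.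
  by rewrite distrC; exact: HN.
have e3 : 0 < e / 3 by rewrite divr_gt0.
have [|N1 H1] := lim_le (fun z => complex.Re z) (e / 3) e3.
  by move=> d /rC[N HN]; exists N => i j Ni Nj; have [] := HN i j Ni Nj.
have [|N2 H2] := lim_le (fun z => complex.Im z) (e / 3) e3.
  by move=> d /rC[N HN]; exists N => i j Ni Nj; have [] := HN i j Ni Nj.
have [N3 H3] := rs _ e3.
(* One third each for the change of representative, the real part and the imaginary part. *)
exists (maxn N1 (maxn N2 N3)) => k; rewrite !geq_max => /and3P[/H1 h1 /H2 h2 /H3 h3].
rewrite -(subrKA (r k g)) (le_trans (ler_normD _ _)) //.
have -> : e%:C%C = (e / 3)%:C%C + ((e / 3)%:C%C + (e / 3)%:C%C) :> R[i].
  by rewrite -!rmorphD; congr (_%:C%C); field.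
apply: lerD; first by rewrite distrC; apply: le_norm => //; exact: cseq_Cc.
rewrite /cstar_fun -/r; move: h1 h2; case: (r k g) => x y /=.
set p := limn _; set q := limn _ => h1 h2.
have -> : Complex x y - Complex p q = Complex (x - p) 0 + Complex 0 (y - q).
  by apply/eqP; rewrite eq_complex /= addr0 add0r !eqxx.
apply: le_trans (ler_normD _ _) _; rewrite !normc_def /= expr0n addr0 add0r !sqrtr_sqr.
by apply: lerD; rewrite lecR.
Qed.

End NormComparison.

Section Operators.
Context (R : realType) (H : prehilbert R).
Implicit Types (T U : H -> H) (h k : H) (e : R).

Lemma ler_eps_mul (x C : R) : 0 <= C -> (forall e : R, 0 < e -> x <= e * C) -> x <= 0.
Proof.
move=> C0 xC; rewrite leNgt; apply/negP => x0.
have C1 : 0 < C + 1 by rewrite ltr_wpDl.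
have := xC (x / (C + 1)) (divr_gt0 x0 C1).
rewrite mulrAC ler_pdivlMr // ler_pM2l // leNgt => /negP; apply.
by rewrite ltrDl.
Qed.

Lemma bounded_op_gt0 T : bounded_op T -> exists2 M : R, 0 < M & forall h, hnorm (T h) <= M * hnorm h.
Proof.
move=> [_ [M TM]]; exists (`|M| + 1) => [|h]; first by rewrite ltr_wpDl.
apply: le_trans (TM h) _; rewrite ler_wpM2r ?hnorm_ge0 //.
by rewrite (le_trans (ler_norm M)) // lerDl.
Qed.

(** Linearity and boundedness are not part of [cuntz_identified]; they are inherited from the
    approximating polynomials. *)
Lemma op_cvg_bounded (T_ : nat -> H -> H) T : (forall l, bounded_op (T_ l)) ->
  op_cvg T_ T -> bounded_op T.
Proof.
move=> Tb TT; split; last first.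
  have [N HN] := TT 1 ltr01; have [_ [M TM]] := Tb N; exists (1 + M) => h.
  rewrite -[T h](subrK (T_ N h)) mulrDl (le_trans (ler_hnormD _ _)) //.
  by rewrite lerD // hnormBC; exact: HN.
move=> a h k; apply/eqP; rewrite -subr_eq0; apply/eqP/hnorm_eq0/eqP.
rewrite eq_le hnorm_ge0 andbT.
have a0 : 0 <= complex.Re `|a| by rewrite normc_def sqrtr_ge0.
pose C := hnorm (a *: h + k) + (complex.Re `|a| * hnorm h + hnorm k).
apply: (@ler_eps_mul _ C) => [|e /TT[N HN]].
  by rewrite !addr_ge0 ?mulr_ge0 ?hnorm_ge0.
have [lN _] := Tb N.
rewrite -(subrKA (T_ N (a *: h + k))) [X in _ + (X - _)]lN opprD [X in _ + X]addrACA -scalerBr.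
apply: le_trans (ler_hnormD _ _) _; rewrite mulrDr; apply: lerD.
  by rewrite hnormBC; exact: HN.
apply: le_trans (ler_hnormD _ _) _; rewrite mulrDr; apply: lerD; last exact: HN.
by rewrite hnormZ mulrCA ler_wpM2l //; exact: HN.
Qed.

Lemma bounded_op_lin (a : R[i]) T U : bounded_op T -> bounded_op U ->
  bounded_op (fun h => a *: T h + U h).
Proof.
move=> [lT [M TM]] [lU [M' UM]]; split.
  move=> b h k; rewrite lT lU !scalerDr !scalerA (mulrC a b) -!addrA.
  by congr (_ + _); rewrite addrCA.
exists (complex.Re `|a| * M + M') => h; rewrite mulrDl (le_trans (ler_hnormD _ _)) //.
by rewrite lerD // hnormZ -mulrA ler_wpM2l // normc_def sqrtr_ge0.
Qed.

Lemma bounded_op_comp T U : bounded_op T -> bounded_op U -> bounded_op (T \o U).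
Proof.
move=> bT [lU [M' UM]]; have [M M0 TM] := bounded_op_gt0 bT; split.
  by move=> b h k /=; rewrite lU; case: bT => ->.
exists (M * M') => h /=; rewrite (le_trans (TM _)) // -mulrA.
by rewrite ler_wpM2l ?UM // ltW.
Qed.

End Operators.

(** * The Cuntz algebra as the norm closure of the polynomials *)

Section CuntzAlgebra.
Context (R : realType) (n : nat) (n_ge2 : (2 <= n)%N).
Local Notation word := (seq 'I_n).
Local Notation H := (L2I R).
Local Notation vol := (@volterra_mono R n).
Implicit Types (c : cuntz_poly R n) (T U : H -> H) (h : H) (e : R).

Let volF : cuntz_family vol. Proof. exact: volterra_family. Qed.

Lemma poly_op_bounded c : bounded_op (poly_op c : H -> H).
Proof. exact: (fam_poly_bounded volF). Qed.

Lemma cuntz_coword_nil h : cuntz_coword (Nil 'I_n) h = h.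
Proof. by apply: (@hformI _ H) => k; rewrite -cuntz_word_adj. Qed.

Lemma cuntz_isometry_poly (i : 'I_n) :
  cuntz_isometry i = poly_op [:: (1, ([:: i], [::]))] :> (H -> H).
Proof.
apply/funext => h; rewrite /poly_op big_seq1 scale1r.
by rewrite -[RHS]/(vol [:: i] [::] h) volterra_monoE cuntz_coword_nil.
Qed.

Lemma poly_op_mem (B : set (H -> H)) c : cstar_subalgebra B ->
  range (@cuntz_isometry R n) `<=` B -> B (poly_op c).
Proof.
move=> [_ Blin Bcomp Badj _] SB.
(* The identity is not among the generators, but it is S_o^* S_o. *)
have Bid : B id.
  pose o : 'I_n := Ordinal (leq_trans (isT : 0 < 2)%N n_ge2).
  have Bo : B (cuntz_word [:: o]) by apply: SB; exists o.
  rewrite (_ : id = adjoint (cuntz_word [:: o]) \o cuntz_word [:: o]).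
    by apply: Bcomp => //; exact: Badj.
  apply/funext => h; rewrite -[RHS]/(adjoint (cuntz_word [:: o]) (cuntz_word [:: o] h)).
  by rewrite adjoint_cuntz_word cuntz_coword_word // eqxx.
have B0 : B (fun=> 0).
  rewrite (_ : (fun=> 0) = (fun u => (-1) *: id u + id u)); first exact: Blin.
  by apply/funext => h; rewrite scaleN1r addNr.
have Bw (w : word) : B (cuntz_word w).
  by elim: w => [|i w IH] //=; apply: Bcomp => //; apply: SB; exists i.
elim: c => [|m c IH].
  by rewrite (_ : poly_op [::] = (fun=> 0)) //; apply/funext => h; rewrite /poly_op big_nil.
rewrite (_ : poly_op (m :: c) = (fun h => m.1 *: (cuntz_word m.2.1 \o adjoint (cuntz_word m.2.2)) h + poly_op c h)).
  by apply: Blin => //; apply: Bcomp => //; exact: Badj.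
by apply/funext => h; rewrite /poly_op big_cons.
Qed.

(** The norm closure of the polynomials. As it is itself a C*-subalgebra containing the isometries,
    it contains the algebra they generate. *)
Definition poly_approx : set (H -> H) := [set T | bounded_op T /\
  forall e, 0 < e -> exists c, forall h, hnorm (poly_op c h - T h) <= e * hnorm h].

Lemma poly_approx_lin (a : R[i]) T U : poly_approx T -> poly_approx U ->
  poly_approx (fun h => a *: T h + U h).
Proof.
move=> [bT TP] [bU UP]; split; first exact: bounded_op_lin.
have a0 : 0 <= complex.Re `|a| by rewrite normc_def sqrtr_ge0.
have a1 : 0 < complex.Re `|a| + 1 by rewrite ltr_wpDl.
move=> e e0; have [c cP] := TP (e / 2 / (complex.Re `|a| + 1)) (divr_gt0 (divr_gt0 e0 (ltr0n _ 2)) a1).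
have [c' cP'] := UP (e / 2) (divr_gt0 e0 (ltr0n _ 2)).
exists ([seq (a * m.1, m.2) | m : R[i] * (word * word) <- c] ++ c') => h.
rewrite -[poly_op _ h]/(fam_poly vol _ h) fam_poly_cat fam_poly_scale.
rewrite opprD addrACA -scalerBr [e in leRHS]splitr mulrDl.
apply: le_trans (ler_hnormD _ _) _; apply: lerD; last exact: cP'.
rewrite hnormZ; apply: le_trans (ler_wpM2l a0 (cP h)) _.
rewrite mulrA ler_wpM2r ?hnorm_ge0 // mulrCA ler_piMr //; first by rewrite divr_ge0 // ltW.
by rewrite ler_pdivrMr // mul1r lerDl.
Qed.

Lemma poly_approx_comp T U : poly_approx T -> poly_approx U -> poly_approx (T \o U).
Proof.
move=> [bT TP] [bU UP]; split; first exact: bounded_op_comp.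
have [M M0 TM] := bounded_op_gt0 bT; have [lT _] := bT.
have TB h k : T (h - k) = T h - T k.
  by rewrite addrC -scaleN1r lT scaleN1r addrC.
(* The order of choices matters: the precision asked of [c] depends on a bound of [c']. *)
move=> e e0; have [|c' cP'] := UP (e / 2 / M); first by rewrite !divr_gt0.
have [M' M'0 cM'] := bounded_op_gt0 (poly_op_bounded c').
have [|c cP] := TP (e / 2 / M'); first by rewrite !divr_gt0.
exists (poly_mul c c') => h.
rewrite -[poly_op _ h]/(fam_poly vol _ h) (fam_poly_mul volF) /=.
rewrite -(subrKA (T (poly_op c' h))) -TB [e in leRHS]splitr mulrDl.
apply: le_trans (ler_hnormD _ _) _; apply: lerD.
  apply: le_trans (cP _) _.
  have := ler_wpM2l (ltW (divr_gt0 (divr_gt0 e0 (ltr0n _ 2)) M'0)) (cM' h).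
  by rewrite mulrA divfK ?gt_eqF.
apply: le_trans (TM _) _; apply: le_trans (ler_wpM2l (ltW M0) (cP' h)) _.
by rewrite mulrA [M * _]mulrC divfK ?gt_eqF.
Qed.

Lemma poly_approx_adjoint T : poly_approx T -> poly_approx (adjoint T).
Proof.
(* [adjoint T] is zero by default if [T] has no adjoint. *)
have P0 : poly_approx (fun=> 0).
  have E0 : (fun=> 0) = poly_op ([::] : cuntz_poly R n).
    by apply/funext => h; rewrite /poly_op big_nil.
  rewrite E0; split; first exact: poly_op_bounded.
  by move=> e e0; exists [::] => h; rewrite subrr hnorm0 mulr_ge0 ?hnorm_ge0 // ltW.
move=> [bT TP]; rewrite /adjoint; case: xgetP => [U _ TU|//].
have UT h k : hform H (U h) k = hform H h (T k) by rewrite hformC -TU -hformC.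
have [M M0 TM] := bounded_op_gt0 bT; split.
  split; first exact: adj_linear UT.
  by exists M; apply: adjoint_bound TU TM; exact: ltW.
move=> e e0; have [c cP] := TP e e0; exists (poly_star c).
apply: adjoint_bound cP => [|h k]; first exact: ltW.
by rewrite hformBl hformBr TU -[poly_op c h]/(fam_poly vol c h) (fam_poly_star volF).
Qed.

Lemma poly_approx_subalgebra : cstar_subalgebra poly_approx.
Proof.
split.
- by move=> T [].
- exact: poly_approx_lin.
- exact: poly_approx_comp.
- exact: poly_approx_adjoint.
- move=> T_ T TA bT TT; split => // e e0.
  have e2 : 0 < e / 2 by rewrite divr_gt0.
  have [N HN] := TT _ e2; have [_ /(_ _ e2)[c cP]] := TA N; exists c => h.
  rewrite -(subrKA (T_ N h)) [e in leRHS]splitr mulrDl.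
  by apply: le_trans (ler_hnormD _ _) _; apply: lerD; [exact: cP|exact: HN].
Qed.

Lemma cuntz_algebra_approx T : cuntz_algebra R n T -> poly_approx T.
Proof.
move=> /(_ _ poly_approx_subalgebra); apply => _ [i _ <-].
rewrite cuntz_isometry_poly; split; first exact: poly_op_bounded.
by move=> e e0; exists [:: (1, ([:: i], [::]))] => h; rewrite subrr hnorm0 mulr_ge0 ?hnorm_ge0 // ltW.
Qed.

End CuntzAlgebra.

(** * The two inclusions *)

Section VolterraSubalgebra.
Context (R : realType) (m : nat).
Local Notation n := m.+2.
Local Notation word := (seq 'I_n).
Local Notation G := (cuntz_groupoid n).
Local Notation T := (tail_point m.+1).
Local Notation L := (@CL2_space _ T R (@counting T R : {measure set T -> \bar R})).
Local Notation H := (L2I R).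
Local Notation vol := (@volterra_mono R n).
Local Notation reg := (fun w v : word => reg_rep (chi R w v)).
Implicit Types (c : cuntz_poly R n) (e : R) (g : G).

Let volF : cuntz_family vol. Proof. exact: volterra_family. Qed.
Let regF : cuntz_family reg. Proof. exact: reg_family. Qed.

(* Entrywise convergence gives strong convergence of the adjoints, which is
   uniform because the sequence is Cauchy in norm. *)
Lemma reg_null_seq (d : nat -> cuntz_poly R n) :
  (forall e, 0 < e -> exists N, forall i j, (N <= i)%N -> (N <= j)%N ->
    forall xi, hnorm (fam_poly reg (d i) xi - fam_poly reg (d j) xi) <= e * hnorm xi) ->
  (forall (q p : T) e, 0 < e -> exists N, forall k, (N <= k)%N ->
    `|hform L (fam_poly reg (d k) (L2_delta R q)) (L2_delta R p)| <= e%:C%C) ->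
  forall e, 0 < e -> exists N, forall k, (N <= k)%N ->
    forall xi, hnorm (fam_poly reg (d k) xi) <= e * hnorm xi.
Proof.
move=> dC d0.
pose A k := fam_poly reg (d k); pose B k := fam_poly reg (poly_star (d k)).
have AB k xi eta : hform L (A k xi) eta = hform L xi (B k eta).
  exact: (fam_poly_star regF).
have BC e : 0 < e -> exists N, forall i j, (N <= i)%N -> (N <= j)%N ->
    forall xi, hnorm (B i xi - B j xi) <= e * hnorm xi.
  move=> e0; have [N HN] := dC e e0; exists N => i j Ni Nj.
  apply: (@adjoint_bound R L (fun xi => A i xi - A j xi)) => [|xi eta|]; first exact: ltW.
    by rewrite hformBl hformBr !AB.
  exact: HN.
have seqC (C : nat -> L -> L) : (forall e, 0 < e -> exists N, forall i j, (N <= i)%N -> (N <= j)%N ->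
      forall xi, hnorm (C i xi - C j xi) <= e * hnorm xi) ->
    forall xi e, 0 < e -> exists N, forall i j, (N <= i)%N -> (N <= j)%N ->
      hnorm (C i xi - C j xi) < e.
  move=> CC xi e e0; have p : 0 < hnorm xi + 1 by rewrite ltr_wpDl ?hnorm_ge0.
  have [N HN] := CC (e / (hnorm xi + 1)) (divr_gt0 e0 p); exists N => i j Ni Nj.
  apply: le_lt_trans (HN i j Ni Nj xi) _.
  by rewrite mulrAC ltr_pdivrMr // ltr_pM2l // ltrDl.
have col q : forall e, 0 < e -> exists N, forall k, (N <= k)%N -> hnorm (A k (L2_delta R q)) <= e.
  apply: (L2_coef_cvg0 (@tail_discrete m.+1)) => [|p e e0]; first exact: seqC.
  exact: d0.
(* The coordinate of B k xi at q is the conjugate of <A k delta_q, xi>, which is small because the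
   column A k delta_q tends to zero in norm. *)
have row xi : forall e, 0 < e -> exists N, forall k, (N <= k)%N -> hnorm (B k xi) <= e.
  apply: (L2_coef_cvg0 (@tail_discrete m.+1)) => [|q e e0]; first exact: seqC.
  have p : 0 < hnorm xi + 1 by rewrite ltr_wpDl ?hnorm_ge0.
  have [N HN] := col q _ (divr_gt0 e0 p); exists N => k /HN Ak.
  rewrite hformC norm_conjC -AB (le_trans (cauchy_schwarz _ _)) // lecR.
  apply: le_trans (ler_wpM2r (hnorm_ge0 xi) Ak) _.
  by rewrite mulrAC ler_pdivrMr // ler_pM2l // lerDl.
move=> e e0; have [N HN] := BC e e0; exists N => k Nk.
apply: (@adjoint_bound R L (B k)) => [|xi eta|xi]; first exact: ltW.
  by rewrite hformC -AB -hformC.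
(* [N'] depends on [xi], but it only enters through the auxiliary index; [N] does not depend on
   [xi]. *)
apply/ler_addgt0Pr => e' e'0; have [N' HN'] := row xi e' e'0.
rewrite -[B k xi](subrK (B (maxn N N') xi)) (le_trans (ler_hnormD _ _)) //.
by apply: lerD; [apply: HN; rewrite ?leq_maxl|apply: HN'; rewrite leq_maxr].
Qed.

(** E_w c E_v as a polynomial again, so that the comparison of norms applies to it. *)
Definition poly_cut (w v : word) c : cuntz_poly R n :=
  poly_mul [:: (1, (w, w))] (poly_mul c [:: (1, (v, v))]).

Lemma fam_poly_cut (K : prehilbert R) (s : word -> word -> K -> K) (w v : word) c h :
  cuntz_family s -> fam_poly s (poly_cut w v c) h = s w w (fam_poly s c (s v v h)).
Proof.
have one (u : word) k : fam_poly s [:: (1, (u, u))] k = s u u k.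
  by rewrite /fam_poly big_seq1 scale1r.
by move=> sF; rewrite !(fam_poly_mul sF) !one.
Qed.

Lemma reg_cut_dotE (w v : word) c (y : path_space n) (i : int) (x : path_space n) (j : int) :
  hform L (fam_poly reg (poly_cut w v c) (L2_delta R ((y, i) : T))) (L2_delta R ((x, j) : T)) =
  hform L (fam_poly reg c (if ptake (size v) y == v then L2_delta R ((y, i) : T) else 0))
    (if ptake (size w) x == w then L2_delta R ((x, j) : T) else 0).
Proof. by rewrite (fam_poly_cut _ _ _ _ regF) (fam_adj regF) !reg_rep_proj_delta. Qed.

Lemma poly_fun_cut (w v : word) c g : ptake (size w) (grng g) = w ->
  ptake (size v) (gsrc g) = v -> poly_fun (poly_cut w v c) g = poly_fun c g.
Proof.
move=> gw gv; have E c' := esym (reg_rep_coef g (Cc_tame (Cc_poly_fun c'))).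
by rewrite !E !(star_rep_poly (reg_star_rep R m.+1)) reg_cut_dotE gw gv !eqxx.
Qed.

(** Two basis vectors fix range, source and degree, hence a single groupoid element. It does not
    depend on the polynomial, so that the entry can be followed along a sequence. *)
Lemma reg_cut_dot (w v : word) c (y : path_space n) (i : int) (x : path_space n) (j : int) :
  hform L (fam_poly reg (poly_cut w v c) (L2_delta R ((y, i) : T))) (L2_delta R ((x, j) : T)) != 0 ->
  exists g, [/\ ptake (size w) (grng g) = w, ptake (size v) (gsrc g) = v &
    forall c', hform L (fam_poly reg (poly_cut w v c') (L2_delta R ((y, i) : T)))
      (L2_delta R ((x, j) : T)) = poly_fun c' g].
Proof.
rewrite reg_cut_dotE; case: (ptake _ y =P v) => [yv|_]; last first.
  rewrite (_ : fam_poly _ _ _ = 0) ?hform0l ?eqxx // /fam_poly big1 // => p _.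
  by rewrite (fam0 regF) scaler0.
case: (ptake _ x =P w) => [xw|_]; last by rewrite hform0r eqxx.
have E2 c' : hform L (fam_poly reg c' (L2_delta R ((y, i) : T))) (L2_delta R ((x, j) : T)) =
    \sum_(g \in [set g : G | [/\ grng g = x, gsrc g = y & gdeg g = j - i]]) poly_fun c' g.
  rewrite -(star_rep_poly (reg_star_rep R m.+1)) reg_rep_dot_delta //.
  exact/Cc_tame/Cc_poly_fun.
rewrite E2 => ne; have [g [gx gy gd]] : exists g, [/\ grng g = x, gsrc g = y & gdeg g = j - i].
  by apply: contrapT => N; case/eqP: ne; apply: fsbig1 => g gD; case: N; exists g.
exists g; rewrite gx gy; split => // c'; rewrite reg_cut_dotE yv xw !eqxx E2.
rewrite (_ : [set h : G | _] = [set g]) ?fsbig_set1 //.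
by apply/seteqP; split=> [h [h1 h2 h3]|_ -> //]; apply: gext; congruence.
Qed.

Lemma identified_nest_algebra (a : CstarG R n) (A : H -> H) :
  vanishing_off (PV n) a -> cuntz_identified a A ->
  bounded_op A -> nest_algebra (volterra_nest R) A.
Proof.
move=> aP [s [c [aE sE cA]]] bA; apply: (mono_nest_algebra (isT : 2 <= n)%N) => // w v h sz vw.
pose d k := poly_cut w v (c k).
have dC e : 0 < e -> exists N, forall i j, (N <= i)%N -> (N <= j)%N ->
    forall xi, hnorm (fam_poly reg (d i) xi - fam_poly reg (d j) xi) <= e * hnorm xi.
  move=> e0; have [N HN] := cseq_cauchy s e0; exists N => i j Ni Nj xi.
  have sP (f f' : L) : reg w w f - reg w w f' = reg w w (f - f').
    by rewrite addrC -scaleN1r -(fam_linear regF) scaleN1r addrC.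
  rewrite !(fam_poly_cut _ _ _ _ regF) sP -fam_poly_opp -fam_poly_cat.
  apply: le_trans (fam_contract regF _ _ _) _.
  apply: (@le_trans _ _ (e * hnorm (reg v v xi))); last first.
    by rewrite ler_wpM2l ?(fam_contract regF) // ltW.
  move: (reg_rep (chi R v v) xi); apply/(poly_op_regP _ (ltW e0)).
  apply/(poly_op_cstar_norm _ (ltW e0)).
  by rewrite poly_fun_cat_opp -!sE ltW // HN.
have d0 (q p : T) e : 0 < e -> exists N, forall k, (N <= k)%N ->
    `|hform L (fam_poly reg (d k) (L2_delta R q)) (L2_delta R p)| <= e%:C%C.
  case: q p => [y i] [x j] e0; have eC : 0 <= e%:C%C :> R[i] by rewrite ler0c ltW.
  (* Either the entry is zero for every polynomial of the sequence, or it is their value at an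
     element whose range comes after its source, thus outside PV. *)
  have [[k ne]|N] := pselect (exists k,
      hform L (fam_poly reg (d k) (L2_delta R ((y, i) : T))) (L2_delta R ((x, j) : T)) != 0); last first.
    exists 0%N => k _; rewrite (_ : hform _ _ _ = 0) ?normr0 //.
    by apply/eqP/contraT => ne; case: N; exists k.
  have [g [gw gv gE]] := reg_cut_dot ne; have gP : ~ PV n g.
    by move=> /PV_widx_le -/(_ (size w)); rewrite gw {1}sz gv leqNgt vw.
  have [N HN] := cstar_fun_cvg s g e0; exists N => l /HN.
  by rewrite -aE (aP g gP) subr0 gE sE.
have dn := reg_null_seq dC d0.
apply/(@hnorm_eq0 _ H)/eqP; rewrite eq_le hnorm_ge0 andbT.
apply: (@ler_eps_mul _ _ (hnorm h + hnorm h)) => [|e e0]; first by rewrite addr_ge0 ?hnorm_ge0.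
(* E_w A E_v is split into E_w (A - c_k) E_v, small by convergence in norm, and E_w c_k E_v, small
   in the regular representation and hence here. *)
have [N HN] := dn e e0; have [N' HN'] := cA e e0; pose k := maxn N N'.
rewrite -[A _](subrK (poly_op (c k) (vol v v h))) (famD volF) mulrDr.
apply: le_trans (ler_hnormD _ _) _; apply: lerD.
  apply: le_trans (fam_contract volF _ _ _) _; rewrite hnormBC.
  apply: le_trans (HN' k (leq_maxr _ _) _) _.
  by rewrite ler_wpM2l ?(fam_contract volF) // ltW.
rewrite -(fam_poly_cut w v (c k) h volF); move: h; apply/(poly_op_regP _ (ltW e0)).
exact/HN/leq_maxl.
Qed.

Lemma nest_algebra_identified (A : H -> H) :
  cuntz_algebra R n A -> nest_algebra (volterra_nest R) A ->
  exists2 a : CstarG R n, vanishing_off (PV n) a & cuntz_identified a A.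
Proof.
move=> /(cuntz_algebra_approx (isT : 2 <= n)%N) [bA AP] An.
have [c cA] : exists c : nat -> cuntz_poly R n, op_cvg (fun k => poly_op (c k)) A.
  have : forall k : nat, exists c, forall h, hnorm (poly_op c h - A h) <= k.+1%:R^-1 * hnorm h.
    by move=> k; apply: AP; rewrite invr_gt0.
  move=> /boolp.choice[c cP]; exists c => e e0.
  have [N HN] : exists N : nat, N.+1%:R^-1 <= e.
    exists (Num.bound e^-1); rewrite -[leRHS]invrK lef_pV2 ?posrE ?invr_gt0 //.
    rewrite ltW // (lt_trans (archi_boundP _)) ?invr_ge0 ?(ltW e0) // ltr_nat //.
  exists N => k Nk h; apply: le_trans (cP k h) _; rewrite ler_wpM2r ?hnorm_ge0 //.
  by apply: le_trans HN; rewrite lef_pV2 ?posrE // ler_nat.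
have cC e : 0 < e -> exists N, forall i j, (N <= i)%N -> (N <= j)%N ->
    (cstar_norm (poly_fun (c i) - poly_fun (c j))%R <= e%:E)%E.
  move=> e0; have [N HN] := cA _ (divr_gt0 e0 (ltr0n _ 2)); exists N => i j Ni Nj.
  rewrite -poly_fun_cat_opp; apply/(poly_op_cstar_norm _ (ltW e0)) => h.
  rewrite -[poly_op _ h]/(fam_poly vol _ h) fam_poly_cat fam_poly_opp.
  rewrite -(subrKA (A h)) [e]splitr mulrDl (le_trans (ler_hnormD _ _)) //.
  by apply: lerD; [|rewrite hnormBC]; apply: HN.
have sC e : 0 < e -> exists N, forall i j, (N <= i)%N -> (N <= j)%N ->
    (cstar_norm (poly_fun (c i) - poly_fun (c j))%R < e%:E)%E.
  move=> e0; have [N HN] := cC _ (divr_gt0 e0 (ltr0n _ 2)); exists N => i j Ni Nj.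
  apply: le_lt_trans (HN i j Ni Nj) _.
  by rewrite lte_fin gtr_pMr // invf_lt1 // ltr1n.
pose s := CauchySeq (fun k => Cc_poly_fun (c k)) sC.
exists (\pi_(CstarG R n)%qT s); last by exists s, c; split.
move=> g gP; apply/eqP; rewrite -normr_eq0 eq_le normr_ge0 andbT.
(* One [e] for the distance of the limit to the polynomial at [g], another for the polynomial
   itself, evaluated at [h] instead of [g]. *)
suff small e : 0 < e -> `|cstar_fun (\pi_(CstarG R n)%qT s) g| <= (e * 2)%:C%C.
  move: small; rewrite normc_def; set r := Num.sqrt _ => small; rewrite lecR.
  by apply: (@ler_eps_mul _ _ 2) => // e /small; rewrite lecR.
move=> e0; have [N1 H1] := cstar_fun_cvg s g e0.
have [N2 H2] := cA e e0; pose k := maxn N1 N2.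
(* The index [k] is fixed first: the neighbourhood on which the polynomial is constant, and with it
   [h], depend on [k]. *)
have [w [v [wvg wvE]]] := poly_fun_locally_cst (c k) g.
have [h [l [wvh lt]]] := PV_cylinder_gt wvg gP.
set al := ptake l (grng h) in lt; set be := ptake l (gsrc h) in lt.
(* As E A E vanishes for these two words, E c_k E equals E (c_k - A) E. *)
have cut_le u : hnorm (poly_op (poly_cut al be (c k)) u) <= e * hnorm u.
  rewrite -[poly_op _ u]/(fam_poly vol _ u) (fam_poly_cut _ _ _ _ volF).
  have Z : vol al al (A (vol be be u)) = 0.
    by apply: nest_algebra_mono => //; rewrite !size_ptake.
  rewrite -[vol al al _]subr0 -Z.
  have volB x y : vol al al x - vol al al y = vol al al (x - y).
    by rewrite addrC -scaleN1r -(fam_linear volF) scaleN1r addrC.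
  rewrite volB (le_trans (fam_contract volF _ _ _)) // (le_trans (H2 k (leq_maxr _ _) _)) //.
  by rewrite ler_wpM2l ?(fam_contract volF) // ltW.
have kh : `|poly_fun (c k) h| <= e%:C%C.
  rewrite -(@poly_fun_cut al be); [|by rewrite size_ptake..].
  by apply: poly_fun_le cut_le; exact: ltW.
rewrite -[cstar_fun _ g](subKr (poly_fun (c k) g)) (le_trans (ler_normB _ _)) //.
rewrite mulr_natr mulr2n rmorphD lerD //; first by rewrite -(wvE h wvh).
exact/H1/leq_maxl.
Qed.

End VolterraSubalgebra.

Theorem theorem6 (R : realType) (n : nat) (n_ge2 : (2 <= n)%N) :
  [set T | exists2 a : CstarG R n, vanishing_off (PV n) a &
                                   cuntz_identified a T] =
  cuntz_algebra R n `&` nest_algebra (volterra_nest R).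
Proof.
(* Writing n = m + 2 makes the alphabet visibly inhabited, as the types of paths and tails
   require. *)
case: n n_ge2 => [|[|m]] // n_ge2; apply/seteqP; split=> [T [a aP aT]|T [TO TN]]; last first.
  exact: nest_algebra_identified.
have [s [c [_ _ cT]]] := aT.
have bT : bounded_op T by apply: op_cvg_bounded cT => k; exact: poly_op_bounded.
split; last exact: (identified_nest_algebra aP).
move=> B BA SB; have [_ _ _ _ Bcl] := BA.
by apply: (Bcl _ T _ bT cT) => k; exact: poly_op_mem.
Qed.
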